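(* Let $A$ be the disjoint union of a square of area $1$, a right-angled isosceles triangle of area $2$, and a right-angled isosceles triangle of area $\frac12$, where one edge of the square has Neumann boundary conditions and the edge of length $\sqrt2$ (the hypotenuse) of the triangle of area $\frac12$ has Neumann boundary conditions. Let $B$ be the disjoint union of a right-angled isosceles triangle of area $1$, a rectangle of edge lengths $1$ and $2$, and a right-angled isosceles triangle of area $\frac12$, where one edge of length $\sqrt2$ (a leg) of the triangle of area $1$ has Neumann boundary conditions and one edge of length $1$ (a leg) of the triangle of area $\frac12$ has Neumann boundary conditions. All other edges in both $A$ and $B$ have Dirichlet boundary conditions. Then $A$ and $B$ are not isoheat. In particular: (i) for $t\to\infty$, $$Q_A(t)=\frac{1600}{9\pi^4}e^{-5\pi^2t/4}+O(e^{-2\pi^2t});$$ (ii) for $t\to\infty$, $$Q_B(t)=\frac{1664}{9\pi^4}e^{-5\pi^2t/4}+O(e^{-2\pi^2t}).$$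
   Context: For a disjoint union $M$ of planar polygons whose edges are each labelled Dirichlet or Neumann, the heat content is $Q_M(t)=\int_M u(x;t)\,dx$, where $u$ is the solution of the heat equation $\Delta u=\partial u/\partial t$ on $M$, $t>0$, with $\lim_{t\downarrow0}u(\cdot;t)=1$ in $L^2(M)$, $u(x;t)=0$ for $x$ on Dirichlet edges, and $\frac{\partial u}{\partial n}(x;t)=0$ for $x$ on Neumann edges ($n$ the outward unit normal), $t>0$. Equivalently, $Q_M(t)=\sum_{j\ge1}e^{-t\lambda_j(M)}\left(\int_M\phi_{j,M}(x)\,dx\right)^2$, where $\{\phi_{j,M}\}$ is an orthonormal basis of $L^2(M)$ of eigenfunctions of the Laplacian $-\Delta$ with these mixed boundary conditions and $\lambda_j(M)$ are the corresponding eigenvalues. Two such $M_1,M_2$ are isoheat if $Q_{M_1}(t)=Q_{M_2}(t)$ for all $t>0$. *)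

(* Defs.v *)
From HB Require Import structures.
From mathcomp Require Import all_boot all_order all_algebra.
From mathcomp Require Import all_classical all_reals all_analysis.

Set Implicit Arguments.
Unset Strict Implicit.
Unset Printing Implicit Defensive.

Import Order.TTheory GRing.Theory Num.Theory.
Import numFieldNormedType.Exports.

Local Open Scope classical_set_scope.
Local Open Scope ring_scope.

(* Makes the Landau notations of the library available at +oo. *)
Canonical pinfty_filter_on (R : realType) :=
  FilterType (@pinfty_nbhs R) (@proper_pinfty_nbhs R).

Variant boundary_condition := Dirichlet | Neumann.

(* A convex polygon with labelled edges is the list of its vertices in
   counterclockwise order; the label attached to a vertex is that of the edge
   from this vertex to the next one (cyclically). *)
Definition polygon (R : realType) := seq ((R * R) * boundary_condition).

Section Polygon.
Variables (R : realType) (P : polygon R).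

Definition vertex (i : nat) : R * R :=
  (nth ((0, 0), Dirichlet) P (i %% size P)).1.

Definition label (i : nat) : boundary_condition :=
  (nth ((0, 0), Dirichlet) P i).2.

Definition edge_vector (i : nat) : R * R := vertex i.+1 - vertex i.

Definition edge_length (i : nat) : R :=
  Num.sqrt ((edge_vector i).1 ^+ 2 + (edge_vector i).2 ^+ 2).

Definition edge (i : nat) : set (R * R) :=
  [set vertex i + s *: edge_vector i | s in `[0, 1]].

(* The edge without its two end points. *)
Definition open_edge (i : nat) : set (R * R) :=
  [set vertex i + s *: edge_vector i | s in `]0, 1[].

Definition outward_normal (i : nat) : R * R :=
  (edge_length i)^-1 *: ((edge_vector i).2, - (edge_vector i).1).

(* The open polygon: the points strictly to the left of every edge. *)
Definition region : set (R * R) :=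
  [set x | forall i, (i < size P)%N ->
     0 < (edge_vector i).1 * (x.2 - (vertex i).2)
         - (edge_vector i).2 * (x.1 - (vertex i).1)].

End Polygon.

Section HeatEquation.
Variable R : realType.

Definition area_measure :
    {measure set (measurableTypeR R * measurableTypeR R) -> \bar R} :=
  (@lebesgue_measure R \x @lebesgue_measure R)%E.

Definition partial1 (v : R * R -> R) : R * R -> R := 'D_(1, 0) v.
Definition partial2 (v : R * R -> R) : R * R -> R := 'D_(0, 1) v.

Definition laplacian (v : R * R -> R) (x : R * R) : R :=
  partial1 (partial1 v) x + partial2 (partial2 v) x.

Definition C1_on (D : set (R * R)) (v : R * R -> R) : Prop :=
  forall x, D x ->
    [/\ derivable v x (1, 0), derivable v x (0, 1),
        {for x, continuous (partial1 v)} & {for x, continuous (partial2 v)}].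

Definition C2_on (D : set (R * R)) (v : R * R -> R) : Prop :=
  [/\ C1_on D v, C1_on D (partial1 v) & C1_on D (partial2 v)].

Definition time_derivative (u : R -> R * R -> R) (t : R) (x : R * R) : R :=
  ((fun s => u s x)^`())%classic t.

(* u is a classical solution on one polygon of the heat equation for t > 0 with
   the given mixed boundary conditions.  As usual on polygons, the gradient is
   required to extend continuously to the interior of each edge, but not to the
   vertices, where the solution may be singular; the normal derivative at a
   point of an edge is the limit of n . grad u from inside the polygon. *)
Record mixed_heat_equation (P : polygon R) (u : R -> R * R -> R) : Prop := {
  heat_continuous :
    {within [set z : R * (R * R) | 0 < z.1 /\ closure (region P) z.2],
      continuous (fun z => u z.1 z.2)};
  heat_derivable : forall (t : R) (x : R * R), 0 < t -> closure (region P) x ->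
    derivable (fun s => u s x) t 1;
  heat_time_derivative_continuous :
    {within [set z : R * (R * R) | 0 < z.1 /\ closure (region P) z.2],
      continuous (fun z => time_derivative u z.1 z.2)};
  heat_C2 : forall t : R, 0 < t -> C2_on (region P) (u t);
  heat_gradient_boundary : forall (t : R) i (x : R * R),
    0 < t -> (i < size P)%N -> open_edge P i x ->
    cvg (partial1 (u t) y @[y --> within (region P) (nbhs x)]) /\
    cvg (partial2 (u t) y @[y --> within (region P) (nbhs x)]);
  heat_equation : forall (t : R) (x : R * R), 0 < t -> region P x ->
    laplacian (u t) x = time_derivative u t x;
  heat_Dirichlet : forall (t : R) i (x : R * R),
    0 < t -> (i < size P)%N -> label P i = Dirichlet -> edge P i x ->
    u t x = 0;
  heat_Neumann : forall (t : R) i (x : R * R),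
    0 < t -> (i < size P)%N -> label P i = Neumann -> open_edge P i x ->
    (outward_normal P i).1 * partial1 (u t) y
      + (outward_normal P i).2 * partial2 (u t) y
      @[y --> within (region P) (nbhs x)] --> (0 : R)
}.

(* A disjoint union of polygons is the list of its components, each placed in
   its own copy of the plane; a function on it is a family of functions indexed
   by the components. *)
Definition heat_solution (M : seq (polygon R))
    (u : 'I_(size M) -> R -> R * R -> R) : Prop :=
  (forall i : 'I_(size M), mixed_heat_equation (nth [::] M i) (u i)) /\
  (\sum_(i < size M)
     \int[area_measure]_(x in region (nth [::] M i)) ((u i t x - 1) ^+ 2)%:E)%E
    @[t --> 0^'+] --> 0%E.

Definition heat_content (M : seq (polygon R))
    (u : 'I_(size M) -> R -> R * R -> R) (t : R) : R :=
  \sum_(i < size M) \int[area_measure]_(x in region (nth [::] M i)) u i t x.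

(* Since the solution of the heat problem is unique, the heat contents compared
   here are those of M1 and M2. *)
Definition isoheat (M1 M2 : seq (polygon R)) : Prop :=
  exists u1 u2, [/\ @heat_solution M1 u1, @heat_solution M2 u2 &
    forall t : R, 0 < t -> heat_content u1 t = heat_content u2 t].

Definition A : seq (polygon R) :=
  [:: (* square of side 1, one edge Neumann *)
      [:: ((0, 0), Neumann); ((1, 0), Dirichlet);
          ((1, 1), Dirichlet); ((0, 1), Dirichlet)];
      (* legs of length 2 *)
      [:: ((0, 0), Dirichlet); ((2, 0), Dirichlet); ((0, 2), Dirichlet)];
      (* legs of length 1, hypotenuse Neumann *)
      [:: ((0, 0), Dirichlet); ((1, 0), Neumann); ((0, 1), Dirichlet)]].

Definition B : seq (polygon R) :=
  [:: (* hypotenuse of length 2 on the horizontal axis, one leg Neumann *)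
      [:: ((0, 0), Dirichlet); ((2, 0), Neumann); ((1, 1), Dirichlet)];
      (* rectangle with edges of lengths 2 and 1 *)
      [:: ((0, 0), Dirichlet); ((2, 0), Dirichlet);
          ((2, 1), Dirichlet); ((0, 1), Dirichlet)];
      (* legs of length 1, one leg Neumann *)
      [:: ((0, 0), Neumann); ((1, 0), Dirichlet); ((0, 1), Dirichlet)]].

End HeatEquation.

(* Main.v *)
(* Each component has a positive Dirichlet-Neumann eigenfunction phi1, a sine
   polynomial vanishing exactly on the Dirichlet edges. Cutting off with C^2
   functions of phi1 and of the distance to the Neumann edge, where the mass of
   their second derivatives stays bounded, gives Green's formula between a heat
   flow u and every eigenfunction f with |f| <= C phi1, even though u is not
   controlled at the vertices; hence int u(t) f = exp(- lambda t) int f.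

   Completeness of the eigenfunctions is replaced by an approximation of 1: the
   iterates of r -> r (3 - r^2) / 2 starting from phi1 are again finite sums of
   eigenfunctions, lie between 0 and 1, and converge to 1 pointwise. Pairing them
   with u(t), Bessel's inequality bounds the contribution of the eigenvalues
   >= 2 pi^2 by area * exp(- 2 pi^2 t), and below 2 pi^2 the only eigenvalue that
   occurs is 5 pi^2 / 4, at most once. So the component has heat content
   (int e)^2 / (int e^2) exp(- 5 pi^2 t / 4) + O(exp(- 2 pi^2 t)), with e the
   corresponding eigenfunction: the coefficients are 64 / pi^4 and 1024 / (9 pi^4)
   for the square and the large triangle of A, 128 / pi^4 and 512 / (9 pi^4) for
   the rectangle and the large triangle of B, and 0 for the two small triangles. *)
Require Import Defs.
From HB Require Import structures.
From mathcomp Require Import all_boot all_order all_algebra.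
From mathcomp Require Import all_classical all_reals all_analysis.
From mathcomp Require Import measurable_realfun ring lra zify.
Set Implicit Arguments.
Unset Strict Implicit.
Unset Printing Implicit Defensive.

Import Order.TTheory GRing.Theory Num.Theory.
Import numFieldNormedType.Exports.
Local Open Scope classical_set_scope.
Local Open Scope ring_scope.

(** The gradient of [u] may blow up at the vertices, so [u] cannot be integrated by parts directly.
    Every component has at most one Neumann edge; hence each vertex lies on a Dirichlet edge, where
    [phi1] vanishes, and a cutoff in [phi1] removes vertices and Dirichlet edges together. What
    remains to be killed is [u] times a second derivative of the cutoff. By convexity this weight is
    nonnegative, Green's identity with the constant 1 in place of [u] bounds its mass, and it
    concentrates where [u] tends to 0. Domination by [phi1] makes [phi1 + c f] positive for small
    [c], which extends the formula to eigenfunctions that change sign; the domination itself rests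
    on sin (n x) / sin x being a polynomial in cos x. The iteration has to be odd: a product of
    three sines is again a sum of sines, with frequencies of the right parities, while an even power
    would leave this class. In units of pi / 2 the modes have integer frequencies i, j and
    eigenvalue pi^2 / 4 times i^2 + j^2, so the two exponents correspond to the numbers 5 and 8. *)

Notation mR2 R := (measurableTypeR R * measurableTypeR R)%type.
Notation mu2 := (@area_measure _).

(** * Integration and divergence in the plane *)

Section PlaneMeasure.
Variable R : realType.
Implicit Types (D A : set (R * R)) (f g : R * R -> R).

(** The product sigma-algebra is generated by rectangles, so an open set has to be written as a
    countable union of them: all rational boxes, with [set0] in place of those not contained in
    [A]. *)
Lemma open_measurable2 A : open A -> measurable (A : set (mR2 R)).
Proof.
move=> oA.
pose box (q : (rat * rat) * (rat * rat)) : set (R * R) :=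
  `]ratr q.1.1, ratr q.1.2[%classic `*` `]ratr q.2.1, ratr q.2.2[%classic.
have -> : (A : set (mR2 R)) = \bigcup_(q : rat * rat * (rat * rat))
    (if `[< box q `<=` A >] then box q else set0).
  apply/seteqP; split; last first.
    by move=> z [q _]; case: asboolP => // qA; exact: qA.
  move=> [x y] Axy.
  have /nbhs_ballP[e /= e0 eA] := open_nbhs_nbhs (conj oA Axy).
  have itv (s : R) : exists a b : rat,
      [/\ ratr a \in `]s - e, s[, ratr b \in `]s, s + e[ & true].
    have [a ha] := @rat_in_itvoo R (s - e) s ltac:(lra).
    have [b hb] := @rat_in_itvoo R s (s + e) ltac:(lra).
    by exists a, b.
  have [a [b [ha hb _]]] := itv x; have [c [d [hc hd _]]] := itv y.
  exists ((a, b), (c, d)) => //=.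
  move: ha hb hc hd; rewrite !in_itv/= => /andP[a1 a2] /andP[b1 b2].
  move=> /andP[c1 c2] /andP[d1 d2].
  case: asboolP => [_|]; last first.
    case; move=> [u v] [/=]; rewrite !in_itv/= => /andP[u1 u2] /andP[v1 v2].
    by apply: eA; split; rewrite /ball/= ltr_norml; apply/andP; split; lra.
  by split => /=; rewrite in_itv/= ?a2 ?c2.
apply: countable_bigcupT_measurable; first exact: countableP.
move=> q; case: asboolP => // _.
by apply: measurableX; exact: measurable_itv.
Qed.

Lemma continuous_measurable2 D f : open D ->
  (forall z, D z -> {for z, continuous f}) ->
  measurable_fun (D : set (mR2 R)) f.
Proof.
move=> oD cf.
apply: (measurability _ (RGenOInfty.measurableE R)).
move=> _ [_ [a ->] <-].
apply: open_measurable2.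
rewrite openE => z [Dz /= fz]; apply: filterI; first exact: open_nbhs_nbhs.
by apply: (cf z Dz); apply: open_nbhs_nbhs; split => //; exact: interval_open.
Qed.

(** These functions form an algebra and are integrable on sets of finite area, so the integrability
    conditions below reduce to closure properties. *)
Definition bmeas D f := measurable_fun (D : set (mR2 R)) f /\
  exists M : R, forall z, D z -> `|f z| <= M.

Lemma bmeasD D f g : bmeas D f -> bmeas D g -> bmeas D (fun z => f z + g z).
Proof.
move=> [mf [M Mf]] [mg [N Ng]]; split; first exact: measurable_funD.
by exists (M + N) => z Dz; rewrite (le_trans (ler_normD _ _))// lerD ?Mf ?Ng.
Qed.

Lemma bmeasN D f : bmeas D f -> bmeas D (fun z => - f z).
Proof.
move=> [mf [M Mf]]; split; first exact: measurableT_comp.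
by exists M => z Dz; rewrite normrN Mf.
Qed.

Lemma bmeasB D f g : bmeas D f -> bmeas D g -> bmeas D (fun z => f z - g z).
Proof. by move=> hf hg; apply: bmeasD => //; exact: bmeasN. Qed.

Lemma bmeasM D f g : bmeas D f -> bmeas D g -> bmeas D (fun z => f z * g z).
Proof.
move=> [mf [M Mf]] [mg [N Ng]]; split; first exact: measurable_funM.
by exists (M * N) => z Dz; rewrite normrM ler_pM ?Mf ?Ng.
Qed.

Lemma bmeas_cst D (c : R) : bmeas D (fun=> c).
Proof. by split; [exact: measurable_cst|exists `|c|]. Qed.

Lemma bmeasZ D (c : R) f : bmeas D f -> bmeas D (fun z => c * f z).
Proof. by move=> bf; apply: bmeasM => //; exact: bmeas_cst. Qed.

Lemma bmeas_norm D f : bmeas D f -> bmeas D (fun z => `|f z|).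
Proof.
move=> [mf [M Mf]]; split; first exact: measurableT_comp.
by exists M => z Dz; rewrite normr_id Mf.
Qed.

Lemma bmeas_sum D (I : Type) (s : seq I) (F : I -> R * R -> R) :
  (forall i, bmeas D (F i)) -> bmeas D (fun z => \sum_(i <- s) F i z).
Proof.
move=> hF; elim: s => [|i s ih].
  by under eq_fun do rewrite big_nil; exact: bmeas_cst.
by under eq_fun do rewrite big_cons; exact: bmeasD.
Qed.

Section Integral.
Variable D : set (R * R).
Hypotheses (mD : measurable (D : set (mR2 R))) (fD : (mu2 D < +oo)%E).

Lemma bmeas_integrable f : bmeas D f -> mu2.-integrable D (EFin \o f).
Proof.
move=> [mf [M Mf]]; apply: measurable_bounded_integrable => //.
exists M; split; first by rewrite num_real.
by move=> N MN z Dz /=; rewrite (le_trans (Mf z Dz))// ltW.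
Qed.

Lemma intD f g : bmeas D f -> bmeas D g ->
  \int[mu2]_(z in D) (f z + g z) = \int[mu2]_(z in D) f z + \int[mu2]_(z in D) g z.
Proof. by move=> ? ?; rewrite RintegralD//; exact: bmeas_integrable. Qed.

Lemma intB f g : bmeas D f -> bmeas D g ->
  \int[mu2]_(z in D) (f z - g z) = \int[mu2]_(z in D) f z - \int[mu2]_(z in D) g z.
Proof. by move=> ? ?; rewrite RintegralB//; exact: bmeas_integrable. Qed.

Lemma intZ (c : R) f : bmeas D f ->
  \int[mu2]_(z in D) (c * f z) = c * \int[mu2]_(z in D) f z.
Proof. by move=> ?; rewrite RintegralZl//; exact: bmeas_integrable. Qed.

Lemma le_int f g : bmeas D f -> bmeas D g -> (forall z, D z -> f z <= g z) ->
  \int[mu2]_(z in D) f z <= \int[mu2]_(z in D) g z.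
Proof. by move=> ? ? ?; apply: le_Rintegral => //; exact: bmeas_integrable. Qed.

Lemma norm_int f : bmeas D f ->
  `|\int[mu2]_(z in D) f z| <= \int[mu2]_(z in D) `|f z|.
Proof. by move=> ?; apply: le_normr_Rintegral => //; exact: bmeas_integrable. Qed.

Lemma eq_int f g : (forall z, D z -> f z = g z) ->
  \int[mu2]_(z in D) f z = \int[mu2]_(z in D) g z.
Proof. by move=> fg; apply: eq_Rintegral => z /set_mem/fg. Qed.

Lemma int_sum (I : Type) (s : seq I) (F : I -> R * R -> R) :
  (forall i, bmeas D (F i)) ->
  \int[mu2]_(z in D) (\sum_(i <- s) F i z) = \sum_(i <- s) \int[mu2]_(z in D) F i z.
Proof.
move=> hF; elim: s => [|i s ih].
  rewrite big_nil; under eq_Rintegral do rewrite big_nil.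
  by rewrite Rintegral_cst// mul0r.
rewrite big_cons -ih; under eq_Rintegral do rewrite big_cons.
by rewrite intD//; exact: bmeas_sum.
Qed.

Lemma bounded_cvg_int (F : nat -> R * R -> R) f (M : R) :
  (forall n, measurable_fun (D : set (mR2 R)) (F n)) ->
  (forall n z, D z -> `|F n z| <= M) -> measurable_fun (D : set (mR2 R)) f ->
  (forall z, D z -> F n z @[n --> \oo] --> f z) ->
  \int[mu2]_(z in D) F n z @[n --> \oo] --> \int[mu2]_(z in D) f z.
Proof.
move=> mF bF mf cF.
have bc : bmeas D (cst M) by exact: bmeas_cst.
have [|||||intf _ h] := @dominated_convergence _ _ _ mu2 D mD
  (fun n z => (F n z)%:E) (EFin \o f) (EFin \o cst M).
- by move=> n; apply/measurable_EFinP.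
- exact/measurable_EFinP.
- by apply: aeW => z Dz; apply: cvg_EFin; [exact: nearW|exact: cF].
- exact: bmeas_integrable.
- by apply: aeW => z n Dz; rewrite lee_fin; exact: bF.
apply: fine_cvg; rewrite fineK//; apply: integrable_fin_num => //.
Qed.

End Integral.
End PlaneMeasure.

Section Slices.
Variable R : realType.
Implicit Types (D A : set (R * R)) (f g F : R * R -> R).

Lemma FTC (F f : R -> R) (a b : R) : a <= b ->
  (forall x : R, is_derive x 1 F (f x)) -> continuous f ->
  \int[lebesgue_measure]_(x in `[a, b]) f x = F b - F a.
Proof.
rewrite le_eqVlt => /predU1P[<- _ _|ab dF cf].
  by rewrite set_itv1 Rintegral_set1 subrr.
have cF : continuous F.
  by move=> x; apply: differentiable_continuous; apply/derivable1_diffP; case: (dF x).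
rewrite /Rintegral (@continuous_FTC2 _ f F)//.
- exact: continuous_subspaceT.
- split; first by move=> x _; case: (dF x).
  + exact/cvg_at_right_filter/cF.
  + exact/cvg_at_left_filter/cF.
- by move=> x _; rewrite derive1E; case: (dF x).
Qed.

Definition box (M : R) : set (R * R) := `[- M, M] `*` `[- M, M].

Lemma boxP M (z : R * R) : box M z <-> `|z.1| <= M /\ `|z.2| <= M.
Proof. by rewrite /box /= !in_itv/= !ler_norml. Qed.

Lemma compact_box M : compact (box M).
Proof. by apply: compact_setX; exact: segment_compact. Qed.

Lemma measurable_box M : measurable (box M : set (mR2 R)).
Proof. by apply: measurableX; exact: measurable_itv. Qed.

Lemma area_box M : (mu2 (box M) < +oo)%E.
Proof.
have -> : mu2 (box M) =
    (lebesgue_measure `[(- M)%R, M] * lebesgue_measure `[(- M)%R, M])%E.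
  by apply: product_measure1E; exact: measurable_itv.
by rewrite -ge0_fin_numE ?mule_ge0// fin_numM// lebesgue_measure_itv/=; case: ifP.
Qed.

Lemma continuous_bounded_compact (K : set (R * R)) f : compact K ->
  {within K, continuous f} -> exists M, forall z, K z -> `|f z| <= M.
Proof.
move=> cK cf; have /compact_bounded[M [_ hM]] := continuous_compact cf cK.
exists (M + 1) => z Kz; apply: (hM (M + 1)); first by rewrite ltrDl.
by exists z.
Qed.

Section CompactSupport.
Variables (M : R) (F f : R * R -> R).
Hypotheses (cf : continuous f) (f0 : forall z, ~ box M z -> f z = 0).

Let bf : bmeas setT f.
Proof.
split; first by apply: continuous_measurable2; [exact: openT|move=> z _; exact: cf].
have [N hN] := continuous_bounded_compact (@compact_box M)
  (continuous_subspaceT (A := box M) cf).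
exists `|N| => z _; have [Bz|/f0->] := pselect (box M z); last by rewrite normr0.
by rewrite (le_trans (hN z Bz))// ler_norm.
Qed.

Let restrf : f = f \_ (box M).
Proof.
by apply/funext => z; rewrite patchE; case: ifPn => // /negP; rewrite inE => /f0.
Qed.

Lemma integrable_compact_support : mu2.-integrable setT (EFin \o f).
Proof.
rewrite restrf -restrict_EFin.
apply/(integrable_mkcond _ (@measurable_box M)).
apply: bmeas_integrable; [exact: measurable_box|exact: area_box|].
by case: bf => mf [N hN]; split; [exact: measurable_funTS|exists N => z _; exact: hN].
Qed.

Lemma int_partial1_setT :
  (forall x y : R, is_derive x 1 (fun s => F (s, y)) (f (x, y))) ->
  (forall z, ~ box M z -> F z = 0) -> \int[mu2]_z f z = 0.
Proof.
move=> dF F0; rewrite /Rintegral -[X in fine X]/(\int[mu2]_z (EFin \o f) z)%E.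
rewrite /area_measure -integral21_prod_meas1; last exact: integrable_compact_support.
rewrite integral0_eq// => y _; rewrite /fubini_G/=.
(* Strictly larger than [M], so that both end points of the slice lie off the closed box, where [F]
   vanishes. *)
pose N := `|M| + 1.
have hN z : ~ (- N < z < N) -> ~ (`|z| <= M).
  move=> h1 h2; apply: h1; rewrite -ltr_norml (le_lt_trans h2)// /N.
  by rewrite (le_lt_trans (ler_norm M))// ltrDl.
have -> : (\int[lebesgue_measure]_x (f (x, y))%:E =
    \int[lebesgue_measure]_(x in `[(- N)%R, N]) (f (x, y))%:E)%E.
  rewrite [RHS]integral_mkcond; apply: eq_integral => x _; rewrite patchE.
  case: ifPn => // /negP; rewrite inE/= in_itv/= => h.
  rewrite f0// => /boxP[/= + _]; apply: hN => /andP[a b]; apply: h.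
  by rewrite !ltW.
have cs : continuous (fun x => f (x, y)).
  move=> x; apply: (@continuous_comp _ _ _ (fun x : R => (x, y)) f (x : R)); last exact: cf.
  by apply: (@cvg_pair _ _ _ _ (nbhs x) (nbhs y)); [exact: cvg_id|exact: cvg_cst].
have NN : - N <= N by rewrite ge0_cp ?addr_ge0.
have := FTC NN (fun x => dF x y) cs; rewrite !F0 ?subrr; last 2 first.
- by move=> /boxP[/= + _]; apply: hN; rewrite ltxx.
- by move=> /boxP[/= + _]; apply: hN; rewrite ltxx andbF.
(* [fine] also sends the infinities to 0, so the extended integral is known to vanish only once it
   is finite. *)
rewrite /Rintegral => /eqP; rewrite fine_eq0 ?fin_numE.
  by move=> /eqP.
rewrite -fin_numE; apply: integrable_fin_num => //.
apply: continuous_compact_integrable; first exact: segment_compact.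
exact: continuous_subspaceT.
Qed.

Lemma int_partial2_setT :
  (forall x y : R, is_derive y 1 (fun s => F (x, s)) (f (x, y))) ->
  (forall z, ~ box M z -> F z = 0) -> \int[mu2]_z f z = 0.
Proof.
move=> dF F0; rewrite /Rintegral -[X in fine X]/(\int[mu2]_z (EFin \o f) z)%E.
rewrite /area_measure -integral12_prod_meas1; last exact: integrable_compact_support.
rewrite integral0_eq// => x _; rewrite /fubini_F/=.
pose N := `|M| + 1.
have hN z : ~ (- N < z < N) -> ~ (`|z| <= M).
  move=> h1 h2; apply: h1; rewrite -ltr_norml (le_lt_trans h2)// /N.
  by rewrite (le_lt_trans (ler_norm M))// ltrDl.
have -> : (\int[lebesgue_measure]_y (f (x, y))%:E =
    \int[lebesgue_measure]_(y in `[(- N)%R, N]) (f (x, y))%:E)%E.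
  rewrite [RHS]integral_mkcond; apply: eq_integral => y _; rewrite patchE.
  case: ifPn => // /negP; rewrite inE/= in_itv/= => h.
  rewrite f0// => /boxP[/= _ +]; apply: hN => /andP[a b]; apply: h.
  by rewrite !ltW.
have cs : continuous (fun y => f (x, y)).
  move=> y; apply: (@continuous_comp _ _ _ (fun y : R => (x, y)) f (y : R)); last exact: cf.
  by apply: (@cvg_pair _ _ _ _ (nbhs x) (nbhs y)); [exact: cvg_cst|exact: cvg_id].
have NN : - N <= N by rewrite ge0_cp ?addr_ge0.
have := FTC NN (fun y => dF x y) cs; rewrite !F0 ?subrr; last 2 first.
- by move=> /boxP[/= _ +]; apply: hN; rewrite ltxx.
- by move=> /boxP[/= _ +]; apply: hN; rewrite ltxx andbF.
rewrite /Rintegral => /eqP; rewrite fine_eq0 ?fin_numE.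
  by move=> /eqP.
rewrite -fin_numE; apply: integrable_fin_num => //.
apply: continuous_compact_integrable; first exact: segment_compact.
exact: continuous_subspaceT.
Qed.

End CompactSupport.

End Slices.

Section InteriorDivergence.
Variable R : realType.
Implicit Types (D : set (R * R)) (f F : R * R -> R).

Lemma near_slice1 (P : R * R -> Prop) (x y : R) :
  (\forall z \near (x, y), P z) -> \forall s \near x, P (s, y).
Proof.
move=> h; have : (fun s : R => (s, y)) @ x --> (x, y).
  by apply: (@cvg_pair _ _ _ _ (nbhs x) (nbhs y)); [exact: cvg_id|exact: cvg_cst].
by move=> /(_ _ h).
Qed.

Lemma near_slice2 (P : R * R -> Prop) (x y : R) :
  (\forall z \near (x, y), P z) -> \forall s \near y, P (x, s).
Proof.
move=> h; have : (fun s : R => (x, s)) @ y --> (x, y).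
  by apply: (@cvg_pair _ _ _ _ (nbhs x) (nbhs y)); [exact: cvg_cst|exact: cvg_id].
by move=> /(_ _ h).
Qed.

(** Vanishing on a whole neighbourhood within [D] of every outside point lets the extension by zero
    inherit continuity and differentiability, with no regularity of [f] up to the boundary. *)
Definition vanishes_at_boundary D f :=
  forall z, ~ D z -> \forall z' \near z, D z' -> f z' = 0.

Section Extension.
Variables (D : set (R * R)) (f : R * R -> R).
Hypotheses (oD : open D) (f0 : vanishes_at_boundary D f).

Lemma near_restrict_out z : ~ D z -> \forall z' \near z, (f \_ D) z' = 0.
Proof.
move=> /f0; apply: filterS => z' h; rewrite patchE; case: ifPn => //.
by rewrite inE => /h.
Qed.

Lemma near_restrict_in z : D z -> \forall z' \near z, (f \_ D) z' = f z'.
Proof.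
move=> Dz; have : nbhs z D by exact: open_nbhs_nbhs.
by apply: filterS => z' Dz'; rewrite patchE mem_set.
Qed.

Lemma restrict_out z : ~ D z -> (f \_ D) z = 0.
Proof. by move=> Dz; rewrite patchE memNset. Qed.

Lemma restrict_in z : D z -> (f \_ D) z = f z.
Proof. by move=> Dz; rewrite patchE mem_set. Qed.

Lemma continuous_restrict0 :
  (forall z, D z -> {for z, continuous f}) -> continuous (f \_ D).
Proof.
move=> cf z; have [Dz|nDz] := pselect (D z).
  rewrite /continuous_at restrict_in//.
  apply: cvg_trans (cf z Dz); apply: near_eq_cvg.
  by apply: filterS (near_restrict_in Dz) => z' ->.
rewrite /continuous_at restrict_out//.
apply: cvg_trans (@cvg_cst _ (0 : R) _ (nbhs z) _); apply: near_eq_cvg.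
by apply: filterS (near_restrict_out nDz) => z' ->.
Qed.

End Extension.

Lemma derive1_restrict0 D F f : open D -> vanishes_at_boundary D F ->
  (forall x y : R, D (x, y) -> is_derive x 1 (fun s => F (s, y)) (f (x, y))) ->
  forall x y : R, is_derive x 1 (fun s => (F \_ D) (s, y)) ((f \_ D) (x, y)).
Proof.
move=> oD F0 dF x y; have [Dz|nDz] := pselect (D (x, y)).
  rewrite restrict_in//; apply: near_eq_is_derive (dF _ _ Dz).
  by apply: (@near_slice1 (fun z => F z = (F \_ D) z)); apply: filterS (near_restrict_in F oD Dz).
rewrite restrict_out//; apply: (@near_eq_is_derive _ _ _ (cst 0)).
by apply: (@near_slice1 (fun z => cst 0 z.1 = (F \_ D) z)); apply: filterS (near_restrict_out F0 nDz).
Qed.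

Lemma derive2_restrict0 D F f : open D -> vanishes_at_boundary D F ->
  (forall x y : R, D (x, y) -> is_derive y 1 (fun s => F (x, s)) (f (x, y))) ->
  forall x y : R, is_derive y 1 (fun s => (F \_ D) (x, s)) ((f \_ D) (x, y)).
Proof.
move=> oD F0 dF x y; have [Dz|nDz] := pselect (D (x, y)).
  rewrite restrict_in//; apply: near_eq_is_derive (dF _ _ Dz).
  by apply: (@near_slice2 (fun z => F z = (F \_ D) z)); apply: filterS (near_restrict_in F oD Dz).
rewrite restrict_out//; apply: (@near_eq_is_derive _ _ _ (cst 0)).
by apply: (@near_slice2 (fun z => cst 0 z.1 = (F \_ D) z)); apply: filterS (near_restrict_out F0 nDz).
Qed.

Section Divergence.
Variables (D : set (R * R)) (M : R) (F f : R * R -> R).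
Hypotheses (oD : open D) (DM : D `<=` box M).
Hypotheses (F0 : vanishes_at_boundary D F) (f0 : vanishes_at_boundary D f).
Hypothesis cf : forall z, D z -> {for z, continuous f}.

Let cont := continuous_restrict0 oD f0 cf.

Let out g z : ~ box M z -> (g \_ D) z = 0 :> R.
Proof. by move=> nB; rewrite restrict_out// => /DM. Qed.

Lemma bmeas_vanishing : bmeas D f.
Proof.
split; first exact: continuous_measurable2.
have [N hN] := continuous_bounded_compact (@compact_box R M)
  (continuous_subspaceT (A := box M) cont).
by exists N => z Dz; rewrite -(restrict_in f Dz); exact/hN/DM.
Qed.

(** Extension by zero reduces to the whole plane, where Fubini and the fundamental theorem on a
    slice give 0; the shape of [D] never enters. *)
Lemma int_partial1_eq0 :
  (forall x y : R, D (x, y) -> is_derive x 1 (fun s => F (s, y)) (f (x, y))) ->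
  \int[mu2]_(z in D) f z = 0.
Proof.
move=> dF; rewrite Rintegral_mkcond.
by apply: (@int_partial1_setT _ M (F \_ D)) => //; [exact: out|exact: derive1_restrict0|exact: out].
Qed.

Lemma int_partial2_eq0 :
  (forall x y : R, D (x, y) -> is_derive y 1 (fun s => F (x, s)) (f (x, y))) ->
  \int[mu2]_(z in D) f z = 0.
Proof.
move=> dF; rewrite Rintegral_mkcond.
by apply: (@int_partial2_setT _ M (F \_ D)) => //; [exact: out|exact: derive2_restrict0|exact: out].
Qed.

End Divergence.
End InteriorDivergence.

(** * Cutoffs *)

Section Cutoff.
Variable R : realType.
Implicit Types (e s : R).

Lemma is_derive_glue (h h' : R -> R) e : h e = 0 -> h' e = 0 ->
  (forall s, e <= s -> is_derive s 1 h (h' s)) ->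
  forall s, is_derive s 1 (fun s => if s <= e then 0 else h s)
    (if s <= e then 0 else h' s).
Proof.
move=> he h'e dh s; have [se|se|->] := ltgtP s e.
- apply: (@near_eq_is_derive _ _ _ (cst 0)) => //.
  by near=> t; rewrite ifT//; near: t; exact: lt_le_nbhsl.
- apply: (@near_eq_is_derive _ _ _ h); last exact/dh/ltW.
  near=> t; rewrite ifF//; apply/negbTE; rewrite -ltNge; near: t; exact: lt_nbhsr.
(* At the junction the difference quotient is zero on the left and tends to [h' e = 0] on the
   right. *)
suff hc : (fun t : R => t^-1 *: ((if t *: 1 + e <= e then 0 else h (t *: 1 + e))
    - (if e <= e then 0 else h e))) @ 0^' --> (0 : R).
  by split; [apply/cvg_ex; exists 0|exact: cvg_lim hc].
have [dhe hd] := dh e (lexx _).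
have {}dhe : (fun t : R => t^-1 *: (h (t *: 1 + e) - h e)) @ 0^' --> (0 : R).
  have : (fun t : R => t^-1 *: (h (t *: 1 + e) - h e)) @ 0^' --> 'D_1 h e := dhe.
  by rewrite hd h'e.
apply/cvgrPdist_le => eps eps0; move/cvgrPdist_le: dhe => /(_ _ eps0).
apply: filterS => t; rewrite lexx he !subr0 !sub0r !normrN.
by case: ifP => // _ _; rewrite scaler0 normr0 ltW.
Unshelve. all: by end_near. Qed.

(* [cut0 e] is C^2, vanishes up to [e], tends to the identity as [e] tends to [0],
   and is convex: its second derivative [cut2 e] is nonnegative. *)
Definition cut0 e s := if s <= e then 0 else (s - e) ^+ 3 / s ^+ 2.
Definition cut1 e s := if s <= e then 0 else (s - e) ^+ 2 * (s + 2 * e) / s ^+ 3.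
Definition cut2 e s := if s <= e then 0 else 6 * e ^+ 2 * (s - e) / s ^+ 4.

Section Positive.
Variable e : R.
Hypothesis e0 : 0 < e.

Lemma is_derive_cut0 s : is_derive s 1 (cut0 e) (cut1 e s).
Proof.
apply: (@is_derive_glue (fun s => (s - e) ^+ 3 / s ^+ 2)
  (fun s => (s - e) ^+ 2 * (s + 2 * e) / s ^+ 3)).
- by rewrite subrr expr0n/= mul0r.
- by rewrite subrr expr0n/= !mul0r.
move=> t et; have t0 : t != 0 by rewrite gt_eqF// (lt_le_trans e0).
have h : t ^+ 2 != 0 by rewrite expf_neq0.
apply: is_derive_eq; rewrite /GRing.scale/= ?mulr1 ?expr1.
by field.
Qed.

Lemma is_derive_cut1 s : is_derive s 1 (cut1 e) (cut2 e s).
Proof.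
apply: (@is_derive_glue (fun s => (s - e) ^+ 2 * (s + 2 * e) / s ^+ 3)
  (fun s => 6 * e ^+ 2 * (s - e) / s ^+ 4)).
- by rewrite subrr expr0n/= !mul0r.
- by rewrite subrr mulr0 mul0r.
move=> t et; have t0 : t != 0 by rewrite gt_eqF// (lt_le_trans e0).
have h : t ^+ 3 != 0 by rewrite expf_neq0.
apply: is_derive_eq; rewrite /GRing.scale/= ?mulr1 ?expr1.
by field.
Qed.

Lemma continuous_derive1 (f df : R -> R) :
  (forall s : R, is_derive s 1 f (df s)) -> continuous f.
Proof.
by move=> d s; apply: differentiable_continuous; apply/derivable1_diffP; case: (d s).
Qed.

Lemma continuous_cut0 : continuous (cut0 e).
Proof. exact/continuous_derive1/is_derive_cut0. Qed.

Lemma continuous_cut1 : continuous (cut1 e).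
Proof. exact/continuous_derive1/is_derive_cut1. Qed.

Lemma continuous_cut2 : continuous (cut2 e).
Proof.
(* Replacing [s] by its maximum with [e] absorbs the case distinction and keeps the denominator
   positive. *)
have -> : cut2 e =
    (fun s => 6 * e ^+ 2 * (Num.max s e - e) * (Num.max s e ^+ 4)^-1).
  apply/funext => s; rewrite /cut2; case: (leP s e) => se; last by [].
  by rewrite subrr mulr0 mul0r.
move=> s; have cmax : {for s, continuous (fun s : R => Num.max s e)}.
  have -> : (fun s : R => Num.max s e) = (fun s => (s + e + `|s - e|) / 2).
    by apply/funext => t; rewrite maxr_absE.
  apply: cvgM; last exact: cvg_cst.
  apply: cvgD; first by apply: cvgD; [exact: cvg_id|exact: cvg_cst].
  by apply: cvg_norm; apply: cvgB; [exact: cvg_id|exact: cvg_cst].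
apply: cvgM.
  by apply: cvgM; [exact: cvg_cst|apply: cvgB; [exact: cmax|exact: cvg_cst]].
apply: cvgV; first by rewrite expf_neq0// gt_eqF// lt_max e0 orbT.
exact: (@continuous_comp _ _ _ _ (fun x : R => x ^+ 4) s cmax (@exprn_continuous _ _ _)).
Qed.

Lemma cut0_eq0 s : s <= e -> cut0 e s = 0. Proof. by rewrite /cut0 => ->. Qed.
Lemma cut1_eq0 s : s <= e -> cut1 e s = 0. Proof. by rewrite /cut1 => ->. Qed.
Lemma cut2_eq0 s : s <= e -> cut2 e s = 0. Proof. by rewrite /cut2 => ->. Qed.

Lemma cut2_ge0 s : 0 <= cut2 e s.
Proof.
rewrite /cut2; case: (leP s e) => // se.
by rewrite divr_ge0 ?exprn_ge0 ?mulr_ge0 ?subr_ge0 ?sqr_ge0// ltW// (lt_trans e0).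
Qed.

Lemma cut1_ge0 s : 0 <= cut1 e s.
Proof.
rewrite /cut1; case: (leP s e) => // se; have s0 : 0 < s by exact: lt_trans se.
have ? := sqr_ge0 (s - e); have ? : 0 <= s ^+ 3 by rewrite exprn_ge0// ltW.
have ? : 0 <= s + 2 * e by apply: addr_ge0; [exact: ltW|rewrite mulr_ge0// ltW].
by rewrite divr_ge0// mulr_ge0.
Qed.

Lemma cut1_le1 s : cut1 e s <= 1.
Proof.
rewrite /cut1; case: (leP s e) => // se; have s0 : 0 < s by exact: lt_trans se.
rewrite ler_pdivrMr ?exprn_gt0// mul1r -subr_ge0.
have -> : s ^+ 3 - (s - e) ^+ 2 * (s + 2 * e) = e ^+ 2 * (s + 2 * (s - e)) by ring.
by rewrite mulr_ge0 ?sqr_ge0//; lra.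
Qed.

Lemma cut0_bound s : 0 <= s -> 0 <= cut0 e s <= s.
Proof.
move=> s0; rewrite /cut0; case: (leP s e) => [_|se]; first by rewrite lexx.
have s1 : 0 < s by exact: lt_trans se.
apply/andP; split; first by rewrite divr_ge0 ?exprn_ge0 ?subr_ge0// ltW.
rewrite ler_pdivrMr ?exprn_gt0// -exprS ler_pXn2r ?nnegrE ?subr_ge0//; last exact: ltW.
by rewrite gerBl ltW.
Qed.

(** Away from 0 the second derivative is O(e^2); with a bound on the total mass, this is what
    concentrates it at 0. *)
Lemma cut2_le (t s : R) : 0 < t -> t <= s -> cut2 e s <= 6 * e ^+ 2 / t ^+ 3.
Proof.
move=> t0 ts; have s0 : 0 < s by exact: lt_le_trans ts.
rewrite /cut2; case: (leP s e) => [_|se].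
  by rewrite divr_ge0 ?mulr_ge0 ?exprn_ge0// ltW.
apply: (@le_trans _ _ (6 * e ^+ 2 / s ^+ 3)).
  have -> : 6 * e ^+ 2 / s ^+ 3 = 6 * e ^+ 2 * s / s ^+ 4.
    by field; rewrite gt_eqF.
  by rewrite ler_pM2r ?invr_gt0 ?exprn_gt0// ler_pM2l ?mulr_gt0 ?exprn_gt0// gerBl ltW.
rewrite ler_pM2l ?mulr_gt0 ?exprn_gt0// lef_pV2 ?posrE ?exprn_gt0//.
by rewrite ler_pXn2r// nnegrE ltW.
Qed.

(** With r = e / s < 1 the cutoff equals (1 - r)^2 (1 + 2 r) = 1 - 3 r^2 + 2 r^3. *)
Lemma cut1_dist s : 0 < s -> `|1 - cut1 e s| <= 3 * (e / s) ^+ 2.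
Proof.
move=> s0; rewrite ger0_norm ?subr_ge0 ?cut1_le1// /cut1; case: (leP s e) => [se|se].
  rewrite subr0; have : 1 <= e / s by rewrite ler_pdivlMr// mul1r.
  by move=> h; have : 1 <= (e / s) ^+ 2; [rewrite exprn_ege1|lra].
set r := e / s; have r0 : 0 < r by rewrite divr_gt0.
have -> : (s - e) ^+ 2 * (s + 2 * e) / s ^+ 3 = (1 - r) ^+ 2 * (1 + 2 * r).
  by rewrite /r; field; rewrite gt_eqF.
rewrite -subr_ge0.
have -> : 3 * r ^+ 2 - (1 - (1 - r) ^+ 2 * (1 + 2 * r)) = 2 * r ^+ 3 by ring.
by rewrite mulr_ge0// exprn_ge0// ltW.
Qed.

Lemma cut0_dist s : 0 < s -> `|s - cut0 e s| <= 3 * e.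
Proof.
move=> s0; have /andP[_ h] := cut0_bound (ltW s0).
rewrite ger0_norm ?subr_ge0// /cut0; case: (leP s e) => [se|se]; first lra.
set r := e / s; have r0 : 0 < r by rewrite divr_gt0.
have r1 : r < 1 by rewrite ltr_pdivrMr// mul1r.
have es : e = r * s by rewrite /r divfK// gt_eqF.
have -> : (s - e) ^+ 3 / s ^+ 2 = s * (1 - r) ^+ 3.
  by rewrite /r; field; rewrite gt_eqF.
rewrite es -subr_ge0.
have -> : 3 * (r * s) - (s - s * (1 - r) ^+ 3) = s * r ^+ 2 * (3 - r) by ring.
have h3 : 0 <= 3 - r by lra.
by rewrite mulr_ge0// mulr_ge0 ?exprn_ge0// ltW.
Qed.

End Positive.

Lemma cvg_cut1 s : 0 < s -> cut1 (harmonic n) s @[n --> \oo] --> (1 : R).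
Proof.
move=> s0; apply/cvgrPdist_le => eps eps0.
have : (fun n => 3 * (harmonic n / s) ^+ 2) @ \oo --> (3 * (0 / s) ^+ 2 : R).
  apply: cvgM; first exact: cvg_cst.
  have h : (fun n => harmonic n / s) @ \oo --> (0 / s : R).
    by apply: cvgM; [exact: cvg_harmonic|exact: cvg_cst].
  exact: (cvg_comp _ _ h (@exprn_continuous _ 2 _)).
rewrite mul0r expr0n/= mulr0 => /cvgrPdist_le/(_ _ eps0).
apply: filterS => n; rewrite sub0r normrN => hn.
apply: le_trans hn; apply: le_trans (ler_norm _).
by apply: cut1_dist => //; rewrite invr_gt0 ltr0n.
Qed.

Lemma cvg_cut0 s : 0 < s -> cut0 (harmonic n) s @[n --> \oo] --> s.
Proof.
move=> s0; apply/cvgrPdist_le => eps eps0.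
have : (fun n => 3 * harmonic n) @ \oo --> (3 * 0 : R).
  by apply: cvgM; [exact: cvg_cst|exact: cvg_harmonic].
rewrite mulr0 => /cvgrPdist_le/(_ _ eps0).
apply: filterS => n; rewrite sub0r normrN => hn.
apply: le_trans hn; apply: le_trans (ler_norm _).
by apply: cut0_dist => //; rewrite invr_gt0 ltr0n.
Qed.

End Cutoff.

(** * Iterated integrals and the mass of an affine cutoff *)

Section SliceIntegral.
Variable R : realType.
Notation mu1 := (@lebesgue_measure R).

Lemma measurable_slice1 (D : set (R * R)) (f : R * R -> R) (E : set (measurableTypeR R)) (x : R) :
  measurable_fun (D : set (mR2 R)) f -> measurable (D : set (mR2 R)) ->
  measurable E -> (forall y, E y -> D (x, y)) ->
  measurable_fun E (fun y => f (x, y)).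
Proof.
move=> mf mD mE ED.
apply: (@measurable_comp _ _ _ (measurableTypeR R) (mR2 R) R
  (D : set (mR2 R)) f E (pair x)) => //.
- by move=> _ [y Ey <-]; exact: ED.
- exact: measurable_funTS.
Qed.

Lemma finite_itv_oo (a b : R) : (lebesgue_measure `]a, b[ < +oo)%E.
Proof. by rewrite lebesgue_measure_itv/=; case: ifP => // _; exact: ltry. Qed.

Lemma int_slices (D : set (R * R)) (a b : R) (p q : R -> R) (f : R * R -> R) :
  measurable (D : set (mR2 R)) -> (mu2 D < +oo)%E -> bmeas D f ->
  (forall x y, D (x, y) <-> a < x < b /\ p x < y < q x) ->
  \int[mu2]_(z in D) f z =
  \int[mu1]_(x in `]a, b[) \int[mu1]_(y in `]p x, q x[) f (x, y).
Proof.
move=> mD fD bf DE.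
have int_f := bmeas_integrable mD fD bf.
rewrite Rintegral_mkcond {1}/Rintegral -[X in fine X]/(\int[mu2]_z (EFin \o (f \_ D)) z)%E.
rewrite /area_measure -integral12_prod_meas1; last first.
  by rewrite -restrict_EFin; apply/(integrable_mkcond _ mD).
rewrite /Rintegral [in RHS]integral_mkcond; congr fine; apply: eq_integral => x _.
rewrite /fubini_F/= patchE; case: ifPn => [|/negP]; rewrite inE/= in_itv/= => hx.
  rewrite fineK.
    rewrite [RHS]integral_mkcond; apply: eq_integral => y _.
    rewrite !patchE; case: ifPn => [|/negP]; rewrite inE => hy.
      by rewrite mem_set//= in_itv/=; have [] := (DE _ _).1 hy.
    rewrite memNset//= in_itv/= => h; apply: hy; exact/DE.
  apply: integrable_fin_num => //.
  apply: measurable_bounded_integrable => //.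
  - exact: finite_itv_oo.
  - case: bf => mf _; apply: (measurable_slice1 mf mD) => // y.
    by rewrite /= in_itv/= => h; apply/DE.
  - case: bf => _ [M hM]; exists M; split; first exact: num_real.
    move=> N MN y /=; rewrite in_itv/= => hy.
    by rewrite (le_trans (hM _ _))// ?ltW//; apply/DE.
rewrite integral0_eq// => y _; rewrite patchE memNset// => h.
by apply: hx; have [] := (DE _ _).1 h.
Qed.

Lemma integrable_oo (f : R -> R) (a b : R) : continuous f ->
  mu1.-integrable `]a, b[ (EFin \o f).
Proof.
move=> cf; have int_f : mu1.-integrable `[a, b] (EFin \o f).
  apply: continuous_compact_integrable; first exact: segment_compact.
  exact: continuous_subspaceT.
by apply: integrableS int_f => //; apply: subset_itv; rewrite bnd_simp.
Qed.

Lemma FTC_oo (F f : R -> R) (a b : R) : a <= b ->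
  (forall x : R, is_derive x 1 F (f x)) -> continuous f ->
  \int[mu1]_(x in `]a, b[) f x = F b - F a.
Proof.
move=> ab dF cf; rewrite -(FTC ab dF cf).
have int_f : mu1.-integrable `[a, b] (EFin \o f).
  apply: continuous_compact_integrable; first exact: segment_compact.
  exact: continuous_subspaceT.
rewrite Rintegral_itv_obnd_cbnd ?Rintegral_itv_bndo_bndc//.
- by apply: integrableS int_f => //; apply: subset_itvl; rewrite bnd_simp.
- by apply: integrableS int_f => //; apply: subset_itv; rewrite bnd_simp.
Qed.

Definition obox (M : R) : set (R * R) := `]- M, M[ `*` `]- M, M[.

(** Since [cut2] is nonnegative, [D] may be enlarged to the square. On a vertical line [cut2] of the
    affine form is the derivative of [cut1] divided by [be], so each slice contributes at most 1 /
    |be|, whatever [e], because [cut1] stays in [0, 1]. *)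
Lemma int_cut2_affine (D : set (R * R)) (M al be ga : R) : open D -> 0 < M ->
  D `<=` obox M -> be != 0 -> exists C, forall e, 0 < e ->
  \int[mu2]_(z in D) cut2 e (al * z.1 + be * z.2 + ga) <= C.
Proof.
move=> oD M0 DM be0; exists (`|be|^-1 * (M - - M)) => e e0.
have mD := open_measurable2 oD.
have mO : measurable (obox M : set (mR2 R)) by apply: measurableX; exact: measurable_itv.
have OB : obox M `<=` box M.
  by move=> [x y] [/=]; rewrite !in_itv/= => /andP[? ?] /andP[? ?]; split; rewrite /= in_itv/= !ltW.
have fO : (mu2 (obox M) < +oo)%E.
  by apply: le_lt_trans (area_box M); apply: le_measure; rewrite ?inE//; exact: measurable_box.
pose l (z : R * R) := al * z.1 + be * z.2 + ga.
have cl : continuous (fun z => cut2 e (l z)).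
  move=> z; apply: (@continuous_comp _ _ _ l (cut2 e)); last exact: continuous_cut2.
  apply: cvgD; last exact: cvg_cst.
  by apply: cvgD; apply: cvgM; [exact: cvg_cst|exact: cvg_fst|exact: cvg_cst|exact: cvg_snd].
have bO : bmeas (obox M) (fun z => cut2 e (l z)).
  split; first by apply: measurable_funTS; apply: continuous_measurable2; [exact: openT|move=> z _; exact: cl].
  have [N hN] := continuous_bounded_compact (@compact_box R M)
    (continuous_subspaceT (A := box M) cl).
  by exists N => z Oz; apply/hN/OB.
apply: (@le_trans _ _ (\int[mu2]_(z in obox M) cut2 e (l z))).
  have io := bmeas_integrable mO fO bO.
  have iD : mu2.-integrable D (EFin \o (fun z => cut2 e (l z))) by apply: integrableS io.
  apply: fine_le; [exact: integrable_fin_num|exact: integrable_fin_num|].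
  apply: ge0_subset_integral => //.
    by apply/measurable_EFinP; case: bO.
  by move=> z _; rewrite lee_fin cut2_ge0.
rewrite (@int_slices _ (- M) M (cst (- M)) (cst M))//.
have NM : - M <= M by lra.
pose H x := be^-1 * cut1 e (l (x, M)) - be^-1 * cut1 e (l (x, - M)).
have key x : \int[mu1]_(y in `]- M, M[) cut2 e (l (x, y)) = H x.
  apply: (@FTC_oo (fun y => be^-1 * cut1 e (l (x, y)))) => //.
  - move=> y; have h : is_derive y 1 (fun y => l (x, y)) be.
      rewrite /l/=; apply: is_derive_eq.
      by rewrite /GRing.scale/= !(add0r, mul1r, mulr1, addr0).
    have /= k := @is_derive1_comp _ (cut1 e) (fun y => l (x, y)) y _ _ (is_derive_cut1 e0 _) h.
    have -> : cut2 e (l (x, y)) = be^-1 *: (cut2 e (l (x, y)) * be).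
      by rewrite /GRing.scale/= mulrCA mulVf// mulr1.
    exact: (is_deriveZ be^-1 k).
  - move=> y; apply: (@continuous_comp _ _ _ (fun y : R => (x, y)) (fun z => cut2 e (l z)) (y : R)); last exact: cl.
    by apply: (@cvg_pair _ _ _ _ (nbhs x) (nbhs y)); [exact: cvg_cst|exact: cvg_id].
rewrite (_ : Rintegral _ _ _ = \int[mu1]_(x in `]- M, M[) H x); last first.
  by apply: eq_Rintegral => x _; exact: key.
have cH : continuous H.
  have cc (c : R) : continuous (fun x => be^-1 * cut1 e (l (x, c))).
    move=> x; apply: cvgM; first exact: cvg_cst.
    apply: (@continuous_comp _ _ _ (fun x => l (x, c)) (cut1 e)); last exact: continuous_cut1.
    rewrite /l/=; apply: cvgD; last exact: cvg_cst.
    apply: cvgD; last exact: cvg_cst.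
    by apply: cvgM; [exact: cvg_cst|exact: cvg_id].
  by move=> x; apply: cvgB; exact: cc.
have iH : mu1.-integrable `]- M, M[ (EFin \o H).
  exact: integrable_oo.
apply: (@le_trans _ _ (\int[mu1]_(x in `]- M, M[) `|be|^-1)).
  apply: le_Rintegral => //.
    by apply: integrable_oo => x; exact: cvg_cst.
  move=> x _; rewrite (le_trans (ler_norm _))// /H -mulrBr normrM normfV.
  rewrite ler_piMr ?invr_ge0// ler_norml.
  have := cut1_ge0 e0 (l (x, M)); have := cut1_le1 e0 (l (x, M)).
  have := cut1_ge0 e0 (l (x, -M)); have := cut1_le1 e0 (l (x, -M)).
  by move=> ? ? ? ?; apply/andP; split; lra.
have h : lebesgue_measure `]- M, M[%classic = (M - - M)%:E :> \bar R.
  by rewrite lebesgue_measure_itv/= lte_fin ifT//; lra.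
rewrite Rintegral_cst//.
by have /= -> := congr1 fine h.
Qed.

End SliceIntegral.

(** * Concentration of the second derivative of a cutoff *)

Section Concentration.
Variables (R : realType) (D : set (R * R)).
Hypotheses (mD : measurable (D : set (mR2 R))) (fD : (mu2 D < +oo)%E).

(* The mass of [cut2 e (h z)] concentrates on [h = 0] as [e] tends to [0]. *)
Lemma cvg_int_cut2 (h rho N : R * R -> R) (C : R) : bmeas D N -> bmeas D rho ->
  (forall z, D z -> 0 <= rho z) ->
  (forall e, 0 < e -> bmeas D (fun z => cut2 e (h z))) ->
  (forall e, 0 < e -> \int[mu2]_(z in D) (cut2 e (h z) * rho z) <= C) ->
  (forall eps, 0 < eps -> exists2 t, 0 < t &
    forall z, D z -> h z < t -> `|N z| <= eps) ->
  \int[mu2]_(z in D) (cut2 (harmonic n) (h z) * rho z * N z) @[n --> \oo] --> (0 : R).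
Proof.
move=> bN brho rho0 bcut leC small.
have [_ [B hB]] := bN; have [_ [P hP]] := brho.
have C0 : 0 <= C.
  apply: le_trans (leC 1 ltr01); apply: Rintegral_ge0 => z Dz.
  by rewrite mulr_ge0 ?cut2_ge0 ?rho0.
pose ar := fine (mu2 D); have ar0 : 0 <= ar by exact: fine_ge0.
apply/cvgrPdist_le => eps eps0.
pose eps' := eps / (2 * (C + 1)).
have C1 : 0 < 2 * (C + 1) by lra.
have eps'0 : 0 < eps' by rewrite divr_gt0.
(* Where [h] is below [t], the weight has mass at most [C] and [N] is at most [eps']; elsewhere the
   weight is O(e^2) by [cut2_le], and [rho] and [N] are bounded. *)
have [t t0 ht] := small _ eps'0.
have lim : (fun n => 6 * harmonic n ^+ 2 / t ^+ 3 * (`|P| * `|B|) * ar) @ \oo -->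
    (6 * 0 ^+ 2 / t ^+ 3 * (`|P| * `|B|) * ar : R).
  do 3 (apply: cvgM; last exact: cvg_cst).
  apply: cvgM; first exact: cvg_cst.
  exact: (cvg_comp _ _ (@cvg_harmonic R) (@exprn_continuous _ 2 _)).
have e2 : 0 < eps / 2 by rewrite divr_gt0.
move: lim; rewrite expr0n/= mulr0 !mul0r => /cvgrPdist_le/(_ _ e2).
apply: filterS => n; rewrite !sub0r !normrN => hn.
set e : R := harmonic n in hn *; have e0 : 0 < e by rewrite invr_gt0 ltr0n.
have bw : bmeas D (fun z => cut2 e (h z) * rho z) by exact: bmeasM (bcut _ e0) brho.
set K := 6 * e ^+ 2 / t ^+ 3 * (`|P| * `|B|).
have t3 : 0 <= 6 * e ^+ 2 / t ^+ 3 by rewrite divr_ge0 ?mulr_ge0 ?exprn_ge0// ltW.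
have K0 : 0 <= K by rewrite mulr_ge0// mulr_ge0.
apply: le_trans (norm_int mD fD (bmeasM bw bN)) _.
have bl := bmeas_norm (bmeasM bw bN).
have br : bmeas D (fun z => eps' * (cut2 e (h z) * rho z) + K).
  by apply: bmeasD; [apply: bmeasM => //|]; exact: bmeas_cst.
apply: le_trans (le_int mD fD bl br _) _.
  move=> z Dz; rewrite normrM ger0_norm ?mulr_ge0 ?cut2_ge0 ?rho0//.
  have w0 : 0 <= cut2 e (h z) * rho z by rewrite mulr_ge0 ?cut2_ge0 ?rho0.
  have [hzt|tz] := ltP (h z) t.
    rewrite (@le_trans _ _ (eps' * (cut2 e (h z) * rho z)))// ?lerDl//.
    by rewrite mulrC ler_wpM2r// ht.
  apply: (@le_trans _ _ K); last by rewrite lerDr mulr_ge0// ltW.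
  have -> : K = 6 * e ^+ 2 / t ^+ 3 * `|P| * `|B| by rewrite /K mulrA.
  apply: ler_pM => //; last by rewrite (le_trans (hB _ Dz))// ler_norm.
  apply: ler_pM; [exact: cut2_ge0|exact: rho0|exact: cut2_le|].
  by rewrite (le_trans (ler_norm _))// (le_trans (hP _ Dz))// ler_norm.
rewrite intD//; [|by apply: bmeasZ|exact: bmeas_cst].
rewrite intZ// Rintegral_cst// -/ar (splitr eps) lerD//; last first.
  by rewrite (le_trans (ler_norm _)).
apply: (@le_trans _ _ (eps' * C)); first by rewrite ler_pM2l// leC.
have C2 : 0 < C + 1 by lra.
have -> : eps' * C = eps / 2 * (C / (C + 1)).
  by rewrite /eps'; field; rewrite gt_eqF.
by rewrite ler_piMr ?(ltW e2)// ler_pdivrMr// mul1r; lra.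
Qed.

End Concentration.

(** * Local bounds made uniform by compactness *)

Section PointwiseContinuity.
Variable R : realType.
Implicit Types (f g : R * R -> R) (z : R * R).

Lemma contD f g z : {for z, continuous f} -> {for z, continuous g} ->
  {for z, continuous (fun y => f y + g y)}.
Proof. by move=> cf cg; apply: cvgD; [exact: cf|exact: cg]. Qed.

Lemma contB f g z : {for z, continuous f} -> {for z, continuous g} ->
  {for z, continuous (fun y => f y - g y)}.
Proof. by move=> cf cg; apply: cvgB; [exact: cf|exact: cg]. Qed.

Lemma contM f g z : {for z, continuous f} -> {for z, continuous g} ->
  {for z, continuous (fun y => f y * g y)}.
Proof. by move=> cf cg; apply: cvgM; [exact: cf|exact: cg]. Qed.

Lemma contX2 f z : {for z, continuous f} ->
  {for z, continuous (fun y => f y ^+ 2)}.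
Proof. by move=> cf; exact: contM. Qed.

Lemma cont_cst (c : R) z : {for z, continuous (fun=> c)}.
Proof. exact: cvg_cst. Qed.

Lemma cont_comp (h : R -> R) f z : continuous h -> {for z, continuous f} ->
  {for z, continuous (fun y => h (f y))}.
Proof. by move=> ch cf; apply: (@continuous_comp _ _ _ f h); [exact: cf|exact: ch]. Qed.

Definition affine (al be ga : R) z := al * z.1 + be * z.2 + ga.

Lemma cont_affine al be ga : continuous (affine al be ga).
Proof.
move=> z; apply: cvgD; last exact: cvg_cst.
apply: cvgD; apply: cvgM; by [exact: cvg_cst|exact: cvg_fst|exact: cvg_snd].
Qed.

Lemma near_lt f z (c : R) : {for z, continuous f} -> f z < c ->
  \forall y \near z, f y < c.
Proof. by move=> cf fz; near=> y; near: y; apply: (cvgr_lt (f z)). Unshelve. all: by end_near. Qed.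

Lemma near_gt f z (c : R) : {for z, continuous f} -> c < f z ->
  \forall y \near z, c < f y.
Proof. by move=> cf fz; near=> y; near: y; apply: (cvgr_gt (f z)). Unshelve. all: by end_near. Qed.

Lemma cont_locally_bounded f z : {for z, continuous f} ->
  exists B : R, \forall y \near z, `|f y| <= B.
Proof.
move=> cf; exists (`|f z| + 1).
have cn : {for z, continuous (fun y => `|f y|)} by apply: cvg_norm; exact: cf.
have lt1 : `|f z| < `|f z| + 1 by rewrite ltrDl.
by apply: filterS (near_lt cn lt1) => y /ltW.
Qed.

Section Compact.
Variables (K D : set (R * R)).
Hypothesis cK : compact K.

(** Compactness in near-covering form, with the bound itself as the parameter tending to +oo,
    replaces the choice of a finite subcover. *)
Lemma compact_locally_bounded f :
  (forall z, K z -> exists B : R, \forall y \near z, D y -> `|f y| <= B) ->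
  exists B : R, forall y, K y -> D y -> `|f y| <= B.
Proof.
move=> lb.
have /compact_near_coveringP h := cK.
have := h R (pinfty_nbhs R) (fun B y => D y -> `|f y| <= B) _ _.
case=> [z Kz|B [Br hB]].
  have [B hB] := lb _ Kz.
  exists ([set y | D y -> `|f y| <= B], [set B' : R | B < B']).
    by split => //=; exists B; split => //; exact: num_real.
  by move=> [y B'] [/= hy BB] /hy /le_trans -> //; exact: ltW.
exists (B + 1) => y Ky Dy.
by apply: (hB (B + 1)) => //; rewrite ltrDl.
Qed.

(** Near-covering again, with the threshold [t] tending to 0 from the right: a point with [h z > 0]
    has a neighbourhood where [h] exceeds [h z / 2], which drops out as soon as [t] is below this
    value. *)
Lemma compact_locally_small f (h : R * R -> R) : continuous h ->
  (forall z, K z -> h z <= 0 -> forall eps, 0 < eps ->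
     \forall y \near z, D y -> `|f y| <= eps) ->
  forall eps, 0 < eps -> exists2 t, 0 < t &
    forall y, K y -> D y -> h y < t -> `|f y| <= eps.
Proof.
move=> ch ls eps eps0.
have /compact_near_coveringP hc := cK.
have := hc R (0^'+) (fun t y => D y -> h y < t -> `|f y| <= eps) _ _.
case=> [z Kz|t /= t0 ht].
  have [hz|hz] := leP (h z) 0.
    exists ([set y | D y -> `|f y| <= eps], setT).
      by split => /=; [exact: ls|exact: filterT].
    by move=> [y t] [/= hy _] Dy _; exact: hy.
  have h2 : 0 < h z / 2 by rewrite divr_gt0.
  exists ([set y | h z / 2 < h y], [set t : R | t < h z / 2]).
    split => /=; first by apply: near_gt; [exact: ch|rewrite ltr_pdivrMr// ltr_pMr// ltr1n].
    exact: nbhs_right_lt.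
  by move=> [y t] [/= hy ty] _ yt; have := lt_trans (lt_trans hy yt) ty; rewrite ltxx.
have t2 : 0 < t / 2 by rewrite divr_gt0.
exists (t / 2) => // y Ky Dy hy; apply: (ht (t / 2)) => //.
by rewrite /ball/= sub0r normrN gtr0_norm// ltr_pdivrMr// ltr_pMr// ltr1n.
Qed.

End Compact.
End PointwiseContinuity.

(** The derivatives are explicit functions, and differentiation is along slices, so that
    one-variable rules apply; a Laplacian involves only the pure second derivatives. *)
Record C2_data (R : realType) (D : set (R * R)) (v v1 v2 v11 v22 : R * R -> R)
  : Prop := {
  C2_d1 : forall x y : R, D (x, y) -> is_derive x 1 (fun s => v (s, y)) (v1 (x, y));
  C2_d2 : forall x y : R, D (x, y) -> is_derive y 1 (fun s => v (x, s)) (v2 (x, y));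
  C2_d11 : forall x y : R, D (x, y) -> is_derive x 1 (fun s => v1 (s, y)) (v11 (x, y));
  C2_d22 : forall x y : R, D (x, y) -> is_derive y 1 (fun s => v2 (x, s)) (v22 (x, y));
  C2_c : forall z, D z -> {for z, continuous v};
  C2_c1 : forall z, D z -> {for z, continuous v1};
  C2_c2 : forall z, D z -> {for z, continuous v2};
  C2_c11 : forall z, D z -> {for z, continuous v11};
  C2_c22 : forall z, D z -> {for z, continuous v22} }.

(** * Green's formula *)

Section C2Operations.
Variable R : realType.
Implicit Types (D : set (R * R)).

Lemma C2_comp (h h1 h2 : R -> R) D g g1 g2 g11 g22 :
  (forall s : R, is_derive s 1 h (h1 s)) -> (forall s : R, is_derive s 1 h1 (h2 s)) ->
  continuous h2 -> C2_data D g g1 g2 g11 g22 ->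
  C2_data D (fun z => h (g z)) (fun z => h1 (g z) * g1 z) (fun z => h1 (g z) * g2 z)
    (fun z => h2 (g z) * g1 z ^+ 2 + h1 (g z) * g11 z)
    (fun z => h2 (g z) * g2 z ^+ 2 + h1 (g z) * g22 z).
Proof.
move=> dh dh1 ch2 [d1 d2 d11 d22 c c1 c2 c11 c22].
have ch := continuous_derive1 dh; have ch1 := continuous_derive1 dh1.
have comp1 (k k1 : R -> R) (x y : R) (dk : forall s : R, is_derive s 1 k (k1 s)) : D (x, y) ->
    is_derive x 1 (fun s => k (g (s, y))) (k1 (g (x, y)) * g1 (x, y)).
  by move=> /d1 dg; have := @is_derive1_comp _ k (fun s => g (s, y)) x _ _ (dk _) dg.
have comp2 (k k1 : R -> R) (x y : R) (dk : forall s : R, is_derive s 1 k (k1 s)) : D (x, y) ->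
    is_derive y 1 (fun s => k (g (x, s))) (k1 (g (x, y)) * g2 (x, y)).
  by move=> /d2 dg; have := @is_derive1_comp _ k (fun s => g (x, s)) y _ _ (dk _) dg.
split => [x y Dz|x y Dz|x y Dz|x y Dz|z Dz|z Dz|z Dz|z Dz|z Dz].
- exact: comp1.
- exact: comp2.
- have ? := comp1 _ _ _ _ dh1 Dz; have ? := d11 _ _ Dz.
  by apply: is_derive_eq; rewrite /GRing.scale/=; ring.
- have ? := comp2 _ _ _ _ dh1 Dz; have ? := d22 _ _ Dz.
  by apply: is_derive_eq; rewrite /GRing.scale/=; ring.
- by apply: cont_comp => //; exact: c.
- by apply: contM; [apply: cont_comp => //; exact: c|exact: c1].
- by apply: contM; [apply: cont_comp => //; exact: c|exact: c2].
- apply: contD; apply: contM; [by apply: cont_comp => //; exact: c| |by apply: cont_comp => //; exact: c|exact: c11].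
  by apply: contM; exact: c1.
- apply: contD; apply: contM; [by apply: cont_comp => //; exact: c| |by apply: cont_comp => //; exact: c|exact: c22].
  by apply: contM; exact: c2.
Qed.

Lemma C2_lin D (c : R) v v1 v2 v11 v22 w w1 w2 w11 w22 :
  C2_data D v v1 v2 v11 v22 -> C2_data D w w1 w2 w11 w22 ->
  C2_data D (fun z => v z + c * w z) (fun z => v1 z + c * w1 z)
   (fun z => v2 z + c * w2 z) (fun z => v11 z + c * w11 z) (fun z => v22 z + c * w22 z).
Proof.
have lin (f g : R -> R) (x a b : R) : is_derive x 1 f a -> is_derive x 1 g b ->
    is_derive x 1 (fun s => f s + c * g s) (a + c * b).
  by move=> df dg; apply: is_derive_eq; rewrite /GRing.scale/=; ring.
have cont (f g : R * R -> R) z : {for z, continuous f} -> {for z, continuous g} ->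
    {for z, continuous (fun z => f z + c * g z)}.
  by move=> cf cg; apply: contD => //; apply: contM => //; exact: cont_cst.
move=> [d1 d2 d11 d22 c0 c1 c2 c11 c22] [e1 e2 e11 e22 k0 k1 k2 k11 k22].
split => [x y Dz|x y Dz|x y Dz|x y Dz|z Dz|z Dz|z Dz|z Dz|z Dz].
- exact: lin (d1 _ _ Dz) (e1 _ _ Dz).
- exact: lin (d2 _ _ Dz) (e2 _ _ Dz).
- exact: lin (d11 _ _ Dz) (e11 _ _ Dz).
- exact: lin (d22 _ _ Dz) (e22 _ _ Dz).
- exact: cont (c0 _ Dz) (k0 _ Dz).
- exact: cont (c1 _ Dz) (k1 _ Dz).
- exact: cont (c2 _ Dz) (k2 _ Dz).
- exact: cont (c11 _ Dz) (k11 _ Dz).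
- exact: cont (c22 _ Dz) (k22 _ Dz).
Qed.

Lemma C2_sub D D' v v1 v2 v11 v22 : D `<=` D' ->
  C2_data D' v v1 v2 v11 v22 -> C2_data D v v1 v2 v11 v22.
Proof.
move=> DD [d1 d2 d11 d22 c0 c1 c2 c11 c22].
by split => [x y /DD|x y /DD|x y /DD|x y /DD|z /DD|z /DD|z /DD|z /DD|z /DD]; auto.
Qed.

Lemma C2_const D (a : R) : C2_data D (cst a) (cst 0) (cst 0) (cst 0) (cst 0).
Proof.
by split => [x y _|x y _|x y _|x y _|z _|z _|z _|z _|z _];
  (try exact: cont_cst); exact: is_derive_cst.
Qed.

End C2Operations.

Section Green.
Variables (R : realType) (D : set (R * R)) (M al be ga : R) (phi1 : R * R -> R).
Hypotheses (oD : open D) (M0 : 0 < M) (DM : D `<=` obox M) (be0 : be != 0).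
(** [l] is a multiple of the distance to the line of the Neumann edge. By the next two hypotheses,
    the boundary of [D] consists of the Dirichlet part [phi1 <= 0] and the Neumann part [l = 0]. A
    polygon without Neumann edge takes a line that misses its closure. *)
Let l := affine al be ga.
Hypothesis hl : forall z, D z -> 0 < l z.
Hypothesis hin : forall z, closure D z -> 0 < phi1 z -> 0 < l z -> D z.

(** For such a [g], the function [cut0 e (g z)] vanishes near the Dirichlet edges, hence near the
    vertices, and meets the boundary only along the interior of the Neumann edge, where its normal
    derivative is zero. *)
Record test (g g1 g2 g11 g22 : R * R -> R) : Prop := {
  test_C2 : C2_data setT g g1 g2 g11 g22;
  test_pos : forall z, closure D z -> 0 < g z -> 0 < phi1 z;
  test_N : forall z, closure D z -> 0 < phi1 z -> l z = 0 ->
    al * g1 z + be * g2 z = 0 }.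

(** What a heat flow provides at a fixed time: its Laplacian is the time derivative, which is
    continuous up to the closure and hence bounded, while no bound on the gradient is asked. There
    is no Dirichlet condition, so that the constant 1 qualifies as well. *)
Record neumann_fun (u u1 u2 u11 u22 : R * R -> R) : Prop := {
  neumann_C2 : C2_data D u u1 u2 u11 u22;
  neumann_c : {within closure D, continuous u};
  neumann_lap : exists B : R, forall z, D z -> `|u11 z + u22 z| <= B;
  neumann_N : forall z, closure D z -> 0 < phi1 z -> l z = 0 ->
    al * u1 y + be * u2 y @[y --> within D (nbhs z)] --> (0 : R) }.

Lemma obox_box : D `<=` box M.
Proof.
by move=> [x y] /DM[/=]; rewrite !in_itv/= => /andP[? ?] /andP[? ?];
  split; rewrite /= in_itv/= !ltW.
Qed.

Lemma closure_box : closure D `<=` box M.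
Proof.
have cB : closed (box M).
  by apply: compact_closed; [exact: norm_hausdorff|exact: compact_box].
by rewrite (closure_id (box M)).1//; apply: closureS; exact: obox_box.
Qed.

Lemma compact_closure_region : compact (closure D).
Proof.
by apply: (subclosed_compact _ (@compact_box R M)); [exact: closed_closure|exact: closure_box].
Qed.
Let cK := compact_closure_region.

Lemma closure_affine_ge0 z : closure D z -> 0 <= l z.
Proof.
move=> Kz; rewrite leNgt; apply/negP => lz.
have [y [Dy ly]] := Kz _ (near_lt (@cont_affine _ al be ga z) lz).
by have := lt_trans ly (hl Dy); rewrite ltxx.
Qed.

Lemma measurable_region : measurable (D : set (mR2 R)).
Proof. exact: open_measurable2. Qed.
Let mD := measurable_region.

Lemma area_region : (mu2 D < +oo)%E.
Proof.
apply: le_lt_trans (area_box M); apply: le_measure; rewrite ?inE//.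
  exact: measurable_box.
exact: obox_box.
Qed.
Let fD := area_region.

Lemma bmeas_continuous (f : R * R -> R) :
  (forall z, {for z, continuous f}) -> bmeas D f.
Proof.
move=> cf; split; first by apply: continuous_measurable2.
have [N hN] := continuous_bounded_compact (@compact_box R M)
  (continuous_subspaceT (A := box M) cf).
by exists N => z /obox_box; exact: hN.
Qed.

Lemma bmeas_neumann u u1 u2 u11 u22 : neumann_fun u u1 u2 u11 u22 -> bmeas D u.
Proof.
move=> hu; split; first exact: continuous_measurable2 oD (C2_c (neumann_C2 hu)).
have [N hN] := continuous_bounded_compact cK (neumann_c hu).
by exists N => z Dz; apply: hN; exact: subset_closure.
Qed.

Lemma bmeas_neumann_lap u u1 u2 u11 u22 : neumann_fun u u1 u2 u11 u22 ->
  bmeas D (fun z => u11 z + u22 z).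
Proof.
move=> hu; split; last exact: neumann_lap hu.
apply: continuous_measurable2 oD _ => z Dz; have C := neumann_C2 hu.
by apply: contD; [exact: (C2_c11 C)|exact: (C2_c22 C)].
Qed.

Section BasicGreen.
Variables (e : R) (g g1 g2 g11 g22 u u1 u2 u11 u22 : R * R -> R).
Hypotheses (e0 : 0 < e) (tg : test g g1 g2 g11 g22).
Hypothesis hu : neumann_fun u u1 u2 u11 u22.

Let eta z := cut0 e (g z).
Let eta1 z := cut1 e (g z) * g1 z.
Let eta2 z := cut1 e (g z) * g2 z.
Let eta11 z := cut2 e (g z) * g1 z ^+ 2 + cut1 e (g z) * g11 z.
Let eta22 z := cut2 e (g z) * g2 z ^+ 2 + cut1 e (g z) * g22 z.

Let Ceta : C2_data setT eta eta1 eta2 eta11 eta22.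
Proof.
exact: (C2_comp (is_derive_cut0 e0) (is_derive_cut1 e0) (continuous_cut2 e0) (test_C2 tg)).
Qed.

Let eta_eq0 z : g z <= e -> [/\ eta z = 0, eta1 z = 0, eta2 z = 0, eta11 z = 0 & eta22 z = 0].
Proof.
by move=> ge; rewrite /eta /eta1 /eta2 /eta11 /eta22 cut0_eq0// cut1_eq0// cut2_eq0// !mul0r addr0.
Qed.

(** At a point of the closure with [g z > 0], [test_pos] gives [phi1 z > 0]; being outside [D] it
    must then have [l z <= 0] by [hin]. So the two cutoffs together vanish near the whole
    boundary. *)
Let near_out d z : 0 < d -> ~ D z -> \forall y \near z, D y -> g y <= e \/ l y <= d.
Proof.
move=> d0 nDz; have [Kz|nKz] := pselect (closure D z); last first.
  have : nbhs z (~` closure D).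
    by apply: open_nbhs_nbhs; split => //; exact/closed_openC/closed_closure.
  by apply: filterS => y ny /subset_closure.
have [gz|gz] := leP (g z) 0.
  by apply: filterS (near_lt (C2_c (test_C2 tg) I) (le_lt_trans gz e0)) => y /ltW; left.
have lz : l z <= 0.
  by rewrite leNgt; apply/negP => lz; apply: nDz; apply: hin => //; exact: (test_pos tg).
by apply: filterS (near_lt (@cont_affine _ al be ga z) (le_lt_trans lz d0)) => y /ltW; right.
Qed.

(** The flux of the Green field eta grad u - u grad eta in the direction [(al, be)], normal to the
    Neumann edge. *)
Let N z := eta z * (al * u1 z + be * u2 z) - u z * (al * eta1 z + be * eta2 z).

Let cN z : D z -> {for z, continuous N}.
Proof.
move=> Dz; have C := neumann_C2 hu.
apply: contB; apply: contM.
- exact: (C2_c Ceta).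
- by apply: contD; apply: contM; [exact: cont_cst|exact: (C2_c1 C)|exact: cont_cst|exact: (C2_c2 C)].
- exact: (C2_c C).
- by apply: contD; apply: contM; [exact: cont_cst|exact: (C2_c1 Ceta)|exact: cont_cst|exact: (C2_c2 Ceta)].
Qed.

(** Where [g < e], all terms with [eta] vanish. Otherwise the point is on the Neumann edge and off
    the Dirichlet edges: both normal derivatives tend to 0 there, and [eta] and [u] are bounded. *)
Let N_small z : closure D z -> l z <= 0 -> forall eps, 0 < eps ->
  \forall y \near z, D y -> `|N y| <= eps.
Proof.
move=> Kz lz eps eps0; have [gz|gz] := ltP (g z) e.
  apply: filterS (near_lt (C2_c (test_C2 tg) I) gz) => y /ltW/eta_eq0[h0 h1 h2 _ _] _.
  by rewrite /N h0 h1 h2 !mulr0 addr0 mul0r mulr0 subr0 normr0 ltW.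
have l0 : l z = 0 by apply/eqP; rewrite eq_le lz closure_affine_ge0.
have pz : 0 < phi1 z by apply: (test_pos tg) => //; exact: lt_le_trans gz.
have [B hB] := continuous_bounded_compact cK (neumann_c hu).
have [B' hB'] := cont_locally_bounded (C2_c Ceta (z := z) I).
have deta : {for z, continuous (fun y => al * eta1 y + be * eta2 y)}.
  by apply: contD; apply: contM; [exact: cont_cst|exact: (C2_c1 Ceta)|exact: cont_cst|exact: (C2_c2 Ceta)].
have deta0 : al * eta1 z + be * eta2 z = 0.
  by rewrite /eta1 /eta2 !(mulrCA _ (cut1 _ _)) -mulrDr (test_N tg)// mulr0.
pose c := eps / (2 * (`|B'| + 1)); pose c' := eps / (2 * (`|B| + 1)).
have c0 : 0 < c by rewrite divr_gt0// mulr_gt0// ltr_wpDl.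
have c'0 : 0 < c' by rewrite divr_gt0// mulr_gt0// ltr_wpDl.
have := neumann_N hu Kz pz l0 => /cvgrPdist_le/(_ _ c0); rewrite near_withinE => h1.
have h2 : \forall y \near z, `|al * eta1 y + be * eta2 y| <= c'.
  have /cvgrPdist_le/(_ _ c'0) := deta; rewrite deta0.
  by apply: filterS => y; rewrite sub0r normrN.
near=> y => Dy; rewrite /N (le_trans (ler_normB _ _))// !normrM (splitr eps) lerD//.
- have a1 : `|al * u1 y + be * u2 y| <= c.
    by have := near h1 y; rewrite sub0r normrN; apply => //; near: y.
  have a2 : `|eta y| <= `|B'| + 1.
    rewrite (@le_trans _ _ B')//; first by near: y; exact: hB'.
    by rewrite (le_trans (ler_norm _))// lerDl.
  rewrite (le_trans (ler_pM _ _ a2 a1))// /c.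
  suff -> : (`|B'| + 1) * (eps / (2 * (`|B'| + 1))) = eps / 2 by [].
  by field; rewrite gt_eqF// ltr_wpDl.
- have a1 : `|al * eta1 y + be * eta2 y| <= c' by near: y; exact: h2.
  have a2 : `|u y| <= `|B| + 1.
    rewrite (@le_trans _ _ B)//; first exact/hB/subset_closure.
    by rewrite (le_trans (ler_norm _))// lerDl.
  rewrite (le_trans (ler_pM _ _ a2 a1))// /c'.
  suff -> : (`|B| + 1) * (eps / (2 * (`|B| + 1))) = eps / 2 by [].
  by field; rewrite gt_eqF// ltr_wpDl.
Unshelve. all: by end_near. Qed.

Let bN : bmeas D N.
Proof.
split; first exact: continuous_measurable2.
suff [B hB] : exists B : R, forall y, closure D y -> D y -> `|N y| <= B.
  by exists B => z Dz; apply: hB => //; exact: subset_closure.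
apply: (compact_locally_bounded cK) => z Kz.
have [lz|lz] := leP (l z) 0; first by exists 1; exact: N_small.
have [gz|gz] := ltP (g z) e.
  exists 0; apply: filterS (near_lt (C2_c (test_C2 tg) I) gz) => y /ltW/eta_eq0[h0 h1 h2 _ _] _.
  by rewrite /N h0 h1 h2 !mulr0 addr0 mul0r mulr0 subr0 normr0.
have Dz : D z by apply: hin => //; apply: (test_pos tg) => //; exact: lt_le_trans gz.
have [B hB] := cont_locally_bounded (cN Dz).
by exists B; apply: filterS hB => y.
Qed.

Let G z := eta z * (u11 z + u22 z) - u z * (eta11 z + eta22 z).

Let bG : bmeas D G.
Proof.
apply: bmeasB; apply: bmeasM.
- by apply: bmeas_continuous => z; exact: (C2_c Ceta).
- exact: bmeas_neumann_lap hu.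
- exact: bmeas_neumann hu.
- by apply: bmeas_continuous => z; apply: contD; [exact: (C2_c11 Ceta)|exact: (C2_c22 Ceta)].
Qed.

Let bcut1 d : 0 < d -> bmeas D (fun z => cut1 d (l z)).
Proof.
move=> d0; apply: bmeas_continuous => z; apply: cont_comp; first exact: continuous_cut1.
exact: cont_affine.
Qed.

Let bcut2 d : 0 < d -> bmeas D (fun z => cut2 d (l z)).
Proof.
move=> d0; apply: bmeas_continuous => z; apply: cont_comp; first exact: continuous_cut2.
exact: cont_affine.
Qed.

Let div_eq0 d : 0 < d ->
  \int[mu2]_(z in D) (cut1 d (l z) * G z) = - \int[mu2]_(z in D) (cut2 d (l z) * 1 * N z).
Proof.
move=> d0.
pose F1 z := cut1 d (l z) * (eta z * u1 z - u z * eta1 z).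
pose F2 z := cut1 d (l z) * (eta z * u2 z - u z * eta2 z).
pose f1 z := al * cut2 d (l z) * (eta z * u1 z - u z * eta1 z)
  + cut1 d (l z) * (eta z * u11 z - u z * eta11 z).
pose f2 z := be * cut2 d (l z) * (eta z * u2 z - u z * eta2 z)
  + cut1 d (l z) * (eta z * u22 z - u z * eta22 z).
have out (F : R * R -> R) : (forall z, g z <= e -> F z = 0) ->
    (forall z, l z <= d -> F z = 0) -> vanishes_at_boundary D F.
  move=> Fg Fl z /(near_out d0); apply: filterS => y h /h[]; [exact: Fg|exact: Fl].
have F1_0 : vanishes_at_boundary D F1.
  apply: out => z; rewrite /F1; last by move=> h; rewrite cut1_eq0// mul0r.
  by move=> /eta_eq0[-> -> _ _ _]; rewrite !(mul0r, mulr0) subr0 mulr0.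
have F2_0 : vanishes_at_boundary D F2.
  apply: out => z; rewrite /F2; last by move=> h; rewrite cut1_eq0// mul0r.
  by move=> /eta_eq0[-> _ -> _ _]; rewrite !(mul0r, mulr0) subr0 mulr0.
have f1_0 : vanishes_at_boundary D f1.
  apply: out => z; rewrite /f1; last by move=> h; rewrite cut1_eq0// cut2_eq0// !(mul0r, mulr0) addr0.
  by move=> /eta_eq0[-> -> _ -> _]; rewrite !(mul0r, mulr0, subr0, addr0).
have f2_0 : vanishes_at_boundary D f2.
  apply: out => z; rewrite /f2; last by move=> h; rewrite cut1_eq0// cut2_eq0// !(mul0r, mulr0) addr0.
  by move=> /eta_eq0[-> _ -> _ ->]; rewrite !(mul0r, mulr0, subr0, addr0).
have C := neumann_C2 hu.
have cc1 z : {for z, continuous (fun z => cut1 d (l z))}.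
  by apply: cont_comp; [exact: continuous_cut1|exact: cont_affine].
have cc2 z : {for z, continuous (fun z => cut2 d (l z))}.
  by apply: cont_comp; [exact: continuous_cut2|exact: cont_affine].
have cf1 z : D z -> {for z, continuous f1}.
  move=> Dz; apply: contD; apply: contM.
  - by apply: contM; [exact: cont_cst|exact: cc2].
  - by apply: contB; apply: contM; [exact: (C2_c Ceta)|exact: (C2_c1 C)|exact: (C2_c C)|exact: (C2_c1 Ceta)].
  - exact: cc1.
  - by apply: contB; apply: contM; [exact: (C2_c Ceta)|exact: (C2_c11 C)|exact: (C2_c C)|exact: (C2_c11 Ceta)].
have cf2 z : D z -> {for z, continuous f2}.
  move=> Dz; apply: contD; apply: contM.
  - by apply: contM; [exact: cont_cst|exact: cc2].
  - by apply: contB; apply: contM; [exact: (C2_c Ceta)|exact: (C2_c2 C)|exact: (C2_c C)|exact: (C2_c2 Ceta)].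
  - exact: cc1.
  - by apply: contB; apply: contM; [exact: (C2_c Ceta)|exact: (C2_c22 C)|exact: (C2_c C)|exact: (C2_c22 Ceta)].
have I1 : \int[mu2]_(z in D) f1 z = 0.
  apply: (@int_partial1_eq0 _ D M F1) => //; first exact: obox_box.
  move=> x y Dz; have ? := C2_d1 Ceta (x := x) (y := y) I; have ? := C2_d11 Ceta (x := x) (y := y) I.
  have ? := C2_d1 C Dz; have ? := C2_d11 C Dz.
  have hl1 : is_derive x 1 (fun s => l (s, y)) al.
    by rewrite /l /affine/=; apply: is_derive_eq; rewrite /GRing.scale/= !(add0r, mul1r, mulr1, addr0).
  have /= ? := @is_derive1_comp _ (cut1 d) (fun s => l (s, y)) x _ _ (is_derive_cut1 d0 _) hl1.
  by rewrite /F1 /f1; apply: is_derive_eq; rewrite /GRing.scale/=; ring.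
have I2 : \int[mu2]_(z in D) f2 z = 0.
  apply: (@int_partial2_eq0 _ D M F2) => //; first exact: obox_box.
  move=> x y Dz; have ? := C2_d2 Ceta (x := x) (y := y) I; have ? := C2_d22 Ceta (x := x) (y := y) I.
  have ? := C2_d2 C Dz; have ? := C2_d22 C Dz.
  have hl2 : is_derive y 1 (fun s => l (x, s)) be.
    by rewrite /l /affine/=; apply: is_derive_eq; rewrite /GRing.scale/= !(add0r, mul1r, mulr1, addr0).
  have /= ? := @is_derive1_comp _ (cut1 d) (fun s => l (x, s)) y _ _ (is_derive_cut1 d0 _) hl2.
  by rewrite /F2 /f2; apply: is_derive_eq; rewrite /GRing.scale/=; ring.
have b1 : bmeas D f1 by apply: bmeas_vanishing => //; exact: obox_box.
have b2 : bmeas D f2 by apply: bmeas_vanishing => //; exact: obox_box.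
have bc1 := bmeasM (bcut1 d0) bG.
have bc2 : bmeas D (fun z => cut2 d (l z) * 1 * N z).
  by apply: bmeasM => //; apply: bmeasM; [exact: bcut2|exact: bmeas_cst].
apply/eqP; rewrite -subr_eq0 opprK -intD//; apply/eqP.
transitivity (\int[mu2]_(z in D) (f1 z + f2 z)); last by rewrite intD// I1 I2 addr0.
apply: eq_int => z _.
by rewrite /f1 /f2 /G /N; ring.
Qed.

(** Multiplied by [cut1 d (l z)], the field eta grad u - u grad eta vanishes near the boundary, so
    its divergence has integral 0. As [d] tends to 0, the derivative of the extra factor leaves
    [cut2 d (l z)] against the flux [N]; its mass is bounded by [int_cut2_affine] and concentrates
    on the Neumann edge, where [N] tends to 0. *)
Lemma basic_green :
  \int[mu2]_(z in D) (cut0 e (g z) * (u11 z + u22 z)) =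
  \int[mu2]_(z in D) (u z * (cut1 e (g z) * (g11 z + g22 z)
    + cut2 e (g z) * (g1 z ^+ 2 + g2 z ^+ 2))).
Proof.
have [C hC] := int_cut2_affine al ga oD M0 DM be0.
have lim0 : \int[mu2]_(z in D) (cut2 (harmonic n) (l z) * 1 * N z) @[n --> \oo] --> (0 : R).
  apply: (@cvg_int_cut2 _ D mD fD l (cst 1) N C) => //; first exact: bmeas_cst.
    move=> d d0; under eq_Rintegral do rewrite mulr1; exact: hC.
  move=> eps eps0.
  have [t t0 ht] := compact_locally_small cK (@cont_affine _ al be ga) N_small eps0.
  by exists t => // z Dz; apply: ht => //; exact: subset_closure.
have lim1 : \int[mu2]_(z in D) (cut1 (harmonic n) (l z) * G z) @[n --> \oo] -->
    \int[mu2]_(z in D) G z.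
  have [mG [B hB]] := bG.
  apply: (@bounded_cvg_int _ D mD fD _ _ B) => //.
  - by move=> n; have := bmeasM (@bcut1 (harmonic n) _) bG; rewrite invr_gt0 ltr0n => /(_ isT)[].
  - move=> n z Dz; have n0 : 0 < harmonic n :> R by rewrite invr_gt0 ltr0n.
    rewrite normrM ger0_norm ?cut1_ge0// (le_trans _ (hB _ Dz))// ler_piMl//.
    exact: cut1_le1.
  - move=> z Dz; rewrite -[X in _ --> X]mul1r; apply: cvgM; last exact: cvg_cst.
    exact/cvg_cut1/hl.
have G0 : \int[mu2]_(z in D) G z = 0.
  apply: (cvg_unique _ lim1); first exact: norm_hausdorff.
  rewrite (_ : (fun n => _) = (fun n => - \int[mu2]_(z in D) (cut2 (harmonic n) (l z) * 1 * N z))).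
    by rewrite -oppr0; apply: cvgN.
  by apply/funext => n; rewrite div_eq0// invr_gt0 ltr0n.
apply/eqP; rewrite -subr_eq0 -intB//; last 2 first.
- apply: bmeasM; last exact: bmeas_neumann_lap hu.
  by apply: bmeas_continuous => z; exact: (C2_c Ceta).
- apply: bmeasM; first exact: bmeas_neumann hu.
  apply: bmeas_continuous => z.
  rewrite (_ : (fun z => _) = (fun z => eta11 z + eta22 z)).
    by apply: contD; [exact: (C2_c11 Ceta)|exact: (C2_c22 Ceta)].
  by apply/funext => y; rewrite /eta11 /eta22; ring.
rewrite -G0; apply/eqP; apply: eq_int => z _.
by rewrite /G /eta /eta11 /eta22; ring.
Qed.

End BasicGreen.
End Green.

(** * Green's formula up to the Dirichlet edges *)

Section DirichletGreen.
Variables (R : realType) (D : set (R * R)) (M al be ga : R).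
Variables (phi1 p1 p2 p11 p22 : R * R -> R).
Hypotheses (oD : open D) (M0 : 0 < M) (DM : D `<=` obox M) (be0 : be != 0).
Let l := affine al be ga.
Hypothesis hl : forall z, D z -> 0 < l z.
Hypothesis hin : forall z, closure D z -> 0 < phi1 z -> 0 < l z -> D z.
Hypothesis phi1_gt0 : forall z, D z -> 0 < phi1 z.

Let K := closure D.
Let cK := compact_closure_region DM.
Let mD := measurable_region oD.
Let fD := area_region oD DM.

Definition dirichlet_fun (u : R * R -> R) := forall z, K z -> phi1 z <= 0 -> u z = 0.

Lemma neumann_cst1 : neumann_fun D al be ga phi1 (cst 1) (cst 0) (cst 0) (cst 0) (cst 0).
Proof.
split; first exact: C2_const.
- by apply: continuous_subspaceT => z; exact: cvg_cst.
- by exists 0 => z _; rewrite addr0 normr0.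
- by move=> z _ _ _; under eq_fun do rewrite !mulr0 addr0; exact: cvg_cst.
Qed.

(** Limit of [basic_green] as [e] tends to 0. The term with [cut2 e (g z)] disappears because its
    mass concentrates on [g = 0]; there [phi1 <= 0] by positivity of [g], so [u] vanishes. *)
Lemma green_pos g g1 g2 g11 g22 u u1 u2 u11 u22 :
  test D al be ga phi1 g g1 g2 g11 g22 ->
  (forall z, K z -> 0 < phi1 z -> 0 < g z) ->
  neumann_fun D al be ga phi1 u u1 u2 u11 u22 -> dirichlet_fun u ->
  \int[mu2]_(z in D) (g z * (u11 z + u22 z)) =
  \int[mu2]_(z in D) (u z * (g11 z + g22 z)).
Proof.
move=> tg hg hu du.
have bg := basic_green oD M0 DM be0 hl hin _ tg.
have C := test_C2 tg.
have DK z : D z -> K z by exact: subset_closure.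
have gpos z : D z -> 0 < g z by move=> Dz; apply: hg; [exact: DK|exact: phi1_gt0].
have n0 n : 0 < harmonic n :> R by rewrite invr_gt0 ltr0n.
have b_g : bmeas D g by apply: (bmeas_continuous oD DM) => z; exact: (C2_c C).
have b_lg : bmeas D (fun z => g11 z + g22 z).
  by apply: (bmeas_continuous oD DM) => z; apply: contD; [exact: (C2_c11 C)|exact: (C2_c22 C)].
have b_rho : bmeas D (fun z => g1 z ^+ 2 + g2 z ^+ 2).
  apply: (bmeas_continuous oD DM) => z.
  by apply: contD; apply: contX2; [exact: (C2_c1 C)|exact: (C2_c2 C)].
have b_u : bmeas D u by exact: (bmeas_neumann oD DM hu).
have b_lu : bmeas D (fun z => u11 z + u22 z) by exact: (bmeas_neumann_lap oD hu).
have b_cut0 e : 0 < e -> bmeas D (fun z => cut0 e (g z)).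
  move=> e0; apply: (bmeas_continuous oD DM) => z; apply: cont_comp; first exact: continuous_cut0.
  exact: (C2_c C).
have b_cut1 e : 0 < e -> bmeas D (fun z => cut1 e (g z)).
  move=> e0; apply: (bmeas_continuous oD DM) => z; apply: cont_comp; first exact: continuous_cut1.
  exact: (C2_c C).
have b_cut2 e : 0 < e -> bmeas D (fun z => cut2 e (g z)).
  move=> e0; apply: (bmeas_continuous oD DM) => z; apply: cont_comp; first exact: continuous_cut2.
  exact: (C2_c C).
have [_ [B hB]] := b_lg.
(* For [u = 1] the left side of [basic_green] is 0: the mass of [cut2 e (g z)] weighted by the
   squared gradient of [g] is minus the integral of [cut1 e (g z)] times the Laplacian of [g], and
   [cut1] is at most 1. *)
have energy e : 0 < e -> \int[mu2]_(z in D) (cut2 e (g z) * (g1 z ^+ 2 + g2 z ^+ 2)) <=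
    \int[mu2]_(z in D) `|B|.
  move=> e0; have := bg _ _ _ _ _ _ e0 neumann_cst1.
  under eq_int do rewrite /cst addr0 mulr0.
  under [in RHS]eq_int do rewrite mul1r.
  rewrite Rintegral_cst// mul0r intD//; last 2 first.
  - exact: bmeasM (b_cut1 _ e0) b_lg.
  - exact: bmeasM (b_cut2 _ e0) b_rho.
  move/esym/eqP; rewrite addrC addr_eq0 => /eqP ->.
  rewrite (le_trans (ler_norm _))// normrN (le_trans (norm_int mD fD (bmeasM (b_cut1 _ e0) b_lg)))//.
  apply: le_int => //; [exact: bmeas_norm (bmeasM (b_cut1 _ e0) b_lg)|exact: bmeas_cst|].
  move=> z Dz; rewrite normrM ger0_norm ?cut1_ge0// (le_trans _ (ler_norm B))//.
  by rewrite (le_trans _ (hB _ Dz))// ler_piMl// cut1_le1.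
have lim2 : \int[mu2]_(z in D) (cut2 (harmonic n) (g z) * (g1 z ^+ 2 + g2 z ^+ 2) * u z)
    @[n --> \oo] --> (0 : R).
  apply: (@cvg_int_cut2 _ D mD fD g _ u _ b_u b_rho _ b_cut2 energy).
    by move=> z _; rewrite addr_ge0// sqr_ge0.
  move=> eps eps0.
  have small z : K z -> g z <= 0 -> forall eps, 0 < eps -> \forall y \near z, K y -> `|u y| <= eps.
    move=> Kz gz eps' eps'0.
    have uz : u z = 0 by apply: du => //; rewrite leNgt; apply/negP => /(hg _ Kz); rewrite ltNge gz.
    have : u @ within K (nbhs z) --> u z.
      by have /subspace_continuousP := neumann_c hu; exact.
    rewrite uz => /cvgrPdist_le/(_ _ eps'0).
    by rewrite near_withinE; apply: filterS => y + Ky => /(_ Ky); rewrite sub0r normrN.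
  have cg : continuous g by move=> z; exact: (C2_c C).
  have [t t0 ht] := compact_locally_small cK cg small eps0.
  by exists t => // z Dz; apply: ht; exact: DK.
have lim1 : \int[mu2]_(z in D) (u z * (cut1 (harmonic n) (g z) * (g11 z + g22 z)))
    @[n --> \oo] --> \int[mu2]_(z in D) (u z * (g11 z + g22 z)).
  have b_ulg := bmeasM b_u b_lg; have [m_ulg [B' hB']] := b_ulg.
  apply: (@bounded_cvg_int _ D mD fD _ _ B') => //.
  - by move=> n; have [] := bmeasM b_u (bmeasM (b_cut1 _ (n0 n)) b_lg).
  - move=> n z Dz; rewrite mulrCA normrM ger0_norm ?cut1_ge0// (le_trans _ (hB' _ Dz))//.
    by rewrite ler_piMl// cut1_le1.
  - move=> z Dz; apply: cvgM; first exact: cvg_cst.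
    rewrite -[X in _ --> X]mul1r; apply: cvgM; last exact: cvg_cst.
    exact/cvg_cut1/gpos.
have lim0 : \int[mu2]_(z in D) (cut0 (harmonic n) (g z) * (u11 z + u22 z))
    @[n --> \oo] --> \int[mu2]_(z in D) (g z * (u11 z + u22 z)).
  have b_glu := bmeasM b_g b_lu; have [m_glu [B' hB']] := b_glu.
  apply: (@bounded_cvg_int _ D mD fD _ _ B') => //.
  - by move=> n; have [] := bmeasM (b_cut0 _ (n0 n)) b_lu.
  - move=> n z Dz; rewrite (le_trans _ (hB' _ Dz))// !normrM ler_wpM2r//.
    have g0 := ltW (gpos _ Dz); have /andP[a b] := cut0_bound (n0 n) g0.
    by rewrite !ger0_norm.
  - move=> z Dz; apply: cvgM; last exact: cvg_cst.
    exact/cvg_cut0/gpos.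
have lim3 : \int[mu2]_(z in D) (cut0 (harmonic n) (g z) * (u11 z + u22 z))
    @[n --> \oo] --> \int[mu2]_(z in D) (u z * (g11 z + g22 z)) + 0.
  rewrite (_ : (fun n => _) = (fun n =>
    \int[mu2]_(z in D) (u z * (cut1 (harmonic n) (g z) * (g11 z + g22 z))) +
    \int[mu2]_(z in D) (cut2 (harmonic n) (g z) * (g1 z ^+ 2 + g2 z ^+ 2) * u z))).
    exact: cvgD lim1 lim2.
  apply/funext => n; rewrite (bg _ _ _ _ _ _ (n0 n) hu) -intD//.
  - by apply: eq_int => z _; ring.
  - exact: bmeasM b_u (bmeasM (b_cut1 _ (n0 n)) b_lg).
  - exact: bmeasM (bmeasM (b_cut2 _ (n0 n)) b_rho) b_u.
rewrite addr0 in lim3.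
by apply: (cvg_unique _ lim0 lim3); exact: norm_hausdorff.
Qed.

Hypothesis C_phi1 : C2_data setT phi1 p1 p2 p11 p22.
Hypothesis N_phi1 : forall z, K z -> 0 < phi1 z -> l z = 0 -> al * p1 z + be * p2 z = 0.

Record test_fun (f f1 f2 f11 f22 : R * R -> R) : Prop := {
  test_fun_C2 : C2_data setT f f1 f2 f11 f22;
  test_fun_N : forall z, K z -> 0 < phi1 z -> l z = 0 -> al * f1 z + be * f2 z = 0;
  test_fun_le : exists C : R, forall z, K z -> `|f z| <= C * phi1 z }.

Lemma phi1_ge0 z : K z -> 0 <= phi1 z.
Proof.
move=> Kz; rewrite leNgt; apply/negP => lz.
have [y [Dy ly]] := Kz _ (near_lt (C2_c C_phi1 I) lz).
by have := lt_trans ly (phi1_gt0 Dy); rewrite ltxx.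
Qed.

Lemma test_fun_phi1 : test_fun phi1 p1 p2 p11 p22.
Proof.
by split => //; exists 1 => z Kz; rewrite mul1r ger0_norm// phi1_ge0.
Qed.

Lemma test_fun_lin (c : R) f f1 f2 f11 f22 g g1 g2 g11 g22 :
  test_fun f f1 f2 f11 f22 -> test_fun g g1 g2 g11 g22 ->
  test_fun (fun z => f z + c * g z) (fun z => f1 z + c * g1 z)
   (fun z => f2 z + c * g2 z) (fun z => f11 z + c * g11 z) (fun z => f22 z + c * g22 z).
Proof.
move=> [Cf Nf [a ha]] [Cg Ng [b hb]]; split; first exact: C2_lin.
  move=> z Kz pz lz; rewrite !mulrDr !(mulrCA _ c) addrACA -mulrDr Nf// Ng//.
  by rewrite mulr0 addr0.
exists (a + `|c| * b) => z Kz; rewrite mulrDl (le_trans (ler_normD _ _))// lerD ?ha//.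
by rewrite normrM -mulrA ler_wpM2l// hb.
Qed.

Lemma test_fun_neumann f f1 f2 f11 f22 : test_fun f f1 f2 f11 f22 ->
  neumann_fun D al be ga phi1 f f1 f2 f11 f22.
Proof.
move=> [C N _]; split; first exact: C2_sub C.
- by apply: continuous_subspaceT => z; exact: (C2_c C).
- have [] := bmeas_continuous oD DM (f := fun z => f11 z + f22 z); last by [].
  by move=> z; apply: contD; [exact: (C2_c11 C)|exact: (C2_c22 C)].
- move=> z Kz pz lz; rewrite -(N _ Kz pz lz); apply: cvg_within_filter.
  by apply: contD; apply: contM; [exact: cont_cst|exact: (C2_c1 C)|exact: cont_cst|exact: (C2_c2 C)].
Qed.

Lemma test_fun_dirichlet f f1 f2 f11 f22 : test_fun f f1 f2 f11 f22 -> dirichlet_fun f.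
Proof.
move=> [_ _ [C hC]] z Kz pz; have p0 : phi1 z = 0 by apply/eqP; rewrite eq_le pz phi1_ge0.
by have := hC _ Kz; rewrite p0 mulr0 normr_le0 => /eqP.
Qed.

(** The function [f] may change sign, but [phi1 + c f] with [c = 1 / (|C| + 1)] is positive exactly
    where [phi1] is. Applying [green_pos] to it and to [phi1] and subtracting leaves the formula for
    [f]. *)
Lemma green f f1 f2 f11 f22 u u1 u2 u11 u22 :
  test_fun f f1 f2 f11 f22 ->
  neumann_fun D al be ga phi1 u u1 u2 u11 u22 -> dirichlet_fun u ->
  \int[mu2]_(z in D) (f z * (u11 z + u22 z)) =
  \int[mu2]_(z in D) (u z * (f11 z + f22 z)).
Proof.
move=> tf hu du; have [_ _ [C hC]] := tf.
pose c := (`|C| + 1)^-1; have c0 : 0 < c by rewrite invr_gt0 ltr_wpDl.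
have tg := test_fun_lin c test_fun_phi1 tf.
have cf z : K z -> `|c * f z| <= c * `|C| * phi1 z.
  move=> Kz; rewrite normrM gtr0_norm// -mulrA ler_pM2l// (le_trans (hC _ Kz))//.
  by rewrite ler_wpM2r ?phi1_ge0// ler_norm.
have cC : c * `|C| < 1 by rewrite /c mulrC ltr_pdivrMr ?mul1r ?ltrDl// ltr_wpDl.
have g_gt0 z : K z -> 0 < phi1 z -> 0 < phi1 z + c * f z.
  move=> Kz pz; have := cf _ Kz; rewrite ler_norml => /andP[h _].
  have : c * `|C| * phi1 z < phi1 z by rewrite gtr_pMl.
  by move=> ?; lra.
have tg' : test D al be ga phi1 (fun z => phi1 z + c * f z) (fun z => p1 z + c * f1 z)
   (fun z => p2 z + c * f2 z) (fun z => p11 z + c * f11 z) (fun z => p22 z + c * f22 z).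
  split; [exact: test_fun_C2 tg| |exact: test_fun_N tg].
  move=> z Kz; apply: contraTT; rewrite -!leNgt => pz.
  by rewrite (test_fun_dirichlet tf)// mulr0 addr0.
have E1 := green_pos tg' g_gt0 hu du.
have tp : test D al be ga phi1 phi1 p1 p2 p11 p22 by split.
have E0 := green_pos tp (fun _ _ h => h) hu du.
have b_f : bmeas D f by apply: (bmeas_continuous oD DM) => z; exact: (C2_c (test_fun_C2 tf)).
have b_p : bmeas D phi1 by apply: (bmeas_continuous oD DM) => z; exact: (C2_c C_phi1).
have b_u : bmeas D u by exact: (bmeas_neumann oD DM hu).
have b_lu : bmeas D (fun z => u11 z + u22 z) by exact: (bmeas_neumann_lap oD hu).
have b_lf : bmeas D (fun z => f11 z + f22 z).
  have C' := test_fun_C2 tf.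
  by apply: (bmeas_continuous oD DM) => z; apply: contD; [exact: (C2_c11 C')|exact: (C2_c22 C')].
have b_lp : bmeas D (fun z => p11 z + p22 z).
  by apply: (bmeas_continuous oD DM) => z; apply: contD; [exact: (C2_c11 C_phi1)|exact: (C2_c22 C_phi1)].
have L : \int[mu2]_(z in D) ((phi1 z + c * f z) * (u11 z + u22 z)) =
  \int[mu2]_(z in D) (phi1 z * (u11 z + u22 z)) + c * \int[mu2]_(z in D) (f z * (u11 z + u22 z)).
  have b1 := bmeasM b_p b_lu; have b2 := bmeasM b_f b_lu.
  rewrite -(intZ mD fD c b2) -(intD mD fD b1 (bmeasM (bmeas_cst D c) b2)).
  by apply: eq_int => z _; ring.
have L' : \int[mu2]_(z in D) (u z * (p11 z + c * f11 z + (p22 z + c * f22 z))) =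
  \int[mu2]_(z in D) (u z * (p11 z + p22 z)) + c * \int[mu2]_(z in D) (u z * (f11 z + f22 z)).
  have b1 := bmeasM b_u b_lp; have b2 := bmeasM b_u b_lf.
  rewrite -(intZ mD fD c b2) -(intD mD fD b1 (bmeasM (bmeas_cst D c) b2)).
  by apply: eq_int => z _; ring.
by move: E1; rewrite L L' E0 => /addrI /(mulfI _); apply; rewrite gt_eqF.
Qed.

End DirichletGreen.

(** * Fourier coefficients of the heat flow *)

Section Partials.
Variable R : realType.
Implicit Types (v : R * R -> R).

Lemma is_derive_partial1 v (x y : R) : derivable v (x, y) (1, 0) ->
  is_derive x 1 (fun s => v (s, y)) (partial1 v (x, y)).
Proof.
have E : (fun h : R => h^-1 *: ((v \o shift (x, y)) (h *: (1, 0)) - v (x, y))) =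
    (fun h : R => h^-1 *: (((fun s => v (s, y)) \o shift x) (h *: 1) - v (x, y))).
  apply/funext => h /=; congr (_ *: (v _ - _)).
  transitivity (h * 1 + x, h * 0 + y); first by [].
  by rewrite mulr0 add0r.
move=> d; split; first by move: d; rewrite /derivable E.
by rewrite /partial1 /derive E.
Qed.

Lemma is_derive_partial2 v (x y : R) : derivable v (x, y) (0, 1) ->
  is_derive y 1 (fun s => v (x, s)) (partial2 v (x, y)).
Proof.
have E : (fun h : R => h^-1 *: ((v \o shift (x, y)) (h *: (0, 1)) - v (x, y))) =
    (fun h : R => h^-1 *: (((fun s => v (x, s)) \o shift y) (h *: 1) - v (x, y))).
  apply/funext => h /=; congr (_ *: (v _ - _)).
  transitivity (h * 0 + x, h * 1 + y); first by [].
  by rewrite mulr0 add0r.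
move=> d; split; first by move: d; rewrite /derivable E.
by rewrite /partial2 /derive E.
Qed.

Lemma C2_on_data (D : set (R * R)) v : (forall z, D z -> {for z, continuous v}) ->
  C2_on D v -> C2_data D v (partial1 v) (partial2 v)
    (partial1 (partial1 v)) (partial2 (partial2 v)).
Proof.
move=> cv [h h1 h2]; split.
- by move=> x y /h[d _ _ _]; exact: is_derive_partial1.
- by move=> x y /h[_ d _ _]; exact: is_derive_partial2.
- by move=> x y /h1[d _ _ _]; exact: is_derive_partial1.
- by move=> x y /h2[_ d _ _]; exact: is_derive_partial2.
- exact: cv.
- by move=> z /h[].
- by move=> z /h[].
- by move=> z /h1[].
- by move=> z /h2[].
Qed.

End Partials.

Section HeatCoefficients.
Variables (R : realType) (P : polygon R) (M al be ga : R).
Variables (phi1 p1 p2 p11 p22 : R * R -> R).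
Let D := region P.
Hypotheses (oD : open D) (M0 : 0 < M) (DM : D `<=` obox M) (be0 : be != 0).
Let l := affine al be ga.
Hypothesis hl : forall z, D z -> 0 < l z.
Hypothesis hin : forall z, closure D z -> 0 < phi1 z -> 0 < l z -> D z.
Hypothesis phi1_gt0 : forall z, D z -> 0 < phi1 z.
Hypothesis C_phi1 : C2_data setT phi1 p1 p2 p11 p22.
Hypothesis N_phi1 : forall z, closure D z -> 0 < phi1 z -> l z = 0 ->
  al * p1 z + be * p2 z = 0.
Hypothesis dirichlet_edges : forall z, closure D z -> phi1 z <= 0 ->
  exists i, [/\ (i < size P)%N, label P i = Dirichlet & edge P i z].
Hypothesis neumann_edges : forall z, closure D z -> 0 < phi1 z -> l z = 0 ->
  exists i k, [/\ (i < size P)%N, label P i = Neumann, open_edge P i z &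
    al = k * (outward_normal P i).1 /\ be = k * (outward_normal P i).2].

Let K := closure D.
Let cK : compact K := compact_closure_region DM.
Let mD := measurable_region oD.
Let fD := area_region oD DM.

(* All the frequencies that occur have the form [n = i ^ 2 + j ^ 2], see [freq]. *)
Definition eigenvalue (n : nat) : R := pi ^+ 2 / 4 * n%:R.

Definition eigenfun (n : nat) (f : R * R -> R) :=
  exists f1 f2 f11 f22, test_fun D al be ga phi1 f f1 f2 f11 f22 /\
    forall z, f11 z + f22 z = - eigenvalue n * f z.

Lemma eigenfun_continuous n f : eigenfun n f -> continuous f.
Proof. by move=> [f1 [f2 [f11 [f22 [[C _ _] _]]]]] z; exact: (C2_c C). Qed.

Lemma bmeas_eigenfun n f : eigenfun n f -> bmeas D f.
Proof. by move=> /eigenfun_continuous cf; apply: (bmeas_continuous oD DM). Qed.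

Lemma eigenfun_lin n (c : R) f g : eigenfun n f -> eigenfun n g ->
  eigenfun n (fun z => f z + c * g z).
Proof.
move=> [f1 [f2 [f11 [f22 [tf Lf]]]]] [g1 [g2 [g11 [g22 [tg Lg]]]]].
exists (fun z => f1 z + c * g1 z), (fun z => f2 z + c * g2 z).
exists (fun z => f11 z + c * g11 z), (fun z => f22 z + c * g22 z).
split; first exact: test_fun_lin.
by move=> z /=; rewrite addrACA Lf -mulrDr Lg; ring.
Qed.

Lemma eigenfun_orthogonal n m f g : n != m -> eigenfun n f -> eigenfun m g ->
  \int[mu2]_(z in D) (f z * g z) = 0.
Proof.
move=> nm ef eg; have b := bmeasM (bmeas_eigenfun ef) (bmeas_eigenfun eg).
have b' := bmeasM (bmeas_eigenfun eg) (bmeas_eigenfun ef).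
move: ef eg => [f1 [f2 [f11 [f22 [tf Lf]]]]] [g1 [g2 [g11 [g22 [tg Lg]]]]].
have := green oD M0 DM be0 hl hin phi1_gt0 C_phi1 N_phi1 tf
  (test_fun_neumann oD DM tg) (test_fun_dirichlet phi1_gt0 C_phi1 tg).
under eq_int do rewrite Lg mulrCA.
under [in RHS]eq_int do rewrite Lf mulrCA.
rewrite !intZ// (eq_int (f := fun z => g z * f z) (g := fun z => f z * g z)); last first.
  by move=> z _; rewrite mulrC.
move/eqP; rewrite -subr_eq0 -mulrBl mulf_eq0 => /orP[|/eqP//].
rewrite opprK addrC subr_eq0 /eigenvalue => /eqP/mulfI.
have p0 : pi ^+ 2 / 4 != 0 :> R by rewrite gt_eqF// divr_gt0// exprn_gt0// pi_gt0.
by move=> /(_ p0)/eqP; rewrite eqr_nat (negbTE nm).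
Qed.

Variable u : R -> R * R -> R.
Hypothesis heat : mixed_heat_equation P u.
Hypothesis initial :
  (\int[area_measure R]_(x in D) ((u t x - 1) ^+ 2)%:E)%E @[t --> 0^'+] --> 0%E.

Let Q : set (R * (R * R)) := [set z | 0 < z.1 /\ closure D z.2].

Let section_cont (F : R * (R * R) -> R) t : 0 < t -> {within Q, continuous F} ->
  {within K, continuous (fun x => F (t, x))}.
Proof.
move=> t0 /subspace_continuousP cF; apply/subspace_continuousP => x Kx.
apply: cvg_trans (cF (t, x) _); last by split.
move=> A [[B1 B2] /= [nB1 nB2] hB].
change (nbhs x [set y | K y -> A (F (t, y))]).
apply: filterS nB2 => y B2y Ky; apply: (hB (t, y)) => //=.
by split => //; exact: nbhs_singleton.
Qed.

Lemma heat_within_continuous (t : R) : 0 < t -> {within K, continuous (u t)}.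
Proof. by move=> t0; exact: section_cont t0 (heat_continuous heat). Qed.

Lemma heat_derivative_bounded a b : 0 < a -> exists B : R, forall t x,
  a <= t <= b -> K x -> `|time_derivative u t x| <= B.
Proof.
move=> a0; have cS : compact (`[a, b]%classic `*` K).
  by apply: compact_setX => //; exact: segment_compact.
have SQ : `[a, b]%classic `*` K `<=` Q.
  move=> [t x] [/=]; rewrite in_itv/= => /andP[at_ _] Kx; split => //=.
  exact: lt_le_trans at_.
have cF := continuous_subspaceW SQ (heat_time_derivative_continuous heat).
have /compact_bounded[B [_ hB]] := continuous_compact cF cS.
exists (B + 1) => t x tab Kx; apply: (hB (B + 1)); first by rewrite ltrDl.
by exists (t, x) => //; split => //=; rewrite in_itv.
Qed.

Lemma heat_neumann_fun (t : R) : 0 < t ->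
  neumann_fun D al be ga phi1 (u t) (partial1 (u t)) (partial2 (u t))
   (partial1 (partial1 (u t))) (partial2 (partial2 (u t))).
Proof.
move=> t0; split.
- apply: C2_on_data; last exact: heat_C2 heat _ t0.
  have cD : {within D, continuous (u t)}.
    by apply: continuous_subspaceW (heat_within_continuous t0); exact: subset_closure.
  move=> z Dz; move: cD; rewrite continuous_open_subspace//.
  by move=> /(_ z); apply; rewrite inE.
- exact: heat_within_continuous.
- have [B hB] := @heat_derivative_bounded t t t0.
  exists B => z Dz; have := heat_equation heat t0 Dz; rewrite /laplacian => ->.
  by apply: hB; [rewrite lexx|exact: subset_closure].
- move=> z Kz pz lz; have [i [k [iP li oi [-> ->]]]] := neumann_edges Kz pz lz.
  have := heat_Neumann heat t0 iP li oi => h.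
  move: h; move: (outward_normal P i) => [n1 n2] /= h.
  rewrite (_ : (fun y => _) = (fun y => k * (n1 * partial1 (u t) y + n2 * partial2 (u t) y))).
    by rewrite -(mulr0 k); apply: cvgM; [exact: cvg_cst|exact: h].
  by apply/funext => y; ring.
Qed.

Lemma heat_dirichlet_fun (t : R) : 0 < t -> dirichlet_fun D phi1 (u t).
Proof.
by move=> t0 z Kz /(dirichlet_edges Kz)[i [iP li ei]]; exact: (heat_Dirichlet heat t0 iP li ei).
Qed.

Let b_u t : 0 < t -> bmeas D (u t).
Proof. by move=> t0; exact: (bmeas_neumann oD DM (heat_neumann_fun t0)). Qed.

(** On the times between t / 2 and 2 t the time derivative is bounded by compactness, which
    dominates the differentiation under the integral; the heat equation and [green] then move the
    Laplacian onto [f]. *)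
Lemma is_derive_heat_coef n f (t : R) : eigenfun n f -> 0 < t ->
  is_derive t 1 (fun s => \int[mu2]_(z in D) (u s z * f z))
    (- eigenvalue n * \int[mu2]_(z in D) (u t z * f z)).
Proof.
move=> ef t0; have b_f := bmeas_eigenfun ef.
pose F s z := u s z * f z.
have [B hB] := @heat_derivative_bounded (t / 2) (2 * t) ltac:(by rewrite divr_gt0).
have [mf [B' hB']] := b_f.
have I0 (s : R) : `]t / 2, 2 * t[%classic s -> 0 < s /\ t / 2 <= s <= 2 * t.
  by rewrite /= in_itv/= => /andP[a b]; rewrite !ltW// (lt_trans _ a)// divr_gt0.
have It : `]t / 2, 2 * t[%classic t by rewrite /= in_itv/=; apply/andP; split; lra.
have dF (s : R) z : `]t / 2, 2 * t[%classic s -> D z ->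
    is_derive s 1 (F ^~ z) (time_derivative u s z * f z).
  move=> /I0[s0 _] Dz; have d := heat_derivable heat s0 (subset_closure Dz).
  have ? : is_derive s 1 (fun s => u s z) (time_derivative u s z).
    by split => //; rewrite /time_derivative derive1E.
  by rewrite /F; apply: is_derive_eq; rewrite /GRing.scale/=; ring.
have intF (s : R) : `]t / 2, 2 * t[%classic s -> mu2.-integrable D (EFin \o F s).
  by move=> /I0[s0 _]; apply: bmeas_integrable => //; apply: bmeasM => //; exact: b_u.
have derF (s : R) z : `]t / 2, 2 * t[%classic s -> D z -> derivable (F ^~ z) s 1.
  by move=> Is Dz; have [] := dF s z Is Dz.
have G_ub (s : R) z : `]t / 2, 2 * t[%classic s -> D z ->
    `|partial1of2 F s z| <= cst (`|B| * `|B'|) z.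
  move=> Is Dz; have [_ E] := dF s z Is Dz; rewrite partial1of2E E normrM.
  have [s0 sI] := I0 _ Is.
  apply: ler_pM => //; first by rewrite (le_trans (hB _ _ sI (subset_closure Dz)))// ler_norm.
  by rewrite (le_trans (hB' _ Dz))// ler_norm.
have intG : mu2.-integrable D (EFin \o cst (`|B| * `|B'|)).
  by apply: bmeas_integrable => //; exact: bmeas_cst.
have G0 (z : mR2 R) : 0 <= cst (`|B| * `|B'|) z by rewrite mulr_ge0.
have d := derivable_under_integral mD It intF derF G0 intG G_ub.
have e := differentiation_under_integral mD It intF derF G0 intG G_ub.
split; first exact: d.
rewrite -derive1E e.
move: (ef) => [f1 [f2 [f11 [f22 [tf Lf]]]]].
have := green oD M0 DM be0 hl hin phi1_gt0 C_phi1 N_phi1 tf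
  (heat_neumann_fun t0) (heat_dirichlet_fun t0).
under [in RHS]eq_int do rewrite Lf mulrCA.
rewrite intZ//; last by apply: bmeasM => //; exact: b_u.
move=> <-; apply: eq_int => z Dz; rewrite partial1of2E.
have [_ ->] := dF _ _ It Dz.
by have := heat_equation heat t0 Dz; rewrite /laplacian => ->; rewrite mulrC.
Qed.

(** The coefficient times exp(lambda s) has zero derivative, so it is constant on s > 0; convergence
    of [u] to 1 in L^2 fixes the constant as s tends to 0. *)
Lemma heat_coef n f (t : R) : eigenfun n f -> 0 < t ->
  \int[mu2]_(z in D) (u t z * f z) =
  expR (- (eigenvalue n * t)) * \int[mu2]_(z in D) f z.
Proof.
move=> ef; pose a s := \int[mu2]_(z in D) (u s z * f z).
have b_f := bmeas_eigenfun ef.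
pose b s := expR (eigenvalue n * s) * a s.
have db (s : R) : 0 < s -> is_derive s 1 b 0.
  move=> s0; have ? := is_derive_heat_coef ef s0.
  have ? : is_derive s 1 (fun s => eigenvalue n * s) (eigenvalue n).
    by apply: is_derive_eq; rewrite /GRing.scale/= !(mulr1, mulr0, addr0).
  have ? := @is_derive1_comp _ expR (fun s => eigenvalue n * s) s _ _ (is_derive_expR _) _.
  by rewrite /b /a; apply: is_derive_eq; rewrite /GRing.scale/=; ring.
have bcst (s s' : R) : 0 < s -> s < s' -> b s = b s'.
  move=> s0 ss'.
  have h1 x : x \in `]s, s'[ -> is_derive x 1 b (cst 0 x).
    by rewrite in_itv/= => /andP[sx _]; apply: db; exact: lt_trans sx.
  have h2 : {within `[s, s'], continuous b}.
    apply: derivable_within_continuous => x; rewrite in_itv/= => /andP[sx _].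
    by have [] := db x (lt_le_trans s0 sx).
  have [c _] := MVT ss' h1 h2.
  by rewrite mul0r => /eqP; rewrite subr_eq0 => /eqP.
have lim_a : a s @[s --> 0^'+] --> \int[mu2]_(z in D) f z.
  have [mf [B hB]] := b_f.
  pose ar := fine (mu2 D); have ar0 : 0 <= ar by exact: fine_ge0.
  apply/cvgrPdist_le => eps eps0.
  (* With this [s] the term [s / 2 * B ^+ 2 * ar] of the AM-GM bound is at most [eps / 2], and so is
     the other one once the squared L^2 distance from [u] to 1 is below [s * eps]. The summand 1
     only keeps [c] positive. *)
  pose c := B ^+ 2 * ar + 1; have c0 : 0 < c by rewrite ltr_wpDl// mulr_ge0// sqr_ge0.
  pose s := eps / c; have s_gt0 : 0 < s by rewrite divr_gt0.
  have se0 : 0 < s * eps by rewrite mulr_gt0.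
  have /fine_cvgP[N0 I_small] := initial.
  move/cvgrPdist_le: I_small => /(_ _ se0).
  have pos : \forall t \near (0 : R)^'+, 0 < t by exact: nbhs_right_gt.
  move=> hs; move: pos hs; apply: filterS2 => {}t t0; rewrite /= sub0r normrN => ht.
  have b_v : bmeas D (fun z => u t z - 1) by apply: bmeasB; [exact: b_u|exact: bmeas_cst].
  rewrite /a -intB//; last by apply: bmeasM => //; exact: b_u.
  have -> : \int[mu2]_(z in D) (f z - u t z * f z) = \int[mu2]_(z in D) (- ((u t z - 1) * f z)).
    by apply: eq_int => z _; ring.
  have b_vf := bmeasN (bmeasM b_v b_f).
  have b_v2 : bmeas D (fun z => (u t z - 1) ^+ 2) by exact: (bmeasM b_v b_v).
  have b_r : bmeas D (fun z => (2 * s)^-1 * (u t z - 1) ^+ 2 + s / 2 * B ^+ 2).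
    by apply: bmeasD; [apply: bmeasM => //|]; exact: bmeas_cst.
  rewrite (le_trans (norm_int mD fD b_vf))// (le_trans (le_int mD fD (bmeas_norm b_vf) b_r _))//.
    move=> z Dz; rewrite normrN normrM.
    (* AM-GM: [|v| |f| <= v^2 / (2 s) + s f^2 / 2] *)
    apply: (@le_trans _ _ ((2 * s)^-1 * (u t z - 1) ^+ 2 + s / 2 * `|f z| ^+ 2)).
      rewrite -[in X in _ <= X](real_normK (num_real (u t z - 1))) -subr_ge0.
      set v := `|_ - 1|; set w := `|f z|.
      have -> : (2 * s)^-1 * v ^+ 2 + s / 2 * w ^+ 2 - v * w = (2 * s)^-1 * (v - s * w) ^+ 2.
        by field; rewrite gt_eqF.
      by rewrite mulr_ge0 ?sqr_ge0// invr_ge0 mulr_ge0// ltW.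
    rewrite lerD2l ler_pM2l ?divr_gt0//.
    by rewrite ler_pXn2r ?nnegrE ?hB// (le_trans _ (hB _ Dz)).
  rewrite intD//; [|by apply: bmeasZ|exact: bmeas_cst].
  rewrite intZ// Rintegral_cst// -/ar (splitr eps) lerD//.
    have -> : eps / 2 = (2 * s)^-1 * (s * eps) by field; rewrite gt_eqF.
    have s2 : 0 < (2 * s)^-1 by rewrite invr_gt0 (mulr_gt0 _ s_gt0).
    by rewrite (ler_pM2l s2) (le_trans (ler_norm _)).
  have -> : s / 2 * B ^+ 2 * ar = eps / 2 * (B ^+ 2 * ar / c).
    by rewrite /s; field; rewrite gt_eqF.
  rewrite ler_piMr ?divr_ge0 ?(ltW eps0)// ler_pdivrMr// mul1r /c.
  by rewrite lerDl.
move=> t0; have bt s : 0 < s -> s < t -> a s = expR (- (eigenvalue n * s)) * b t.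
  by move=> s0 st; rewrite -(bcst s t s0 st) /b mulrA -expRD addNr expR0 mul1r.
have lim_b : a s @[s --> 0^'+] --> expR (- (eigenvalue n * 0)) * b t.
  apply: (@cvg_trans _ ((fun s => expR (- (eigenvalue n * s)) * b t) @ 0^'+)).
    apply: near_eq_cvg; near=> s; apply/esym/bt; near: s; first exact: nbhs_right_gt.
    exact: nbhs_right_lt.
  apply: cvg_at_right_filter; apply: cvgM; last exact: cvg_cst.
  apply: (@continuous_comp _ _ _ (fun s => - (eigenvalue n * s)) expR); last exact: continuous_expR.
  by apply: cvgN; apply: cvgM; [exact: cvg_cst|exact: cvg_id].
have := cvg_unique _ lim_a lim_b; rewrite mulr0 oppr0 expR0 mul1r => ->.
  by rewrite /b mulrA -expRD addNr expR0 mul1r.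
exact: norm_hausdorff.
Unshelve. all: by end_near. Qed.

End HeatCoefficients.

(** * Long-time asymptotics from finite spectral sums *)

Section SpectralAsymptotics.
Variables (R : realType) (P : polygon R) (M al be ga : R).
Variables (phi1 p1 p2 p11 p22 : R * R -> R).
Let D := region P.
Hypotheses (oD : open D) (M0 : 0 < M) (DM : D `<=` obox M) (be0 : be != 0).
Let l := affine al be ga.
Hypothesis hl : forall z, D z -> 0 < l z.
Hypothesis hin : forall z, closure D z -> 0 < phi1 z -> 0 < l z -> D z.
Hypothesis phi1_gt0 : forall z, D z -> 0 < phi1 z.
Hypothesis C_phi1 : C2_data setT phi1 p1 p2 p11 p22.
Hypothesis N_phi1 : forall z, closure D z -> 0 < phi1 z -> l z = 0 ->
  al * p1 z + be * p2 z = 0.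
Hypothesis dirichlet_edges : forall z, closure D z -> phi1 z <= 0 ->
  exists i, [/\ (i < size P)%N, label P i = Dirichlet & edge P i z].
Hypothesis neumann_edges : forall z, closure D z -> 0 < phi1 z -> l z = 0 ->
  exists i k, [/\ (i < size P)%N, label P i = Neumann, open_edge P i z &
    al = k * (outward_normal P i).1 /\ be = k * (outward_normal P i).2].

Let K := closure D.
Let cK : compact K := compact_closure_region DM.
Let mD := measurable_region oD.
Let fD := area_region oD DM.

Notation eigenfun := (eigenfun P al be ga phi1).
Notation eigenvalue := (eigenvalue R).

Let bmeas_eigen n f : eigenfun n f -> bmeas D f.
Proof. exact: (bmeas_eigenfun oD DM). Qed.

Let orthogonal n m f g : n != m -> eigenfun n f -> eigenfun m g ->
  \int[mu2]_(z in D) (f z * g z) = 0.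
Proof. exact: (eigenfun_orthogonal oD M0 DM be0 hl hin phi1_gt0 C_phi1 N_phi1). Qed.

Lemma int_sqr_sum (c : nat -> R * R -> R) (b : nat -> R) (s : seq nat) : uniq s ->
  (forall n, eigenfun n (c n)) ->
  \int[mu2]_(z in D) ((\sum_(n <- s) b n * c n z) ^+ 2) =
  \sum_(n <- s) b n ^+ 2 * \int[mu2]_(z in D) (c n z ^+ 2).
Proof.
move=> + ec; have bc n : bmeas D (c n) by exact: bmeas_eigen (ec n).
have bbc n : bmeas D (fun z => b n * c n z) by apply: bmeasZ.
elim: s => [_|x s ih /= /andP[xs us]].
  rewrite big_nil; under eq_int do rewrite big_nil expr0n/=.
  by rewrite Rintegral_cst// mul0r.
rewrite big_cons -ih//.
pose S z := \sum_(n <- s) b n * c n z.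
have bS : bmeas D S by exact: bmeas_sum.
have cS : \int[mu2]_(z in D) (c x z * S z) = 0.
  rewrite (eq_int (g := fun z => \sum_(n <- s) b n * (c x z * c n z))); last first.
    by move=> z _; rewrite /S mulr_sumr; apply: eq_bigr => n _; rewrite mulrCA.
  rewrite int_sum//; last by move=> n; apply: bmeasM; [exact: bmeas_cst|exact: bmeasM].
  rewrite big_seq big1// => n ns.
  have xn : x != n by apply: contraNneq xs => ->.
  by rewrite intZ ?(orthogonal xn (ec x) (ec n)) ?mulr0//; exact: bmeasM.
have b1 : bmeas D (fun z => c x z ^+ 2) by exact: bmeasM (bc x) (bc x).
have b2 : bmeas D (fun z => S z ^+ 2) by exact: (bmeasM bS bS).
have b3 := bmeasM (bc x) bS.
rewrite [LHS](eq_int (g := fun z => b x ^+ 2 * c x z ^+ 2 + (2 * b x * (c x z * S z) + S z ^+ 2))); last first.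
  by move=> z _; rewrite big_cons -/(S z); ring.
rewrite intD//; [|by apply: bmeasZ|].
  rewrite intZ// intD// ?intZ// ?cS ?mulr0 ?add0r//.
  by apply: bmeasZ.
by apply: bmeasD => //; apply: bmeasM => //; exact: bmeas_cst.
Qed.

Variable e : R * R -> R.
Hypothesis e5 : eigenfun 5%N e.
Hypothesis e_neq0 : e = cst 0 \/ \int[mu2]_(z in D) (e z ^+ 2) != 0.

(* Among the frequencies below [8] only [5] contributes, through a multiple of [e]. *)
Definition spectral (g : R * R -> R) := exists N (c : nat -> R * R -> R),
  [/\ forall n, eigenfun n (c n),
      forall z, g z = \sum_(0 <= n < 8 + N) c n z &
      forall n, (n < 8)%N -> exists a, forall z, c n z = if n == 5%N then a * e z else 0].

Variable u : R -> R * R -> R.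
Hypothesis heat : mixed_heat_equation P u.
Hypothesis initial :
  (\int[area_measure R]_(x in D) ((u t x - 1) ^+ 2)%:E)%E @[t --> 0^'+] --> 0%E.

Let coef n f t : eigenfun n f -> 0 < t ->
  \int[mu2]_(z in D) (u t z * f z) =
  expR (- (eigenvalue n * t)) * \int[mu2]_(z in D) f z.
Proof.
exact: (heat_coef oD M0 DM be0 hl hin phi1_gt0 C_phi1 N_phi1 dirichlet_edges neumann_edges).
Qed.

Let b_u t : 0 < t -> bmeas D (u t).
Proof.
by move=> t0; exact: (bmeas_neumann oD DM (heat_neumann_fun oD DM neumann_edges heat t0)).
Qed.

(** The Fourier coefficient of 1 along [e]; for [e = 0] division by zero makes it 0, as it should
    be. *)
Let leading := \int[mu2]_(z in D) e z / \int[mu2]_(z in D) (e z ^+ 2).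
Let area := fine (mu2 D).

Let b_e : bmeas D e. Proof. exact: bmeas_eigen e5. Qed.

(** Split g = a e + W with W carried by frequencies at least 8. Pairing with [u t] multiplies each
    mode of W by its decay factor, at most that of frequency 8, and Parseval with |g| <= 1 bounds
    the square integral of W by the area. The bound depends on [g] only through its supremum, so it
    survives a limit in [g]. *)
Lemma spectral_bound g t : spectral g -> (forall z, D z -> `|g z| <= 1) -> 0 < t ->
  `|\int[mu2]_(z in D) (u t z * g z)
    - expR (- (eigenvalue 5%N * t)) * (leading * \int[mu2]_(z in D) (g z * e z))|
  <= area * expR (- (eigenvalue 8%N * t)).
Proof.
move=> [N [c [ec gE c8]]] g1 t0.
have ar0 : 0 <= area by exact: fine_ge0.
have [a ha] := c8 5%N isT.
pose s := index_iota 8 (8 + N).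
have us : uniq s by exact: iota_uniq.
have s8 n : n \in s -> (8 <= n)%N by rewrite mem_index_iota => /andP[].
pose W z := \sum_(n <- s) 1 * c n z.
have bc n : bmeas D (c n) by exact: bmeas_eigen (ec n).
have bbc (b : nat -> R) n : bmeas D (fun z => b n * c n z) by apply: bmeasZ.
have bW : bmeas D W by apply: bmeas_sum => n; exact: (bbc (fun=> 1)).
have gW z : g z = a * e z + W z.
  rewrite gE (@big_cat_nat _ _ _ 8)//=.
  congr (_ + _); last by rewrite /W; apply: eq_bigr => n _; rewrite mul1r.
  rewrite big_nat (eq_bigr (fun n => if n == 5%N then a * e z else 0)); last first.
    move=> n /andP[_ /c8[b hb]]; have [n5|n5] := eqVneq n 5%N; first by rewrite n5 ha.
    by rewrite hb (negbTE n5).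
  by rewrite -big_nat big_mkord !big_ord_recl big_ord0 /= !(add0r, addr0).
have bb : bmeas D (fun z => a * e z) by apply: bmeasZ.
have bg : bmeas D g by rewrite (_ : g = fun z => a * e z + W z); [exact: bmeasD|exact/funext].
have eW : \int[mu2]_(z in D) (e z * W z) = 0.
  rewrite (eq_int (g := fun z => \sum_(n <- s) (e z * c n z))); last first.
    by move=> z _; rewrite /W mulr_sumr; apply: eq_bigr => n _; rewrite mul1r.
  rewrite int_sum//; last by move=> n; exact: bmeasM.
  rewrite big_seq big1// => n ns; apply: (orthogonal _ e5 (ec n)).
  by apply/eqP => n5; have := s8 _ ns; rewrite -n5.
have b_ee : bmeas D (fun z => e z ^+ 2) by exact: (bmeasM b_e b_e).
have b_eW := bmeasM b_e bW; have b_WW : bmeas D (fun z => W z ^+ 2) by exact: (bmeasM bW bW).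
have ge : \int[mu2]_(z in D) (g z * e z) = a * \int[mu2]_(z in D) (e z ^+ 2).
  rewrite (eq_int (g := fun z => a * e z ^+ 2 + e z * W z)); last by move=> z _; rewrite gW; ring.
  rewrite intD ?eW ?addr0 ?intZ//.
  by apply: bmeasZ.
have lead : leading * \int[mu2]_(z in D) (g z * e z) = a * \int[mu2]_(z in D) e z.
  case: e_neq0 => [e0|e0].
    rewrite /leading ge e0; under eq_int do rewrite /cst.
    by rewrite Rintegral_cst// !(mul0r, mulr0).
  by rewrite /leading ge; field.
pose E n := expR (- (eigenvalue n * t)).
pose w z := \sum_(n <- s) E n * c n z.
have bw : bmeas D w by apply: bmeas_sum => n; exact: bbc.
have ug : \int[mu2]_(z in D) (u t z * g z) =
    E 5%N * (a * \int[mu2]_(z in D) e z) + \int[mu2]_(z in D) w z.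
  rewrite (eq_int (g := fun z => a * (u t z * e z) + \sum_(n <- s) u t z * c n z)); last first.
    move=> z _; rewrite gW mulrDr mulrCA; congr (_ + _).
    by rewrite /W mulr_sumr; apply: eq_bigr => n _; rewrite mul1r.
  have bue := bmeasM (b_u t0) b_e; have buc n := bmeasM (b_u t0) (bc n).
  rewrite intD//; [|by apply: bmeasZ|exact: bmeas_sum].
  rewrite intZ// (coef e5 t0) mulrCA; congr (_ + _).
  rewrite int_sum// /w int_sum//.
  by apply: eq_bigr => n _; rewrite (coef (ec n) t0) intZ.
rewrite lead ug addrC addKr.
have b_ww : bmeas D (fun z => w z ^+ 2) by exact: (bmeasM bw bw).
have E8 : 0 < E 8%N by exact: expR_gt0.
have g_le : \int[mu2]_(z in D) (g z ^+ 2) <= area.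
  have -> : area = \int[mu2]_(z in D) 1 by rewrite Rintegral_cst// mul1r.
  apply: le_int => //; [exact: (bmeasM bg bg)|exact: bmeas_cst|].
  by move=> z Dz; rewrite -(real_normK (num_real (g z))) exprn_ile1// g1.
have W_le : \int[mu2]_(z in D) (W z ^+ 2) <= area.
  apply: le_trans g_le.
  rewrite [leRHS](eq_int (g := fun z => a ^+ 2 * e z ^+ 2 + (2 * a * (e z * W z) + W z ^+ 2))); last first.
    by move=> z _; rewrite gW; ring.
  rewrite intD//; [|by apply: bmeasZ|].
    rewrite intZ// intD// ?intZ// ?eW ?mulr0 ?add0r//.
      rewrite lerDr mulr_ge0 ?sqr_ge0//; apply: Rintegral_ge0 => z _; exact: sqr_ge0.
    by apply: bmeasZ.
  by apply: bmeasD => //; apply: bmeasM => //; exact: bmeas_cst.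
have w_le : \int[mu2]_(z in D) (w z ^+ 2) <= E 8%N ^+ 2 * area.
  apply: (@le_trans _ _ (E 8%N ^+ 2 * \int[mu2]_(z in D) (W z ^+ 2))); last first.
    by rewrite ler_pM2l ?exprn_gt0.
  rewrite !int_sqr_sum// mulr_sumr big_seq [leRHS]big_seq; apply: ler_sum => n ns.
  rewrite expr1n mul1r ler_wpM2r//; first by apply: Rintegral_ge0 => z _; exact: sqr_ge0.
  rewrite ler_pXn2r ?nnegrE ?expR_ge0// /E ler_expR lerN2 ler_wpM2r ?(ltW t0)//.
  rewrite /eigenvalue ler_wpM2l ?ler_nat ?s8//.
  by rewrite divr_ge0// exprn_ge0// pi_ge0.
(* Cauchy-Schwarz in the form |w| <= w^2 / (2 E) + E / 2 with E = [E 8]: since the integral of w^2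
   is at most E^2 times the area, both halves give area * E / 2. *)
have b_r : bmeas D (fun z => (2 * E 8%N)^-1 * w z ^+ 2 + E 8%N / 2).
  by apply: bmeasD; [apply: bmeasM => //|]; exact: bmeas_cst.
rewrite (le_trans (norm_int mD fD bw))// (le_trans (le_int mD fD (bmeas_norm bw) b_r _))//.
  move=> z _; rewrite -[in X in _ <= X](real_normK (num_real (w z))) -subr_ge0.
  have -> : (2 * E 8%N)^-1 * `|w z| ^+ 2 + E 8%N / 2 - `|w z| =
      (2 * E 8%N)^-1 * (`|w z| - E 8%N) ^+ 2.
    by field; rewrite gt_eqF.
  by rewrite mulr_ge0 ?sqr_ge0// invr_ge0 mulr_ge0// ltW.
rewrite intD//; [|by apply: bmeasZ|exact: bmeas_cst].
rewrite Rintegral_cst// -/area (intZ mD fD _ b_ww).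
apply: (@le_trans _ _ ((2 * E 8%N)^-1 * (E 8%N ^+ 2 * area) + E 8%N / 2 * area)).
  by rewrite lerD2r ler_pM2l ?invr_gt0 ?mulr_gt0.
rewrite le_eqVlt -/(E 8%N); apply/orP; left; apply/eqP; field.
by rewrite gt_eqF.
Qed.

Variable h : nat -> R * R -> R.
Hypothesis h_spectral : forall k, spectral (h k).
Hypothesis h_le1 : forall k z, D z -> `|h k z| <= 1.
Hypothesis h_cvg : forall z, D z -> h k z @[k --> \oo] --> (1 : R).

(** In [spectral_bound] the approximation [h k] occurs only in two integrals, which converge by
    dominated convergence, while the right side does not depend on [k]. *)
Theorem heat_content_asymptotics t : 0 < t ->
  `|\int[mu2]_(z in D) u t z - expR (- (eigenvalue 5%N * t)) *
     ((\int[mu2]_(z in D) e z) ^+ 2 / \int[mu2]_(z in D) (e z ^+ 2))|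
  <= area * expR (- (eigenvalue 8%N * t)).
Proof.
move=> t0.
have bh k : bmeas D (h k).
  have [N [c [ec hE _]]] := h_spectral k.
  rewrite (_ : h k = fun z => \sum_(0 <= n < 8 + N) c n z); last exact/funext.
  by apply: bmeas_sum => n; exact: bmeas_eigen (ec n).
have lim v : bmeas D v ->
    \int[mu2]_(z in D) (v z * h k z) @[k --> \oo] --> \int[mu2]_(z in D) v z.
  move=> bv; have [mv [B hB]] := bv.
  apply: (@bounded_cvg_int _ D mD fD _ _ B) => //.
  - by move=> k; have [] := bmeasM bv (bh k).
  - move=> k z Dz; rewrite normrM (le_trans _ (hB _ Dz))//.
    by rewrite ler_piMr// h_le1.
  - move=> z Dz; rewrite -[X in _ --> X]mulr1; apply: cvgM; first exact: cvg_cst.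
    exact: h_cvg.
have L : `|\int[mu2]_(z in D) (u t z * h k z) - expR (- (eigenvalue 5%N * t)) *
    (leading * \int[mu2]_(z in D) (e z * h k z))| @[k --> \oo] -->
    `|\int[mu2]_(z in D) u t z - expR (- (eigenvalue 5%N * t)) * (leading * \int[mu2]_(z in D) e z)|.
  apply: cvg_norm; apply: cvgB; first exact: lim (b_u t0).
  apply: cvgM; first exact: cvg_cst.
  by apply: cvgM; [exact: cvg_cst|exact: lim].
have -> : (\int[mu2]_(z in D) e z) ^+ 2 / \int[mu2]_(z in D) (e z ^+ 2) =
    leading * \int[mu2]_(z in D) e z by rewrite /leading expr2 mulrAC.
rewrite -(cvg_lim _ L)//; apply: limr_le; first by apply/cvg_ex; eexists; exact: L.
apply: nearW => k.
have -> : \int[mu2]_(z in D) (e z * h k z) = \int[mu2]_(z in D) (h k z * e z).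
  by apply: eq_int => z _; rewrite mulrC.
by apply: spectral_bound => //; exact: h_le1.
Qed.

End SpectralAsymptotics.

(** * Sine polynomials *)

Section TrigPolynomials.
Variable R : realType.

(** In the unit pi / 2 all modes of the six polygons have integer frequencies. These are signed
    because triple products produce differences of frequencies. *)
Definition Sin (i : int) (x : R) : R := sin (i%:~R * (pi / 2) * x).
Definition Cos (i : int) (x : R) : R := cos (i%:~R * (pi / 2) * x).

Lemma is_derive_Sin i (x : R) :
  is_derive x 1 (Sin i) (i%:~R * (pi / 2) * Cos i x).
Proof. by rewrite /Sin; apply: is_derive_eq; rewrite /GRing.scale/= /Cos; ring. Qed.

Lemma is_derive_Cos i (x : R) :
  is_derive x 1 (Cos i) (- (i%:~R * (pi / 2)) * Sin i x).
Proof. by rewrite /Cos; apply: is_derive_eq; rewrite /GRing.scale/= /Sin; ring. Qed.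

Lemma continuous_Sin i : continuous (Sin i).
Proof. exact: continuous_derive1 (is_derive_Sin i). Qed.

Lemma continuous_Cos i : continuous (Cos i).
Proof. exact: continuous_derive1 (is_derive_Cos i). Qed.

Lemma sin_mul3 (a b c : R) : sin a * sin b * sin c =
  4^-1 * (sin (a + b - c) + sin (a - b + c) + sin (- a + b + c) - sin (a + b + c)).
Proof. by rewrite !(sinD, cosD, sinN, cosN); field. Qed.

Lemma Sin_mul3 (a b c : int) (x : R) : Sin a x * Sin b x * Sin c x =
  4^-1 * (Sin (a + b - c) x + Sin (a - b + c) x + Sin (- a + b + c) x - Sin (a + b + c) x).
Proof.
rewrite /Sin sin_mul3; congr (_ * (sin _ + sin _ + sin _ - sin _));
  by rewrite !(intrD, intrN) !(mulrDl, mulNr).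
Qed.

Definition par (i : int) : bool := (i %% 2)%Z == 1.

Lemma parD i j : par (i + j) = par i (+) par j. Proof. rewrite /par; lia. Qed.

Lemma parN i : par (- i) = par i. Proof. rewrite /par; lia. Qed.

(** [Q] is the set of parity pairs that the boundary conditions allow. A product of three sines has
    frequencies +-a +-b +-c, whose parity is the sum of the three parities, hence the closure
    condition. *)
Variable Q : bool -> bool -> bool.
Hypothesis Qclosed : forall a b c d e f, Q a d -> Q b e -> Q c f ->
  Q (a (+) b (+) c) (d (+) e (+) f).

Definition index (i j : int) := Q (par i) (par j).

Definition sinpoly (F : R -> R -> R) := exists2 L : seq (R * (int * int)),
  {in L, forall m, index m.2.1 m.2.2} &
  forall X Y, F X Y = \sum_(m <- L) m.1 * (Sin m.2.1 X * Sin m.2.2 Y).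

Lemma sinpoly_mono (c : R) i j : index i j -> sinpoly (fun X Y => c * (Sin i X * Sin j Y)).
Proof.
move=> ij; exists [:: (c, (i, j))]; first by move=> m; rewrite inE => /eqP ->.
by move=> X Y; rewrite big_seq1.
Qed.

Lemma sinpoly_ext F G : (forall X Y, F X Y = G X Y) -> sinpoly F -> sinpoly G.
Proof. by move=> FG [L IL FL]; exists L => // X Y; rewrite -FG. Qed.

Lemma sinpolyD F G : sinpoly F -> sinpoly G -> sinpoly (fun X Y => F X Y + G X Y).
Proof.
move=> [L IL FL] [K IK FK]; exists (L ++ K).
  by move=> m; rewrite mem_cat => /orP[/IL|/IK].
by move=> X Y; rewrite big_cat FL FK.
Qed.

Lemma sinpolyZ (c : R) F : sinpoly F -> sinpoly (fun X Y => c * F X Y).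
Proof.
move=> [L IL FL]; exists [seq (c * m.1, m.2) | m <- L].
  by move=> _ /mapP[m mL ->]; exact: (IL m mL).
by move=> X Y; rewrite big_map FL mulr_sumr; apply: eq_bigr => m _; rewrite mulrA.
Qed.

Lemma sinpoly_sum (T : eqType) (L : seq T) (F : T -> R -> R -> R) :
  (forall m, m \in L -> sinpoly (F m)) -> sinpoly (fun X Y => \sum_(m <- L) F m X Y).
Proof.
elim: L => [_|x L ih h].
  by exists [::] => // X Y; rewrite !big_nil.
apply: (@sinpoly_ext (fun X Y => F x X Y + \sum_(m <- L) F m X Y)).
  by move=> X Y; rewrite big_cons.
apply: sinpolyD; first by apply: h; rewrite mem_head.
by apply: ih => m mL; apply: h; rewrite in_cons mL orbT.
Qed.

Let signs (a b c : int) : seq (R * int) :=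
  [:: (1, a + b - c); (1, a - b + c); (1, - a + b + c); (-1, a + b + c)].

Lemma sinpoly_mul3 F G H : sinpoly F -> sinpoly G -> sinpoly H ->
  sinpoly (fun X Y => F X Y * G X Y * H X Y).
Proof.
move=> [L IL FL] [K IK GK] [J IJ HJ].
apply: (@sinpoly_ext (fun X Y => \sum_(l <- L) \sum_(k <- K) \sum_(j <- J)
    \sum_(p <- signs l.2.1 k.2.1 j.2.1) \sum_(q <- signs l.2.2 k.2.2 j.2.2)
    (l.1 * k.1 * j.1 / 16 * p.1 * q.1) * (Sin p.2 X * Sin q.2 Y))).
  move=> X Y; rewrite FL GK HJ !mulr_suml; apply: eq_bigr => l _.
  rewrite -mulrA big_distrlr mulr_sumr /=.
  apply: eq_bigr => k _; rewrite mulr_sumr; apply: eq_bigr => j _.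
  rewrite !big_cons !big_nil !addr0 /=.
  have h1 := Sin_mul3 l.2.1 k.2.1 j.2.1 X; have h2 := Sin_mul3 l.2.2 k.2.2 j.2.2 Y.
  transitivity (l.1 * k.1 * j.1 * (Sin l.2.1 X * Sin k.2.1 X * Sin j.2.1 X)
    * (Sin l.2.2 Y * Sin k.2.2 Y * Sin j.2.2 Y)); last by ring.
  by rewrite h1 h2; field.
apply: sinpoly_sum => l /IL Il; apply: sinpoly_sum => k /IK Ik; apply: sinpoly_sum => j /IJ Ij.
have sgn a b c p : p \in signs a b c -> par p.2 = par a (+) par b (+) par c.
  rewrite !inE => /or4P[] /eqP -> /=; by rewrite !(parD, parN).
apply: sinpoly_sum => p /sgn hp; apply: sinpoly_sum => q /sgn hq.
by apply: sinpoly_mono; rewrite /index hp hq; exact: Qclosed.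
Qed.

Variable sg : R.

(* [sg = 0] gives the modes of a rectangle, [sg = 1] and [sg = -1] the modes that are
   antisymmetric, respectively symmetric, across the diagonal [X = Y]. *)
Definition basis (i j : int) (X Y : R) := Sin i X * Sin j Y - sg * (Sin i Y * Sin j X).

(** The symmetry of [F] turns [(1 + sg ^+ 2) * F X Y] into [F X Y - sg * F Y X], in which each
    monomial becomes a basis function. For [sg = 0] the symmetry is void and nothing changes. *)
Lemma sinpoly_basis F : 1 + sg ^+ 2 != 0 -> sinpoly F ->
  (forall X Y, sg * F Y X = - sg ^+ 2 * F X Y) ->
  exists2 L : seq (R * (int * int)), {in L, forall m, index m.2.1 m.2.2} &
    forall X Y, F X Y = \sum_(m <- L) m.1 * basis m.2.1 m.2.2 X Y.
Proof.
move=> s0 [L IL FL] sF; exists [seq (m.1 / (1 + sg ^+ 2), m.2) | m <- L].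
  by move=> _ /mapP[m mL ->]; exact: (IL m mL).
move=> X Y; apply: (mulfI s0); rewrite big_map mulr_sumr.
have -> : (1 + sg ^+ 2) * F X Y = F X Y - sg * F Y X by rewrite sF; ring.
rewrite FL [F Y X]FL mulr_sumr -sumrB; apply: eq_bigr => m _ /=.
by rewrite /basis; field.
Qed.

(* Newton's iteration for the sign function. It is odd, so it preserves sine polynomials. *)
Definition newton (F : R -> R -> R) (X Y : R) := F X Y * (3 - F X Y ^+ 2) / 2.

Lemma sinpoly_newton F : sinpoly F -> sinpoly (newton F).
Proof.
move=> sF; apply: (@sinpoly_ext (fun X Y => 3 / 2 * F X Y + (- 2^-1) * (F X Y * F X Y * F X Y))).
  by move=> X Y; rewrite /newton; field.
by apply: sinpolyD; apply: sinpolyZ => //; exact: sinpoly_mul3.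
Qed.

Lemma newton_sym F : sg = 0 \/ sg = 1 \/ sg = -1 ->
  (forall X Y, sg * F Y X = - sg ^+ 2 * F X Y) ->
  forall X Y, sg * newton F Y X = - sg ^+ 2 * newton F X Y.
Proof.
move=> s01 sF X Y; have := sF X Y; rewrite /newton; case: s01 => [->|[->|->]].
- by rewrite !expr0n/= oppr0 !mul0r.
- by rewrite !mul1r !expr1n !mulN1r => ->; ring.
- by rewrite sqrrN !expr1n !mulN1r => /oppr_inj ->; ring.
Qed.

(** The distance to 1 is multiplied at each step by (1 - s) (2 + s) / 2 = 1 - s / 2 - s^2 / 2, and
    the sequence increases, so the factor never exceeds [1 - s 0 / 2]. *)
Lemma newton_bound (s : nat -> R) : 0 < s 0%N <= 1 ->
  (forall k, s k.+1 = s k * (3 - s k ^+ 2) / 2) ->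
  forall k, s 0%N <= s k <= 1 /\ 1 - s k <= (1 - s 0%N / 2) ^+ k.
Proof.
move=> /andP[s0 s1] sS; elim=> [|k [/andP[a b] ih]].
  by rewrite expr0 lexx s1; split => //; lra.
have E1 : s k.+1 - s k = s k * ((1 - s k) * (1 + s k)) / 2 by rewrite sS; field.
have E2 : 1 - s k.+1 = (1 - s k) * ((1 - s k) * (2 + s k) / 2) by rewrite sS; field.
have k0 : 0 < s k by exact: lt_le_trans a.
have h1 : 0 <= 1 - s k by lra.
have h2 : 0 <= s k.+1 - s k by rewrite E1 divr_ge0// mulr_ge0 ?(ltW k0)// mulr_ge0//; lra.
have h3 : 0 <= (1 - s k) * (2 + s k) / 2 by rewrite divr_ge0// mulr_ge0//; lra.
have h4 : (1 - s k) * (2 + s k) / 2 <= 1 - s 0%N / 2.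
  have : 0 <= s k ^+ 2 by exact: sqr_ge0.
  have -> : (1 - s k) * (2 + s k) / 2 = 1 - s k / 2 - s k ^+ 2 / 2 by field.
  by move=> ?; lra.
have h5 : 0 <= 1 - s k.+1 by rewrite E2 mulr_ge0.
split; first by apply/andP; split; lra.
by rewrite E2 exprSr ler_pM.
Qed.

Lemma newton_cvg (s : nat -> R) : 0 < s 0%N <= 1 ->
  (forall k, s k.+1 = s k * (3 - s k ^+ 2) / 2) -> s @ \oo --> (1 : R).
Proof.
move=> s01 sS; have B := newton_bound s01 sS.
have /andP[s0 s1] := s01.
have g : (fun k => (1 - s 0%N / 2) ^+ k) @ \oo --> (0 : R).
  by apply: cvg_expr; rewrite ger0_norm; lra.
apply/cvgrPdist_le => eps eps0; move/cvgrPdist_le: g => /(_ _ eps0).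
apply: filterS => k; rewrite sub0r normrN => h.
have [/andP[_ b] c] := B k.
by rewrite ger0_norm ?subr_ge0// (le_trans c)// (le_trans (ler_norm _)).
Qed.

End TrigPolynomials.

(** * Sine modes placed in the plane *)

Section PlaneBasis.
Variables (R : realType) (sg t0 t1 : R).

(* [Y = t0 + t1 * y] moves the edges on the axis and the diagonal to those of the polygon. *)
Definition bas i j (z : R * R) := basis sg i j z.1 (t0 + t1 * z.2).
Definition bas1 (i j : int) (z : R * R) := let Y := t0 + t1 * z.2 in
  i%:~R * (pi / 2) * (Cos i z.1 * Sin j Y) - sg * (j%:~R * (pi / 2) * (Sin i Y * Cos j z.1)).
Definition bas2 (i j : int) (z : R * R) := let Y := t0 + t1 * z.2 in
  t1 * (j%:~R * (pi / 2) * (Sin i z.1 * Cos j Y) - sg * (i%:~R * (pi / 2) * (Cos i Y * Sin j z.1))).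
Definition bas11 (i j : int) (z : R * R) := let Y := t0 + t1 * z.2 in
  - (i%:~R * (pi / 2)) ^+ 2 * (Sin i z.1 * Sin j Y)
  + sg * ((j%:~R * (pi / 2)) ^+ 2 * (Sin i Y * Sin j z.1)).
Definition bas22 (i j : int) (z : R * R) := let Y := t0 + t1 * z.2 in
  t1 ^+ 2 * (- (j%:~R * (pi / 2)) ^+ 2 * (Sin i z.1 * Sin j Y)
  + sg * ((i%:~R * (pi / 2)) ^+ 2 * (Sin i Y * Sin j z.1))).

Definition freq (i j : int) : nat := (absz i ^ 2 + absz j ^ 2)%N.

Lemma freqE i j : (freq i j)%:R = i%:~R ^+ 2 + j%:~R ^+ 2 :> R.
Proof.
have sq (k : int) : (absz k ^ 2)%:R = k%:~R ^+ 2 :> R.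
  rewrite natrX natr_absz intr_norm real_normK//; exact: num_real.
by rewrite /freq natrD !sq.
Qed.

Lemma C2_bas i j : C2_data setT (bas i j) (bas1 i j) (bas2 i j) (bas11 i j) (bas22 i j).
Proof.
have dS k (x : R) := is_derive_Sin k x; have dC k (x : R) := is_derive_Cos k x.
have dY (y : R) : is_derive y 1 (fun s => t0 + t1 * s) t1.
  by apply: is_derive_eq; rewrite /GRing.scale/=; ring.
have dSY k (y : R) : is_derive y 1 (fun s => Sin k (t0 + t1 * s))
    (k%:~R * (pi / 2) * Cos k (t0 + t1 * y) * t1).
  by have := @is_derive1_comp _ (Sin k) (fun s => t0 + t1 * s) y _ _ (dS k _) (dY y).
have dCY k (y : R) : is_derive y 1 (fun s => Cos k (t0 + t1 * s))
    (- (k%:~R * (pi / 2)) * Sin k (t0 + t1 * y) * t1).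
  by have := @is_derive1_comp _ (Cos k) (fun s => t0 + t1 * s) y _ _ (dC k _) (dY y).
have cX z : {for z, continuous (fun z : R * R => z.1)} by exact: cvg_fst.
have cY z : {for z, continuous (fun z : R * R => t0 + t1 * z.2)}.
  by apply: contD; [exact: cont_cst|apply: contM; [exact: cont_cst|exact: cvg_snd]].
have cSX k z : {for z, continuous (fun z : R * R => Sin k z.1)}.
  by apply: cont_comp; [exact: continuous_Sin|exact: cX].
have cCX k z : {for z, continuous (fun z : R * R => Cos k z.1)}.
  by apply: cont_comp; [exact: continuous_Cos|exact: cX].
have cSY k z : {for z, continuous (fun z : R * R => Sin k (t0 + t1 * z.2))}.
  by apply: cont_comp; [exact: continuous_Sin|exact: cY].
have cCY k z : {for z, continuous (fun z : R * R => Cos k (t0 + t1 * z.2))}.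
  by apply: cont_comp; [exact: continuous_Cos|exact: cY].
split => [x y _|x y _|x y _|x y _|z _|z _|z _|z _|z _].
- have ? := dS i x; have ? := dS j x.
  by rewrite /bas /basis /bas1/=; apply: is_derive_eq; rewrite /GRing.scale/=; ring.
- have ? := dSY i y; have ? := dSY j y.
  by rewrite /bas /basis /bas2/=; apply: is_derive_eq; rewrite /GRing.scale/=; ring.
- have ? := dC i x; have ? := dC j x.
  by rewrite /bas1 /bas11/=; apply: is_derive_eq; rewrite /GRing.scale/=; ring.
- have ? := dCY i y; have ? := dCY j y.
  by rewrite /bas2 /bas22/=; apply: is_derive_eq; rewrite /GRing.scale/=; ring.
- by apply: contB; [|apply: contM; [exact: cont_cst|]]; apply: contM.
- apply: contB; first by apply: contM; [exact: cont_cst|exact: contM].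
  by apply: contM; [exact: cont_cst|apply: contM; [exact: cont_cst|exact: contM]].
- apply: contM; first exact: cont_cst.
  apply: contB; first by apply: contM; [exact: cont_cst|exact: contM].
  by apply: contM; [exact: cont_cst|apply: contM; [exact: cont_cst|exact: contM]].
- apply: contD; first by apply: contM; [exact: cont_cst|exact: contM].
  by apply: contM; [exact: cont_cst|apply: contM; [exact: cont_cst|exact: contM]].
- apply: contM; first exact: cont_cst.
  apply: contD; first by apply: contM; [exact: cont_cst|exact: contM].
  by apply: contM; [exact: cont_cst|apply: contM; [exact: cont_cst|exact: contM]].
Qed.

Lemma lap_bas i j z : t1 ^+ 2 = 1 ->
  bas11 i j z + bas22 i j z = - eigenvalue R (freq i j) * bas i j z.
Proof.
by move=> t11; rewrite /bas11 /bas22 /bas /basis t11 /eigenvalue freqE /=; field.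
Qed.

End PlaneBasis.

(** * Spectral approximation of 1 by Newton's iteration *)

Section TrigAsymptotics.
Variables (R : realType) (P : polygon R) (M al be ga sg t0 t1 ka : R) (i0 j0 : int).
Variable Q : bool -> bool -> bool.
Let D := region P.
Variable phi1 : R * R -> R.
Hypothesis phi1E : forall z, phi1 z = ka * bas sg t0 t1 i0 j0 z.
Hypotheses (oD : open D) (M0 : 0 < M) (DM : D `<=` obox M) (be0 : be != 0).
Let l := affine al be ga.
Hypothesis hl : forall z, D z -> 0 < l z.
Hypothesis hin : forall z, closure D z -> 0 < phi1 z -> 0 < l z -> D z.
Hypothesis dirichlet_edges : forall z, closure D z -> phi1 z <= 0 ->
  exists i, [/\ (i < size P)%N, label P i = Dirichlet & edge P i z].
Hypothesis neumann_edges : forall z, closure D z -> 0 < phi1 z -> l z = 0 ->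
  exists i k, [/\ (i < size P)%N, label P i = Neumann, open_edge P i z &
    al = k * (outward_normal P i).1 /\ be = k * (outward_normal P i).2].
Hypothesis t11 : t1 ^+ 2 = 1.
Hypothesis sg01 : sg = 0 \/ sg = 1 \/ sg = -1.
Hypothesis Qclosed : forall a b c d e f, Q a d -> Q b e -> Q c f ->
  Q (a (+) b (+) c) (d (+) e (+) f).
Hypothesis I00 : index Q i0 j0.
Hypothesis I00' : sg = 0 \/ index Q j0 i0.
Hypothesis phi1_01 : forall z, D z -> 0 < phi1 z <= 1.
Hypothesis basis_N : forall i j, index Q i j -> forall z, closure D z -> l z = 0 ->
  al * bas1 sg t0 t1 i j z + be * bas2 sg t0 t1 i j z = 0.
Hypothesis basis_le : forall i j, index Q i j -> exists C : R, forall z,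
  closure D z -> `|bas sg t0 t1 i j z| <= C * phi1 z.
Variable e : R * R -> R.
Hypothesis basis_small : forall i j, index Q i j -> (freq i j < 8)%N ->
  exists a, forall z, bas sg t0 t1 i j z = if freq i j == 5%N then a * e z else 0.
(** In four of the polygons the ground state has frequency 1 + 4 = 5 and is [e] itself; in the two
    small triangles its frequency is 4 + 4 = 8 or 9 + 1 = 10, and [e] is zero. *)
Hypothesis e_phi1 : e = cst 0 \/
  [/\ e = phi1, freq i0 j0 = 5%N & \int[mu2]_(z in D) (e z ^+ 2) != 0].

Notation mode := (eigenfun P al be ga phi1).

Lemma eigenfun_bas i j : index Q i j -> mode (freq i j) (bas sg t0 t1 i j).
Proof.
move=> ij; exists (bas1 sg t0 t1 i j), (bas2 sg t0 t1 i j).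
exists (bas11 sg t0 t1 i j), (bas22 sg t0 t1 i j); split; last by move=> z; exact: lap_bas.
by split; [exact: C2_bas|move=> z Kz _; exact: basis_N|exact: basis_le].
Qed.

Lemma eigenfun_0 n : mode n (cst 0).
Proof.
exists (cst 0), (cst 0), (cst 0), (cst 0); split; last by move=> z; rewrite addr0 mulr0.
split; first exact: C2_const.
  by move=> z _ _ _; rewrite !mulr0 addr0.
by exists 0 => z _; rewrite normr0 mul0r.
Qed.

Let phi1_scale : phi1 = fun z => cst 0 z + ka * bas sg t0 t1 i0 j0 z.
Proof. by apply/funext => z; rewrite phi1E add0r. Qed.

Let C_phi1 := C2_lin ka (C2_const setT 0) (C2_bas sg t0 t1 i0 j0).

Lemma eigenfun_leading : mode 5%N e.
Proof.
case: e_phi1 => [->|[-> <- _]]; first exact: eigenfun_0.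
by rewrite [X in eigenfun _ _ _ _ _ _ X]phi1_scale; apply: eigenfun_lin; [exact: eigenfun_0|exact: eigenfun_bas].
Qed.

Let F0 X Y := ka * basis sg i0 j0 X Y.
Let hX (k : nat) : R -> R -> R := iter k (@newton R) F0.
Let h k (z : R * R) := hX k z.1 (t0 + t1 * z.2).

Lemma sinpoly_newton_iter k : sinpoly Q (hX k).
Proof.
elim: k => [|k ih]; last exact: sinpoly_newton ih.
apply: sinpolyZ; case: I00' => [s0|I10].
  apply: (@sinpoly_ext _ _ (fun X Y => 1 * (Sin i0 X * Sin j0 Y))); last exact: sinpoly_mono.
  by move=> X Y; rewrite /basis s0; ring.
apply: (@sinpoly_ext _ _ (fun X Y => 1 * (Sin i0 X * Sin j0 Y) + (- sg) * (Sin j0 X * Sin i0 Y))).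
  by move=> X Y; rewrite /basis; ring.
by apply: sinpolyD; exact: sinpoly_mono.
Qed.

Lemma newton_iter_sym k X Y : sg * hX k Y X = - sg ^+ 2 * hX k X Y.
Proof.
elim: k X Y => [X Y|k ih X Y]; last exact: newton_sym.
rewrite /hX /F0 /= /basis; case: sg01 => [->|[->|->]]; ring.
Qed.

(** The iterate is a finite combination of basis functions; collecting those of equal frequency
    gives its spectral components, and [basis_small] identifies the ones below 8. *)
Lemma newton_iter_spectral k : spectral P al be ga phi1 e (h k).
Proof.
have s2 : 1 + sg ^+ 2 != 0 by rewrite gt_eqF// ltr_pwDl// sqr_ge0.
have [L IL hE] := sinpoly_basis s2 (sinpoly_newton_iter k) (@newton_iter_sym k).
pose c n z := \sum_(m <- L | freq m.2.1 m.2.2 == n) m.1 * bas sg t0 t1 m.2.1 m.2.2 z.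
(* One more than the largest frequency, so that the half-open range up to [8 + N] contains them
   all. *)
pose N := (\max_(m <- L) freq m.2.1 m.2.2).+1.
exists N, c; split.
- move=> n; rewrite /c; elim: L IL {hE c N} => [_|m L ih IL].
    rewrite (_ : (fun z => _) = cst 0); first exact: eigenfun_0.
    by apply/funext => z; rewrite big_nil.
  have {}ih := ih (fun m' hm' => IL m' (@mem_behead _ (m :: L) m' hm')).
  case: (eqVneq (freq m.2.1 m.2.2) n) => [mn|mn]; last first.
    by move: ih; congr (mode n _); apply/funext => z; rewrite big_cons (negbTE mn).
  rewrite (_ : (fun z => _) = (fun z =>
      (\sum_(m <- L | freq m.2.1 m.2.2 == n) m.1 * bas sg t0 t1 m.2.1 m.2.2 z)
      + m.1 * bas sg t0 t1 m.2.1 m.2.2 z)).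
    apply: eigenfun_lin => //; rewrite -mn; apply: eigenfun_bas.
    by apply: IL; exact: mem_head.
  by apply/funext => z; rewrite big_cons mn eqxx addrC.
- move=> z; rewrite /h hE /c (exchange_big_dep predT)//= [LHS]big_seq [RHS]big_seq.
  apply: eq_bigr => m mL; rewrite (eq_bigl (fun n => n == freq m.2.1 m.2.2)); last first.
    by move=> n; rewrite eq_sym.
  rewrite big_nat1_eq ifT//= ltn_addl// /N ltnS.
  by rewrite (big_rem m mL)/= leq_maxl.
- move=> n n8; rewrite /c; elim: L IL {hE c N} => [_|m L ih IL].
    by exists 0 => z; rewrite big_nil mul0r if_same.
  have [a ha] := ih (fun m' hm' => IL m' (@mem_behead _ (m :: L) m' hm')).
  have [mn|mn] := eqVneq (freq m.2.1 m.2.2) n; last first.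
    by exists a => z; rewrite big_cons (negbTE mn) ha.
  have [b hb] := basis_small (IL m (mem_head _ _)) (eq_ind_r (fun n => n < 8)%N n8 mn).
  exists (m.1 * b + a) => z; rewrite big_cons mn eqxx ha hb mn.
  by case: ifP => _; ring.
Qed.

Variable u : R -> R * R -> R.
Hypothesis heat : mixed_heat_equation P u.
Hypothesis initial :
  (\int[area_measure R]_(x in D) ((u t x - 1) ^+ 2)%:E)%E @[t --> 0^'+] --> 0%E.

Theorem trig_asymptotics t : 0 < t ->
  `|\int[mu2]_(z in D) u t z - expR (- (eigenvalue R 5%N * t)) *
     ((\int[mu2]_(z in D) e z) ^+ 2 / \int[mu2]_(z in D) (e z ^+ 2))|
  <= fine (mu2 D) * expR (- (eigenvalue R 8%N * t)).
Proof.
have hS z k : h k.+1 z = h k z * (3 - h k z ^+ 2) / 2 by [].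
have h0 z : D z -> 0 < h 0 z <= 1 by rewrite -[h 0 z]phi1E; exact: phi1_01.
have phi1_gt0 z : D z -> 0 < phi1 z by move=> /phi1_01/andP[].
move: C_phi1; rewrite -phi1_scale => Cp.
apply: (@heat_content_asymptotics R P M al be ga phi1 _ _ _ _ oD M0 DM be0 hl hin
  phi1_gt0 Cp _ dirichlet_edges neumann_edges e eigenfun_leading _ u heat initial h).
- move=> z Kz _ lz; rewrite /= !add0r !(mulrCA _ ka) -mulrDr.
  by rewrite basis_N// mulr0.
- by case: e_phi1 => [->|[_ _ ?]]; [left|right].
- exact: newton_iter_spectral.
- move=> k z Dz; have [/andP[a b] _] := newton_bound (h0 z Dz) (hS z) k.
  have /andP[c _] := h0 z Dz.
  by rewrite ger0_norm// (le_trans _ a)// ltW.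
- by move=> z Dz; exact: newton_cvg (h0 z Dz) (hS z).
Qed.

End TrigAsymptotics.

Section ConvexRegions.
Variable R : realType.

Lemma open_affine_gt0 (D : set (R * R)) (cs : seq (R * R * R)) :
  (forall z, D z <-> {in cs, forall c, 0 < affine c.1.1 c.1.2 c.2 z}) -> open D.
Proof.
move=> DE; rewrite openE => z /DE h.
suff : \forall y \near z, {in cs, forall c, 0 < affine c.1.1 c.1.2 c.2 y}.
  by apply: filterS => y /DE.
elim: cs {DE} h => [_|c cs ih h]; first by apply: filterE => y c; rewrite in_nil.
have {}ih := ih (fun c' hc' => h c' (@mem_behead _ (c :: cs) c' hc')).
have hc := near_gt (@cont_affine R c.1.1 c.1.2 c.2 z) (h c (mem_head _ _)).
by apply: filterS2 ih hc => y h1 h2 c'; rewrite in_cons => /predU1P[->//|/h1].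
Qed.

Lemma closure_affine (D : set (R * R)) (cs : seq (R * R * R)) :
  (forall z, D z <-> {in cs, forall c, 0 < affine c.1.1 c.1.2 c.2 z}) ->
  forall z, closure D z -> {in cs, forall c, 0 <= affine c.1.1 c.1.2 c.2 z}.
Proof.
move=> DE z Kz c hc; rewrite leNgt; apply/negP => lz.
have [y [/DE/(_ _ hc) ly]] := Kz _ (near_lt (@cont_affine _ c.1.1 c.1.2 c.2 z) lz).
by move=> ly'; have := lt_trans ly ly'; rewrite ltxx.
Qed.

End ConvexRegions.

(** * Quotients of sines as functions of the cosine *)

Section ChebyshevBounds.
Variable R : realType.

(** Stands for a polynomial on [-1, 1]: a sup bound and a Lipschitz bound there, both of which pass
    through the Chebyshev recurrence. *)
Definition lipschitz1 (U : R -> R) := exists2 L : R, 0 <= L &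
  forall a b, `|a| <= 1 -> `|b| <= 1 -> `|U a| <= L /\ `|U a - U b| <= L * `|a - b|.

Lemma lipschitz1_cst (c : R) : lipschitz1 (cst c).
Proof.
by exists `|c| => // a b _ _; rewrite /cst subrr normr0 mulr_ge0.
Qed.

Lemma lipschitz1N U : lipschitz1 U -> lipschitz1 (fun c => - U c).
Proof.
move=> [L L0 hL]; exists L => // a b ha hb; have [h1 h2] := hL a b ha hb.
by rewrite -opprD !normrN.
Qed.

Lemma lipschitz1_rec U V : lipschitz1 U -> lipschitz1 V ->
  lipschitz1 (fun c => 2 * c * V c - U c).
Proof.
move=> [L L0 hL] [M M0 hM]; exists (4 * M + L); first by rewrite addr_ge0// mulr_ge0.
move=> a b ha hb; have [u1 u2] := hL a b ha hb; have [v1 v2] := hM a b ha hb.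
have [v3 _] := hM b a hb ha.
split.
  rewrite (le_trans (ler_normB _ _))// lerD//.
  rewrite !normrM ger0_norm// -mulrA.
  have : `|a| * `|V a| <= 1 * M by rewrite ler_pM.
  by lra.
have -> : 2 * a * V a - U a - (2 * b * V b - U b) =
    2 * a * (V a - V b) + 2 * (a - b) * V b - (U a - U b) by ring.
rewrite (le_trans (ler_normB _ _))// [leRHS]mulrDl lerD//.
rewrite (le_trans (ler_normD _ _))// !normrM ger0_norm//.
have h1 : `|a| * `|V a - V b| <= 1 * (M * `|a - b|) by rewrite ler_pM.
have h2 : `|a - b| * `|V b| <= `|a - b| * M by rewrite ler_wpM2l.
by rewrite -!mulrA; lra.
Qed.

(** [U] is the Chebyshev polynomial of the second kind, obtained from sin ((n+2) x) = 2 cos x sin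
    ((n+1) x) - sin (n x) and extended to negative [i] by oddness. *)
Lemma chebyshev_sin (i : int) : exists2 U, lipschitz1 U &
  forall x : R, sin (i%:~R * x) = sin x * U (cos x).
Proof.
have nat_case (n : nat) : exists2 U, lipschitz1 U &
    forall x : R, sin (n%:R * x) = sin x * U (cos x).
  suff [] : (exists2 U, lipschitz1 U & forall x : R, sin (n%:R * x) = sin x * U (cos x)) /\
    (exists2 U, lipschitz1 U & forall x : R, sin (n.+1%:R * x) = sin x * U (cos x)) by [].
  elim: n => [|n [[U hU UE] [V hV VE]]].
    split; first by exists (cst 0); [exact: lipschitz1_cst|move=> x; rewrite mul0r sin0 mulr0].
    by exists (cst 1); [exact: lipschitz1_cst|move=> x; rewrite mul1r mulr1].
  split; first by exists V.
  exists (fun c => 2 * c * V c - U c); first exact: lipschitz1_rec.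
  move=> x; have -> : sin x * (2 * cos x * V (cos x) - U (cos x)) =
      2 * cos x * (sin x * V (cos x)) - sin x * U (cos x) by ring.
  rewrite -VE -UE.
  have -> : n.+2%:R * x = n.+1%:R * x + x by rewrite -[n.+2%:R]natr1; ring.
  have -> : n%:R * x = n.+1%:R * x - x by rewrite -[n.+1%:R]natr1; ring.
  by rewrite sinD sinB; ring.
case: i => n; first exact: nat_case.
have [U hU UE] := nat_case n.+1; exists (fun c => - U c); first exact: lipschitz1N.
by move=> x; rewrite NegzE intrN mulNr sinN UE mulrN.
Qed.

(** For odd frequencies the quotient by sin x is the Dirichlet kernel, a polynomial in cos (2 x);
    the same recurrence applies with steps of 2 in the frequency. *)
Lemma chebyshev_sin_odd (i : int) : par i -> exists2 U, lipschitz1 U &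
  forall x : R, sin (i%:~R * x) = sin x * U (cos (2 * x)).
Proof.
have nat_case (n : nat) : exists2 U, lipschitz1 U &
    forall x : R, sin ((2 * n%:R + 1) * x) = sin x * U (cos (2 * x)).
  suff [] : (exists2 U, lipschitz1 U & forall x : R, sin ((2 * n%:R + 1) * x) = sin x * U (cos (2 * x))) /\
    (exists2 U, lipschitz1 U & forall x : R, sin ((2 * n.+1%:R + 1) * x) = sin x * U (cos (2 * x))) by [].
  elim: n => [|n [[U hU UE] [V hV VE]]].
    split; first by exists (cst 1); [exact: lipschitz1_cst|move=> x; rewrite mulr0 add0r mul1r mulr1].
    (* The recurrence started one step earlier: sin (- x) / sin x = -1 is the term before sin x /
       sin x = 1, which yields 2 c + 1 for sin (3 x). *)
    exists (fun c => 2 * c * cst 1 c - cst (-1) c).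
      by apply: lipschitz1_rec; exact: lipschitz1_cst.
    move=> x; have -> : (2 * 1%:R + 1) * x = x + x + x by ring.
    have -> : 2 * x = x + x by ring.
    rewrite /cst !(sinD, cosD); have := cos2sin2 x; rewrite !expr2 => E.
    apply/eqP; rewrite -subr_eq0; apply/eqP.
    transitivity (sin x * (cos x * cos x - (1 - sin x * sin x))); first by ring.
    by rewrite E subrr mulr0.
  split; first by exists V.
  exists (fun c => 2 * c * V c - U c); first exact: lipschitz1_rec.
  move=> x; have -> : sin x * (2 * cos (2 * x) * V (cos (2 * x)) - U (cos (2 * x))) =
      2 * cos (2 * x) * (sin x * V (cos (2 * x))) - sin x * U (cos (2 * x)) by ring.
  rewrite -VE -UE.
  have -> : (2 * n.+2%:R + 1) * x = (2 * n.+1%:R + 1) * x + 2 * x by rewrite -[n.+2%:R]natr1; ring.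
  have -> : (2 * n%:R + 1) * x = (2 * n.+1%:R + 1) * x - 2 * x by rewrite -[n.+1%:R]natr1; ring.
  by rewrite sinD sinB; ring.
have odd_nat (n : nat) : odd n -> n%:R = 2 * (n./2)%:R + 1 :> R.
  by move=> on; rewrite -[in LHS](odd_double_half n) on natrD addrC -muln2 natrM mulrC.
case: i => n pn.
  have on : odd n by move: pn; rewrite /par; lia.
  by have [U hU UE] := nat_case n./2; exists U => // x; rewrite -pmulrn (odd_nat _ on) UE.
have on : odd n.+1 by move: pn; rewrite /par; lia.
have [U hU UE] := nat_case (n.+1)./2; exists (fun c => - U c); first exact: lipschitz1N.
by move=> x; rewrite NegzE intrN mulNr sinN mulrN -pmulrn (odd_nat _ on) UE.
Qed.

(** The expression vanishes for [a = b], so Lipschitz functions make it of order [a - b]. *)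
Lemma antisymmetric_bound (U V : R -> R) : lipschitz1 U -> lipschitz1 V ->
  exists2 C : R, 0 <= C & forall a b, `|a| <= 1 -> `|b| <= 1 ->
    `|U a * V b - U b * V a| <= C * `|a - b|.
Proof.
move=> [L L0 hL] [M M0 hM]; exists (2 * L * M); first by rewrite !mulr_ge0.
move=> a b ha hb; have [u1 u2] := hL a b ha hb; have [v1 v2] := hM a b ha hb.
have [u3 _] := hL b a hb ha; have [v3 _] := hM b a hb ha.
have -> : U a * V b - U b * V a = (U a - U b) * V b - (V a - V b) * U b by ring.
rewrite (le_trans (ler_normB _ _))// !normrM.
have h1 : `|U a - U b| * `|V b| <= L * `|a - b| * M by rewrite ler_pM.
have h2 : `|V a - V b| * `|U b| <= M * `|a - b| * L by rewrite ler_pM.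
by rewrite (le_trans (lerD h1 h2))// le_eqVlt; apply/orP; left; apply/eqP; ring.
Qed.

End ChebyshevBounds.

(** * Reflections, signs and mutual bounds of the sine modes *)

Section SinCos.
Variable R : realType.
Implicit Types (X Y : R) (i j : int).

Lemma Sin_le1 i X : `|Sin i X| <= 1. Proof. exact: sin_max. Qed.

Lemma SinN i X : Sin (- i) X = - Sin i X.
Proof. by rewrite /Sin intrN !mulNr sinN. Qed.

Lemma Sin_0 X : Sin 0 X = 0. Proof. by rewrite /Sin !mul0r sin0. Qed.
Lemma Sin0 i : Sin i 0 = 0 :> R. Proof. by rewrite /Sin mulr0 sin0. Qed.
Lemma Cos0 i : Cos i 0 = 1 :> R. Proof. by rewrite /Cos mulr0 cos0. Qed.

Let pi0 : 0 < pi :> R. Proof. exact: pi_gt0. Qed.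

Lemma sin_cos_reflect i (a : R) : sin (i%:~R * pi - a) = (if par i then 1 else -1) * sin a /\
  cos (i%:~R * pi - a) = (if par i then -1 else 1) * cos a.
Proof.
have nat_case (n : nat) (b : R) : sin (n%:R * pi + b) = (if odd n then -1 else 1) * sin b /\
    cos (n%:R * pi + b) = (if odd n then -1 else 1) * cos b.
  elim: n => [|n [ih1 ih2]]; first by rewrite mul0r add0r !mul1r.
  have -> : n.+1%:R * pi + b = n%:R * pi + b + pi by rewrite -natr1; ring.
  by rewrite sinDpi cosDpi ih1 ih2 /=; case: (odd n); split => /=; ring.
case: i => n.
  have -> : par n = odd n by rewrite /par; lia.
  have [h1 h2] := nat_case n (- a); rewrite -pmulrn h1 h2 sinN cosN.
  by case: (odd n); split => /=; ring.
have -> : par (Negz n) = odd n.+1 by rewrite /par; lia.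
have [h1 h2] := nat_case n.+1 a.
have -> : (Negz n)%:~R * pi - a = - (n.+1%:R * pi + a) by rewrite NegzE intrN -pmulrn; ring.
by rewrite sinN cosN h1 h2; case: (odd n.+1); split => /=; ring.
Qed.

Lemma Sin_reflect i X : Sin i (2 - X) = (if par i then 1 else -1) * Sin i X.
Proof.
rewrite /Sin; have [<- _] := sin_cos_reflect i (i%:~R * (pi / 2) * X).
by congr sin; field.
Qed.

Lemma Cos_reflect i X : Cos i (2 - X) = (if par i then -1 else 1) * Cos i X.
Proof.
rewrite /Cos; have [_ <-] := sin_cos_reflect i (i%:~R * (pi / 2) * X).
by congr cos; field.
Qed.

Lemma Sin2 i : Sin i 2 = 0 :> R.
Proof. by rewrite -[2]subr0 Sin_reflect Sin0 mulr0. Qed.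

Lemma Cos_odd1 i : par i -> Cos i 1 = 0 :> R.
Proof.
move=> pi_; have := Cos_reflect i 1; rewrite pi_ (_ : 2 - 1 = 1); last by ring.
by move=> h; lra.
Qed.

Lemma Sin_even1 i : ~~ par i -> Sin i 1 = 0 :> R.
Proof.
move=> pi_; have := Sin_reflect i 1; rewrite (negbTE pi_) (_ : 2 - 1 = 1); last by ring.
by move=> h; lra.
Qed.

Lemma Sin1_gt0 X : 0 < X < 2 -> 0 < Sin 1 X.
Proof.
move=> /andP[X0 X2]; rewrite /Sin mul1r; apply: sin_gt0_pi; apply/andP; split.
  by rewrite mulr_gt0// divr_gt0.
by rewrite mulrAC ltr_pdivrMr// ltr_pM2l.
Qed.

Lemma Sin2_gt0 X : 0 < X < 1 -> 0 < Sin 2 X.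
Proof.
move=> /andP[X0 X1]; rewrite /Sin (_ : 2%:~R * (pi / 2) = pi :> R); last by field.
by apply: sin_gt0_pi; rewrite mulr_gt0//= -[ltRHS]mulr1 ltr_pM2l.
Qed.

Lemma Cos1_decr X Y : 0 <= X -> X < Y -> Y <= 2 -> Cos 1 Y < Cos 1 X.
Proof.
move=> X0 XY Y2; rewrite /Cos mul1r.
have itv Z : 0 <= Z <= 2 -> pi / 2 * Z \in `[0, pi : R].
  move=> /andP[Z0 Z2]; rewrite in_itv/= mulr_ge0 ?divr_ge0 ?(ltW pi0)//=.
  by rewrite mulrAC ler_pdivrMr// ler_pM2l.
rewrite ltr_cos; first by rewrite ltr_pM2l// divr_gt0.
  by apply: itv; rewrite X0 (le_trans (ltW XY)).
by apply: itv; rewrite Y2 (le_trans X0)// ltW.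
Qed.

Lemma Sin_double X : Sin 2 X = 2 * (Sin 1 X * Cos 1 X).
Proof.
rewrite /Sin /Cos mul1r (_ : 2%:~R * (pi / 2) * X = pi / 2 * X + pi / 2 * X); last by ring.
by rewrite sinD; ring.
Qed.

Lemma Cos_double X : Cos 2 X = 2 * Cos 1 X ^+ 2 - 1.
Proof.
rewrite /Cos mul1r (_ : 2%:~R * (pi / 2) * X = pi / 2 * X + pi / 2 * X); last by ring.
by rewrite cosD -!expr2 sin2cos2; ring.
Qed.

Lemma Sin_triple X : Sin 3 X = Sin 1 X * (2 * Cos 2 X + 1).
Proof.
have -> : Sin 3 X = sin (2%:~R * (pi / 2) * X + 1%:~R * (pi / 2) * X).
  by rewrite /Sin; congr sin; ring.
rewrite sinD -/(Sin 2 X) -/(Sin 1 X) -/(Cos 1 X) -/(Cos 2 X) Sin_double Cos_double.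
have : Sin 1 X ^+ 2 = 1 - Cos 1 X ^+ 2 by exact: sin2cos2.
by move=> E; ring.
Qed.

Lemma Cos2_decr X Y : 0 <= X -> X < Y -> Y <= 1 -> Cos 2 Y < Cos 2 X.
Proof.
move=> X0 XY Y1.
have E Z : Cos 2 Z = Cos 1 (2 * Z) by rewrite /Cos; congr cos; ring.
by rewrite !E; apply: Cos1_decr; lra.
Qed.

Lemma Sin_bound i : exists2 C : R, 0 <= C & forall X, `|Sin i X| <= C * `|Sin 1 X|.
Proof.
have [U [L L0 hL] UE] := @chebyshev_sin R i; exists L => // X.
rewrite /Sin mul1r -!mulrA UE normrM mulrC ler_wpM2r//.
exact: (hL _ _ (cos_max _) (cos_max _)).1.
Qed.

(** Writing i = 2 k, the angle of [Sin 2] becomes the base angle; this is the domination for a side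
    of length 1 with Dirichlet conditions at both ends. *)
Lemma Sin_bound_even i : ~~ par i -> exists2 C : R, 0 <= C &
  forall X, `|Sin i X| <= C * `|Sin 2 X|.
Proof.
move=> pi_; have [k ->] : exists k : int, i = k * 2.
  by exists (i %/ 2)%Z; move: pi_; rewrite /par; lia.
have [U [L L0 hL] UE] := @chebyshev_sin R k; exists L => // X.
rewrite /Sin intrM -!mulrA UE normrM mulrC ler_wpM2r//.
exact: (hL _ _ (cos_max _) (cos_max _)).1.
Qed.

(** By [Sin_double] the product on the right is half the antisymmetric mode of frequencies 2 and 1,
    the ground state of both large triangles. After division by the two factors [Sin 1], what
    remains on the left is antisymmetric in the cosines. *)
Lemma Sin_antisym_bound i j : exists2 C : R, 0 <= C & forall X Y,
  `|Sin i X * Sin j Y - Sin i Y * Sin j X| <=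
  C * `|Sin 1 X * Sin 1 Y * (Cos 1 X - Cos 1 Y)|.
Proof.
have [U hU UE] := @chebyshev_sin R i; have [V hV VE] := @chebyshev_sin R j.
have [C C0 hC] := antisymmetric_bound hU hV; exists C => // X Y.
have E k (W : R -> R) Z : (forall x, sin (k%:~R * x) = sin x * W (cos x)) ->
    Sin k Z = Sin 1 Z * W (Cos 1 Z).
  by move=> WE; rewrite /Sin /Cos !mul1r -mulrA WE.
rewrite !(E i _ _ UE) !(E j _ _ VE) [leRHS]mulrC normrM.
rewrite (_ : _ - _ = Sin 1 X * Sin 1 Y *
  (U (Cos 1 X) * V (Cos 1 Y) - U (Cos 1 Y) * V (Cos 1 X))); last by ring.
rewrite normrM -mulrA ler_wpM2l// mulrC; apply: hC; exact: cos_max.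
Qed.

(** The same with the odd quotients: the product on the right is half the antisymmetric mode of
    frequencies 3 and 1, the ground state of the small triangle of [B]. *)
Lemma Sin_antisym_bound_odd i j : par i -> par j -> exists2 C : R, 0 <= C & forall X Y,
  `|Sin i X * Sin j Y - Sin i Y * Sin j X| <=
  C * `|Sin 1 X * Sin 1 Y * (Cos 2 X - Cos 2 Y)|.
Proof.
move=> oi oj.
have [U hU UE] := @chebyshev_sin_odd R i oi; have [V hV VE] := @chebyshev_sin_odd R j oj.
have [C C0 hC] := antisymmetric_bound hU hV; exists C => // X Y.
have E k (W : R -> R) Z : (forall x, sin (k%:~R * x) = sin x * W (cos (2 * x))) ->
    Sin k Z = Sin 1 Z * W (Cos 2 Z).
  by move=> WE; rewrite /Sin /Cos !mul1r -!mulrA WE.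
rewrite !(E i _ _ UE) !(E j _ _ VE) [leRHS]mulrC normrM.
rewrite (_ : _ - _ = Sin 1 X * Sin 1 Y *
  (U (Cos 2 X) * V (Cos 2 Y) - U (Cos 2 Y) * V (Cos 2 X))); last by ring.
rewrite normrM -mulrA ler_wpM2l// mulrC; apply: hC; exact: cos_max.
Qed.

Variables (sg t0 t1 : R) (Q : bool -> bool -> bool) (e : R * R -> R).
Notation plane_bas := (bas sg t0 t1).

(** Since 3^2 exceeds 8, both frequencies are at most 2 in absolute value, and a sign of a frequency
    only changes the sign of the mode: finitely many cases remain. *)
Lemma small_frequencies :
  (forall m n : nat, (m <= 2)%N -> (n <= 2)%N -> (freq m n < 8)%N -> index Q m n ->
    exists a, forall z, plane_bas m n z = if freq m n == 5%N then a * e z else 0) ->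
  forall i j, index Q i j -> (freq i j < 8)%N ->
    exists a, forall z, plane_bas i j z = if freq i j == 5%N then a * e z else 0.
Proof.
move=> H i j; pose m := absz i; pose n := absz j.
have fE : freq i j = freq m n by [].
rewrite fE => hI f8.
have le2 (k l : nat) : (k ^ 2 + l ^ 2 < 8)%N -> (k <= 2)%N.
  move=> h; rewrite leqNgt; apply/negP => k3.
  have : (3 ^ 2 <= k ^ 2)%N by rewrite leq_exp2r.
  by lia.
have m2 : (m <= 2)%N by apply: (le2 m n).
have n2 : (n <= 2)%N by apply: (le2 n m); rewrite addnC.
have pa (k : int) : par (absz k) = par k by rewrite /par; lia.
have [a ha] := H m n m2 n2 f8 ltac:(by rewrite /index !pa).
have sgn (k : int) : exists c : R, forall X, Sin k X = c * Sin (absz k) X.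
  case: k => k; first by exists 1 => X; rewrite mul1r.
  by exists (-1) => X; rewrite NegzE SinN mulN1r.
have [c hc] := sgn i; have [d hd] := sgn j.
exists (c * d * a) => z.
have -> : plane_bas i j z = c * d * plane_bas m n z.
  by rewrite /bas /basis !(hc, hd); ring.
by rewrite ha; case: ifP => _; rewrite ?mulr0// mulrA.
Qed.

End SinCos.

(** * The six polygons *)

Section Regions.
Variables (R : realType) (P : polygon R).

Let side (i : nat) : R * R * R := (- (edge_vector P i).2, (edge_vector P i).1,
  (edge_vector P i).2 * (vertex P i).1 - (edge_vector P i).1 * (vertex P i).2).

Let sideE i z : affine (side i).1.1 (side i).1.2 (side i).2 z =
  (edge_vector P i).1 * (z.2 - (vertex P i).2) - (edge_vector P i).2 * (z.1 - (vertex P i).1).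
Proof. by rewrite /affine /=; ring. Qed.

Let regionE z : region P z <-> {in [seq side i | i <- iota 0 (size P)],
  forall c, 0 < affine c.1.1 c.1.2 c.2 z}.
Proof.
split=> [h c /mapP[i]|h i iP].
  by rewrite mem_iota => /andP[_ iP] ->; rewrite sideE; exact: h.
by rewrite -sideE; apply: h; apply: map_f; rewrite mem_iota.
Qed.

Lemma open_region : open (region P).
Proof. exact: open_affine_gt0 regionE. Qed.

Lemma closure_region z : closure (region P) z -> forall i, (i < size P)%N ->
  0 <= (edge_vector P i).1 * (z.2 - (vertex P i).2)
       - (edge_vector P i).2 * (z.1 - (vertex P i).1).
Proof.
move=> Kz i iP; rewrite -sideE; apply: (closure_affine regionE Kz).
by apply: map_f; rewrite mem_iota.
Qed.

Lemma edge_intro i z s : 0 <= s <= 1 ->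
  z.1 = (vertex P i).1 + s * (edge_vector P i).1 ->
  z.2 = (vertex P i).2 + s * (edge_vector P i).2 ->
  edge P i z.
Proof. by case: z => x y /= s01 -> ->; exists s => //=; rewrite in_itv. Qed.

Lemma open_edge_intro i z s : 0 < s < 1 ->
  z.1 = (vertex P i).1 + s * (edge_vector P i).1 ->
  z.2 = (vertex P i).2 + s * (edge_vector P i).2 ->
  open_edge P i z.
Proof. by case: z => x y /= s01 -> ->; exists s => //=; rewrite in_itv. Qed.

Lemma inward_normal i : edge_vector P i != 0 -> exists k,
  - (edge_vector P i).2 = k * (outward_normal P i).1 /\
  (edge_vector P i).1 = k * (outward_normal P i).2.
Proof.
move=> ev0; exists (- edge_length P i).
have len0 : edge_length P i != 0.
  rewrite gt_eqF// sqrtr_gt0 lt_neqAle addr_ge0 ?sqr_ge0// andbT eq_sym.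
  apply: contra ev0; rewrite paddr_eq0 ?sqr_ge0// !sqrf_eq0 => /andP[/eqP a /eqP b].
  by apply/eqP; case: (edge_vector P i) a b => /= x y -> ->.
split.
  transitivity (- edge_length P i * ((edge_length P i)^-1 * (edge_vector P i).2)); last by [].
  by field.
transitivity (- edge_length P i * ((edge_length P i)^-1 * - (edge_vector P i).1)); last by [].
by field.
Qed.

End Regions.

Section Polygons.
Variable R : realType.
Implicit Types z : R * R.

Definition square_A : polygon R :=
  [:: ((0, 0), Neumann); ((1, 0), Dirichlet); ((1, 1), Dirichlet); ((0, 1), Dirichlet)].
Definition large_triangle_A : polygon R :=
  [:: ((0, 0), Dirichlet); ((2, 0), Dirichlet); ((0, 2), Dirichlet)].
Definition small_triangle_A : polygon R :=
  [:: ((0, 0), Dirichlet); ((1, 0), Neumann); ((0, 1), Dirichlet)].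
Definition large_triangle_B : polygon R :=
  [:: ((0, 0), Dirichlet); ((2, 0), Neumann); ((1, 1), Dirichlet)].
Definition rectangle_B : polygon R :=
  [:: ((0, 0), Dirichlet); ((2, 0), Dirichlet); ((2, 1), Dirichlet); ((0, 1), Dirichlet)].
Definition small_triangle_B : polygon R :=
  [:: ((0, 0), Neumann); ((1, 0), Dirichlet); ((0, 1), Dirichlet)].

Lemma region_square_A z : region square_A z <-> [/\ 0 < z.1, z.1 < 1, 0 < z.2 & z.2 < 1].
Proof.
split=> [h|[a b c d] [|[|[|[|i]]]] //= _].
  have := h 0%N isT; have := h 1%N isT; have := h 2%N isT; have := h 3%N isT.
  by rewrite /edge_vector /vertex /= => a b c d; split; lra.
all: by rewrite /edge_vector /vertex /=; lra.
Qed.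

Lemma closure_square_A z : closure (region square_A) z -> [/\ 0 <= z.1, z.1 <= 1, 0 <= z.2 & z.2 <= 1].
Proof.
move=> /closure_region h; have := h 0%N isT; have := h 1%N isT; have := h 2%N isT; have := h 3%N isT.
by rewrite /edge_vector /vertex /= => a b c d; split; lra.
Qed.

Lemma region_large_triangle_A z : region large_triangle_A z <-> [/\ 0 < z.1, 0 < z.2 & z.1 + z.2 < 2].
Proof.
split=> [h|[a b c] [|[|[|i]]] //= _].
  have := h 0%N isT; have := h 1%N isT; have := h 2%N isT.
  by rewrite /edge_vector /vertex /= => a b c; split; lra.
all: by rewrite /edge_vector /vertex /=; lra.
Qed.

Lemma closure_large_triangle_A z : closure (region large_triangle_A) z -> [/\ 0 <= z.1, 0 <= z.2 & z.1 + z.2 <= 2].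
Proof.
move=> /closure_region h; have := h 0%N isT; have := h 1%N isT; have := h 2%N isT.
by rewrite /edge_vector /vertex /= => a b c; split; lra.
Qed.

Lemma region_small_triangle_A z : region small_triangle_A z <-> [/\ 0 < z.1, 0 < z.2 & z.1 + z.2 < 1].
Proof.
split=> [h|[a b c] [|[|[|i]]] //= _].
  have := h 0%N isT; have := h 1%N isT; have := h 2%N isT.
  by rewrite /edge_vector /vertex /= => a b c; split; lra.
all: by rewrite /edge_vector /vertex /=; lra.
Qed.

Lemma closure_small_triangle_A z : closure (region small_triangle_A) z -> [/\ 0 <= z.1, 0 <= z.2 & z.1 + z.2 <= 1].
Proof.
move=> /closure_region h; have := h 0%N isT; have := h 1%N isT; have := h 2%N isT.
by rewrite /edge_vector /vertex /= => a b c; split; lra.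
Qed.

Lemma region_large_triangle_B z : region large_triangle_B z <-> [/\ 0 < z.2, z.2 < z.1 & z.1 + z.2 < 2].
Proof.
split=> [h|[a b c] [|[|[|i]]] //= _].
  have := h 0%N isT; have := h 1%N isT; have := h 2%N isT.
  by rewrite /edge_vector /vertex /= => a b c; split; lra.
all: by rewrite /edge_vector /vertex /=; lra.
Qed.

Lemma closure_large_triangle_B z : closure (region large_triangle_B) z -> [/\ 0 <= z.2, z.2 <= z.1 & z.1 + z.2 <= 2].
Proof.
move=> /closure_region h; have := h 0%N isT; have := h 1%N isT; have := h 2%N isT.
by rewrite /edge_vector /vertex /= => a b c; split; lra.
Qed.

Lemma region_rectangle_B z : region rectangle_B z <-> [/\ 0 < z.1, z.1 < 2, 0 < z.2 & z.2 < 1].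
Proof.
split=> [h|[a b c d] [|[|[|[|i]]]] //= _].
  have := h 0%N isT; have := h 1%N isT; have := h 2%N isT; have := h 3%N isT.
  by rewrite /edge_vector /vertex /= => a b c d; split; lra.
all: by rewrite /edge_vector /vertex /=; lra.
Qed.

Lemma closure_rectangle_B z : closure (region rectangle_B) z -> [/\ 0 <= z.1, z.1 <= 2, 0 <= z.2 & z.2 <= 1].
Proof.
move=> /closure_region h; have := h 0%N isT; have := h 1%N isT; have := h 2%N isT; have := h 3%N isT.
by rewrite /edge_vector /vertex /= => a b c d; split; lra.
Qed.

Lemma region_small_triangle_B z : region small_triangle_B z <-> [/\ 0 < z.1, 0 < z.2 & z.1 + z.2 < 1].
Proof.
split=> [h|[a b c] [|[|[|i]]] //= _].
  have := h 0%N isT; have := h 1%N isT; have := h 2%N isT.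
  by rewrite /edge_vector /vertex /= => a b c; split; lra.
all: by rewrite /edge_vector /vertex /=; lra.
Qed.

Lemma closure_small_triangle_B z : closure (region small_triangle_B) z -> [/\ 0 <= z.1, 0 <= z.2 & z.1 + z.2 <= 1].
Proof.
move=> /closure_region h; have := h 0%N isT; have := h 1%N isT; have := h 2%N isT.
by rewrite /edge_vector /vertex /= => a b c; split; lra.
Qed.

End Polygons.

(** * Integrals from explicit antiderivatives *)

Section IteratedIntegrals.
Variable R : realType.
Notation mu1 := (@lebesgue_measure R).

Lemma measurable_slice2 (D : set (R * R)) (f : R * R -> R) (E : set (measurableTypeR R)) (y : R) :
  measurable_fun (D : set (mR2 R)) f -> measurable (D : set (mR2 R)) ->
  measurable E -> (forall x, E x -> D (x, y)) ->
  measurable_fun E (fun x => f (x, y)).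
Proof.
move=> mf mD mE ED.
apply: (@measurable_comp _ _ _ (measurableTypeR R) (mR2 R) R
  (D : set (mR2 R)) f E (fun x => (x, y))) => //.
- by move=> _ [x Ex <-]; exact: ED.
- by apply: measurable_funTS; exact: pair2_measurable.
Qed.

Lemma int_slices2 (D : set (R * R)) (a b : R) (p q : R -> R) (f : R * R -> R) :
  measurable (D : set (mR2 R)) -> (mu2 D < +oo)%E -> bmeas D f ->
  (forall x y, D (x, y) <-> a < y < b /\ p y < x < q y) ->
  \int[mu2]_(z in D) f z =
  \int[mu1]_(y in `]a, b[) \int[mu1]_(x in `]p y, q y[) f (x, y).
Proof.
move=> mD fD bf DE.
have int_f := bmeas_integrable mD fD bf.
rewrite Rintegral_mkcond {1}/Rintegral -[X in fine X]/(\int[mu2]_z (EFin \o (f \_ D)) z)%E.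
rewrite /area_measure -integral21_prod_meas1; last first.
  by rewrite -restrict_EFin; apply/(integrable_mkcond _ mD).
rewrite /Rintegral [in RHS]integral_mkcond; congr fine; apply: eq_integral => y _.
rewrite /fubini_G/= patchE; case: ifPn => [|/negP]; rewrite inE/= in_itv/= => hy.
  rewrite fineK.
    rewrite [RHS]integral_mkcond; apply: eq_integral => x _.
    rewrite !patchE; case: ifPn => [|/negP]; rewrite inE => hx.
      by rewrite mem_set//= in_itv/=; have [] := (DE _ _).1 hx.
    rewrite memNset//= in_itv/= => h; apply: hx; exact/DE.
  apply: integrable_fin_num => //.
  apply: measurable_bounded_integrable => //.
  - exact: finite_itv_oo.
  - case: bf => mf _; apply: (measurable_slice2 mf mD) => // x.
    by rewrite /= in_itv/= => h; apply/DE.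
  - case: bf => _ [M hM]; exists M; split; first exact: num_real.
    move=> N MN x /=; rewrite in_itv/= => hx.
    by rewrite (le_trans (hM _ _))// ?ltW//; apply/DE.
rewrite integral0_eq// => x _; rewrite patchE memNset// => h.
by apply: hy; have [] := (DE _ _).1 h.
Qed.

Section Antiderivative.
Variables (D : set (R * R)) (M a b : R) (p q : R -> R) (f : R * R -> R).
Variables (H : R -> R -> R) (K : R -> R).
Hypotheses (oD : open D) (DM : D `<=` obox M) (cf : continuous f) (ab : a <= b).
Hypothesis pq : forall x, a < x < b -> p x <= q x.
Hypothesis dK : forall x : R, is_derive x 1 K (H x (q x) - H x (p x)).
Hypothesis cK : continuous (fun x => H x (q x) - H x (p x)).

Let mD := measurable_region oD.
Let fD := area_region oD DM.
Let bf : bmeas D f := bmeas_continuous oD DM cf.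

Lemma int_antiderivative :
  (forall x y, D (x, y) <-> a < x < b /\ p x < y < q x) ->
  (forall x y : R, is_derive y 1 (H x) (f (x, y))) ->
  \int[mu2]_(z in D) f z = K b - K a.
Proof.
move=> DE dH; rewrite (int_slices mD fD bf DE) -(FTC_oo ab dK cK).
apply: eq_Rintegral => x; rewrite inE/= in_itv/= => xab.
apply: (FTC_oo (pq xab) (dH x)) => y.
apply: (@continuous_comp _ _ _ (fun y : R => (x, y)) f (y : R)); last exact: cf.
by apply: (@cvg_pair _ _ _ _ (nbhs x) (nbhs y)); [exact: cvg_cst|exact: cvg_id].
Qed.

(** Horizontal slices are for the large triangle of [B]: its hypotenuse lies on the horizontal axis,
    so each slice runs from y to 2 - y, whereas vertical ones would need a case distinction at x =
    1. *)
Lemma int_antiderivative2 :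
  (forall x y, D (x, y) <-> a < y < b /\ p y < x < q y) ->
  (forall x y : R, is_derive x 1 (H y) (f (x, y))) ->
  \int[mu2]_(z in D) f z = K b - K a.
Proof.
move=> DE dH; rewrite (int_slices2 mD fD bf DE) -(FTC_oo ab dK cK).
apply: eq_Rintegral => y; rewrite inE/= in_itv/= => yab.
apply: (FTC_oo (pq yab) (dH ^~ y)) => x.
apply: (@continuous_comp _ _ _ (fun x : R => (x, y)) f (x : R)); last exact: cf.
by apply: (@cvg_pair _ _ _ _ (nbhs x) (nbhs y)); [exact: cvg_id|exact: cvg_cst].
Qed.

End Antiderivative.
End IteratedIntegrals.

Lemma pi_neq0 (R : realType) : pi != 0 :> R. Proof. by rewrite gt_eqF// pi_gt0. Qed.

(* [field] would unfold [pi]. *)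
Ltac pi_field := match goal with
  | |- context [@pi ?K] => move: (@pi_neq0 K); generalize (@pi K) => p p0; by field
  | _ => by field
  end.

(** * Integrals of the leading modes and of their squares *)

Section TrigIntegrals.
Variable R : realType.
Implicit Types x y : R.
Notation S1 := (@Sin R 1).
Notation C1 := (@Cos R 1).
Notation S2 := (@Sin R 2).
Notation C2 := (@Cos R 2).

Lemma dS1 x : is_derive x 1 S1 (pi / 2 * C1 x).
Proof. by have := @is_derive_Sin R 1 x; rewrite mul1r. Qed.
Lemma dC1 x : is_derive x 1 C1 (- (pi / 2) * S1 x).
Proof. by have := @is_derive_Cos R 1 x; rewrite mul1r. Qed.
Lemma dS2 x : is_derive x 1 S2 (pi * C2 x).
Proof. by have := @is_derive_Sin R 2 x; rewrite (_ : 2%:~R * (pi / 2) = pi)//; field. Qed.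
Lemma dC2 x : is_derive x 1 C2 (- pi * S2 x).
Proof. by have := @is_derive_Cos R 2 x; rewrite (_ : 2%:~R * (pi / 2) = pi)//; field. Qed.
#[local] Existing Instances dS1 dC1 dS2 dC2.

Lemma S1sq x : S1 x ^+ 2 = 1 - C1 x ^+ 2. Proof. exact: sin2cos2. Qed.
Lemma S2sq x : S2 x ^+ 2 = 1 - C2 x ^+ 2. Proof. exact: sin2cos2. Qed.
Lemma S1_1 : S1 1 = 1. Proof. by rewrite /Sin mul1r mulr1 sin_pihalf. Qed.
Lemma C1_1 : C1 1 = 0. Proof. by rewrite /Cos mul1r mulr1 cos_pihalf. Qed.
Lemma C1_reflect x : C1 (2 - x) = - C1 x. Proof. by rewrite Cos_reflect mulN1r. Qed.
Lemma C2_reflect x : C2 (2 - x) = C2 x. Proof. by rewrite Cos_reflect mul1r. Qed.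
Lemma S1_reflect x : S1 (2 - x) = S1 x. Proof. by rewrite Sin_reflect mul1r. Qed.
Lemma S2_reflect x : S2 (2 - x) = - S2 x. Proof. by rewrite Sin_reflect mulN1r. Qed.
Lemma C1_2 : C1 2 = -1. Proof. by rewrite -[2]subr0 C1_reflect Cos0. Qed.

Definition int_S1sq x : R := x / 2 - S2 x / (2 * pi).
Definition int_S2sq x : R := x / 2 - S2 x * C2 x / (2 * pi).
Definition int_C1sq x : R := x / 2 + S2 x / (2 * pi).
Definition int_S1S2 x : R := 4 / (3 * pi) * S1 x ^+ 3.

Lemma d_int_S1sq x : is_derive x 1 int_S1sq (S1 x ^+ 2).
Proof.
rewrite /int_S1sq; apply: is_derive_eq; rewrite /GRing.scale/= S1sq Cos_double.
by pi_field.
Qed.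
Lemma d_int_C1sq x : is_derive x 1 int_C1sq (C1 x ^+ 2).
Proof.
rewrite /int_C1sq; apply: is_derive_eq; rewrite /GRing.scale/= Cos_double.
by pi_field.
Qed.
Lemma d_int_S2sq x : is_derive x 1 int_S2sq (S2 x ^+ 2).
Proof.
rewrite /int_S2sq; apply: is_derive_eq; rewrite /GRing.scale/=.
transitivity (2^-1 - 2^-1 * (C2 x ^+ 2 - S2 x ^+ 2)); first by pi_field.
by rewrite S2sq; pi_field.
Qed.
Lemma d_int_S1S2 x : is_derive x 1 int_S1S2 (S1 x * S2 x).
Proof.
rewrite /int_S1S2; apply: is_derive_eq; rewrite /GRing.scale/= Sin_double.
by pi_field.
Qed.
#[local] Existing Instances d_int_S1sq d_int_C1sq d_int_S2sq d_int_S1S2.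

Lemma int_S1sq_reflect x : int_S1sq (2 - x) = 1 - int_S1sq x.
Proof. by rewrite /int_S1sq S2_reflect; pi_field. Qed.
Lemma int_S2sq_reflect x : int_S2sq (2 - x) = 1 - int_S2sq x.
Proof. by rewrite /int_S2sq S2_reflect C2_reflect; pi_field. Qed.
Lemma int_S1S2_reflect x : int_S1S2 (2 - x) = int_S1S2 x.
Proof. by rewrite /int_S1S2 S1_reflect. Qed.

Lemma S2_1 : S2 1 = 0. Proof. exact: Sin_even1. Qed.
Lemma S2_2 : S2 2 = 0. Proof. exact: Sin2. Qed.
Lemma C2_1 : C2 1 = -1. Proof. by rewrite Cos_double C1_1 expr0n/= mulr0 add0r. Qed.

Lemma int_S1sq0 : int_S1sq 0 = 0. Proof. by rewrite /int_S1sq Sin0 !mul0r subr0. Qed.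
Lemma int_S2sq0 : int_S2sq 0 = 0. Proof. by rewrite /int_S2sq Sin0 !mul0r subr0. Qed.
Lemma int_C1sq0 : int_C1sq 0 = 0. Proof. by rewrite /int_C1sq Sin0 !mul0r addr0. Qed.
Lemma int_S1S20 : int_S1S2 0 = 0. Proof. by rewrite /int_S1S2 Sin0 expr0n/= mulr0. Qed.
Lemma int_S1sq1 : int_S1sq 1 = 1 / 2. Proof. by rewrite /int_S1sq S2_1 !mul0r subr0. Qed.
Lemma int_S2sq1 : int_S2sq 1 = 1 / 2. Proof. by rewrite /int_S2sq S2_1 !mul0r subr0. Qed.
Lemma int_C1sq1 : int_C1sq 1 = 1 / 2. Proof. by rewrite /int_C1sq S2_1 !mul0r addr0. Qed.
Lemma int_S1sq2 : int_S1sq 2 = 1. Proof. by rewrite /int_S1sq S2_2 !mul0r subr0 divff. Qed.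
Lemma int_S2sq2 : int_S2sq 2 = 1. Proof. by rewrite /int_S2sq S2_2 !mul0r subr0 divff. Qed.
Lemma int_S1S22 : int_S1S2 2 = 0. Proof. by rewrite /int_S1S2 Sin2 expr0n/= mulr0. Qed.

Lemma continuous_derivable (f : R -> R) : (forall x, derivable f x 1) -> continuous f.
Proof.
by move=> d x; apply: differentiable_continuous; apply/derivable1_diffP; exact: d.
Qed.

Lemma continuous_prod_fun (a b : R -> R) : continuous a -> continuous b ->
  continuous (fun z : R * R => a z.1 * b z.2).
Proof.
move=> ca cb z; apply: contM.
  by apply: (cont_comp ca); exact: cvg_fst.
by apply: (cont_comp cb); exact: cvg_snd.
Qed.

Let cS1 : continuous S1 := @continuous_Sin R 1.
Let cS2 : continuous S2 := @continuous_Sin R 2.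
Let cC1 : continuous C1 := @continuous_Cos R 1.

Let sub_box (D : set (R * R)) : (forall z, D z -> -3 < z.1 < 3 /\ -3 < z.2 < 3) -> D `<=` obox 3.
Proof. by move=> h [x y] /h[/= a b]; split; rewrite /= in_itv. Qed.

Lemma square_A_box : region (square_A R) `<=` obox 3.
Proof. by apply: sub_box => z /region_square_A[*]; split; lra. Qed.

Lemma large_triangle_A_box : region (large_triangle_A R) `<=` obox 3.
Proof. by apply: sub_box => z /region_large_triangle_A[*]; split; lra. Qed.

Lemma small_triangle_A_box : region (small_triangle_A R) `<=` obox 3.
Proof. by apply: sub_box => z /region_small_triangle_A[*]; split; lra. Qed.

Lemma large_triangle_B_box : region (large_triangle_B R) `<=` obox 3.
Proof. by apply: sub_box => z /region_large_triangle_B[*]; split; lra. Qed.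

Lemma rectangle_B_box : region (rectangle_B R) `<=` obox 3.
Proof. by apply: sub_box => z /region_rectangle_B[*]; split; lra. Qed.

Lemma small_triangle_B_box : region (small_triangle_B R) `<=` obox 3.
Proof. by apply: sub_box => z /region_small_triangle_B[*]; split; lra. Qed.

Lemma int_square_A : \int[mu2]_(z in region (square_A R)) (S2 z.1 * C1 z.2) = 4 / pi ^+ 2.
Proof.
pose K x : R := - (2 / pi ^+ 2) * C2 x.
transitivity (K 1 - K 0); last first.
  by rewrite /K C2_1 Cos0; pi_field.
apply: (@int_antiderivative _ _ 3 0 1 (cst 0) (cst 1) _ (fun x y => S2 x * (2 / pi * S1 y)) K) => //.
- exact: open_region.
- exact: square_A_box.
- exact: continuous_prod_fun.
- move=> x; rewrite /cst S1_1 Sin0; by apply: is_derive_eq; rewrite /GRing.scale/=; pi_field.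
- by apply: continuous_derivable => x; exact: ex_derive.
- move=> x y; split; first by move=> /region_square_A[/= -> -> -> ->].
  by case=> /andP[? ?] /andP[? ?]; apply/region_square_A.
- by move=> x y; apply: is_derive_eq; rewrite /GRing.scale/=; pi_field.
Qed.

Lemma int_square_A_sqr : \int[mu2]_(z in region (square_A R)) ((S2 z.1 * C1 z.2) ^+ 2) = 1 / 4.
Proof.
pose K x : R := 1 / 2 * int_S2sq x.
transitivity (K 1 - K 0); last first.
  by rewrite /K int_S2sq1 int_S2sq0; field.
apply: (@int_antiderivative _ _ 3 0 1 (cst 0) (cst 1) _ (fun x y => S2 x ^+ 2 * int_C1sq y) K) => //.
- exact: open_region.
- exact: square_A_box.
- by move=> z; apply: contX2; exact: continuous_prod_fun.
- move=> x; rewrite /cst int_C1sq1 int_C1sq0; by apply: is_derive_eq; rewrite /GRing.scale/=; pi_field.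
- by apply: continuous_derivable => x; exact: ex_derive.
- move=> x y; split; first by move=> /region_square_A[/= -> -> -> ->].
  by case=> /andP[? ?] /andP[? ?]; apply/region_square_A.
- by move=> x y; apply: is_derive_eq; rewrite /GRing.scale/=; pi_field.
Qed.

Lemma int_rectangle_B : \int[mu2]_(z in region (rectangle_B R)) (S1 z.1 * S2 z.2) = 8 / pi ^+ 2.
Proof.
pose K x : R := - (4 / pi ^+ 2) * C1 x.
transitivity (K 2 - K 0); last first.
  by rewrite /K C1_2 Cos0; pi_field.
apply: (@int_antiderivative _ _ 3 0 2 (cst 0) (cst 1) _ (fun x y => S1 x * (- pi^-1 * C2 y)) K) => //.
- exact: open_region.
- exact: rectangle_B_box.
- exact: continuous_prod_fun.
- move=> x; rewrite /cst C2_1 Cos0; by apply: is_derive_eq; rewrite /GRing.scale/=; pi_field.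
- by apply: continuous_derivable => x; exact: ex_derive.
- move=> x y; split; first by move=> /region_rectangle_B[/= -> -> -> ->].
  by case=> /andP[? ?] /andP[? ?]; apply/region_rectangle_B.
- by move=> x y; apply: is_derive_eq; rewrite /GRing.scale/=; pi_field.
Qed.

Lemma int_rectangle_B_sqr : \int[mu2]_(z in region (rectangle_B R)) ((S1 z.1 * S2 z.2) ^+ 2) = 1 / 2.
Proof.
pose K x : R := 1 / 2 * int_S1sq x.
transitivity (K 2 - K 0); last first.
  by rewrite /K int_S1sq2 int_S1sq0; field.
apply: (@int_antiderivative _ _ 3 0 2 (cst 0) (cst 1) _ (fun x y => S1 x ^+ 2 * int_S2sq y) K) => //.
- exact: open_region.
- exact: rectangle_B_box.
- by move=> z; apply: contX2; exact: continuous_prod_fun.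
- move=> x; rewrite /cst int_S2sq1 int_S2sq0; by apply: is_derive_eq; rewrite /GRing.scale/=; pi_field.
- by apply: continuous_derivable => x; exact: ex_derive.
- move=> x y; split; first by move=> /region_rectangle_B[/= -> -> -> ->].
  by case=> /andP[? ?] /andP[? ?]; apply/region_rectangle_B.
- by move=> x y; apply: is_derive_eq; rewrite /GRing.scale/=; pi_field.
Qed.

Lemma int_large_triangle_A :
  \int[mu2]_(z in region (large_triangle_A R))
    (2^-1 * (S2 z.1 * S1 z.2 + S1 z.1 * S2 z.2)) = 16 / (3 * pi ^+ 2).
Proof.
(* After the double-angle formulas the inner integral is [S1 x * (C1 x + 1) ^+ 2 / pi]. *)
pose K x : R := - (2 / (3 * pi ^+ 2)) * (C1 x + 1) ^+ 3.
transitivity (K 2 - K 0); last first.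
  by rewrite /K C1_2 Cos0; pi_field.
apply: (@int_antiderivative _ _ 3 0 2 (cst 0) (fun x => 2 - x) _
  (fun x y => 2^-1 * (S2 x * (- (2 / pi) * C1 y) + S1 x * (- pi^-1 * C2 y))) K) => //.
- exact: open_region.
- exact: large_triangle_A_box.
- by move=> z; apply: contM; [exact: cont_cst|apply: contD; exact: continuous_prod_fun].
- by move=> x /andP[? ?]; rewrite /cst/=; lra.
- move=> x; rewrite /cst !Cos0 C1_reflect C2_reflect.
  apply: is_derive_eq; rewrite /GRing.scale/= Sin_double Cos_double; pi_field.
- by apply: continuous_derivable => x; exact: ex_derive.
- move=> x y; split; first by move=> /region_large_triangle_A[/= ? ? ?]; rewrite /cst/=; split; lra.
  by rewrite /cst/=; case=> /andP[? ?] /andP[? ?]; apply/region_large_triangle_A; split => /=; lra.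
- by move=> x y; apply: is_derive_eq; rewrite /GRing.scale/=; pi_field.
Qed.

Lemma int_large_triangle_A_sqr :
  \int[mu2]_(z in region (large_triangle_A R))
    ((2^-1 * (S2 z.1 * S1 z.2 + S1 z.1 * S2 z.2)) ^+ 2) = 1 / 4.
Proof.
(* The reflection at 1 expresses the inner integral through the same antiderivatives at [x]; what
   results is an exact derivative by the product rule. *)
pose K x : R := 4^-1 * (int_S1sq x + int_S2sq x - int_S1sq x * int_S2sq x + int_S1S2 x ^+ 2).
transitivity (K 2 - K 0); last first.
  rewrite /K int_S1sq2 int_S2sq2 int_S1S22 int_S1sq0 int_S2sq0 int_S1S20; by field.
apply: (@int_antiderivative _ _ 3 0 2 (cst 0) (fun x => 2 - x) _
  (fun x y => 4^-1 * (S2 x ^+ 2 * int_S1sq y + 2 * (S1 x * S2 x) * int_S1S2 y + S1 x ^+ 2 * int_S2sq y)) K) => //.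
- exact: open_region.
- exact: large_triangle_A_box.
- by move=> z; apply: contX2; apply: contM; [exact: cont_cst|apply: contD; exact: continuous_prod_fun].
- by move=> x /andP[? ?]; rewrite /cst/=; lra.
- move=> x; rewrite /cst int_S1sq_reflect int_S2sq_reflect int_S1S2_reflect int_S1sq0 int_S2sq0 int_S1S20.
  by apply: is_derive_eq; rewrite /GRing.scale/=; field.
- by apply: continuous_derivable => x; exact: ex_derive.
- move=> x y; split; first by move=> /region_large_triangle_A[/= ? ? ?]; rewrite /cst/=; split; lra.
  by rewrite /cst/=; case=> /andP[? ?] /andP[? ?]; apply/region_large_triangle_A; split => /=; lra.
- by move=> x y; apply: is_derive_eq; rewrite /GRing.scale/=; pi_field.
Qed.

Lemma int_large_triangle_B :
  \int[mu2]_(z in region (large_triangle_B R))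
    (2^-1 * (S1 z.1 * S2 z.2 - S2 z.1 * S1 z.2)) = 8 / (3 * pi ^+ 2).
Proof.
(* Between x and 2 - x the [C2] terms cancel, and the inner integral is
   [4 / pi * S1 x * C1 x ^+ 2]. *)
pose K x : R := - (8 / (3 * pi ^+ 2)) * C1 x ^+ 3.
transitivity (K 1 - K 0); last first.
  by rewrite /K C1_1 Cos0; pi_field.
apply: (@int_antiderivative2 _ _ 3 0 1 id (fun x => 2 - x) _
  (fun x y => 2^-1 * (- (2 / pi) * C1 y * S2 x + pi^-1 * C2 y * S1 x)) K) => //.
- exact: open_region.
- exact: large_triangle_B_box.
- by move=> z; apply: contM; [exact: cont_cst|apply: contB; exact: continuous_prod_fun].
- by move=> x /andP[? ?]; rewrite /cst/=; lra.
- move=> x; rewrite C1_reflect C2_reflect.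
  apply: is_derive_eq; rewrite /GRing.scale/= Sin_double; pi_field.
- by apply: continuous_derivable => x; exact: ex_derive.
- move=> x y; split; first by move=> /region_large_triangle_B[/= ? ? ?]; rewrite /cst/=; split; lra.
  by rewrite /cst/=; case=> /andP[? ?] /andP[? ?]; apply/region_large_triangle_B; split => /=; lra.
- by move=> x y; apply: is_derive_eq; rewrite /GRing.scale/=; pi_field.
Qed.

Lemma int_large_triangle_B_sqr :
  \int[mu2]_(z in region (large_triangle_B R))
    ((2^-1 * (S1 z.1 * S2 z.2 - S2 z.1 * S1 z.2)) ^+ 2) = 1 / 8.
Proof.
(* The mixed terms cancel because [int_S1S2] is invariant under the reflection; the rest is an exact
   derivative. *)
pose K x : R := 4^-1 * (int_S1sq x + int_S2sq x - 2 * int_S1sq x * int_S2sq x).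
transitivity (K 1 - K 0); last first.
  rewrite /K int_S1sq1 int_S2sq1 int_S1sq0 int_S2sq0; by field.
apply: (@int_antiderivative2 _ _ 3 0 1 id (fun x => 2 - x) _
  (fun x y => 4^-1 * (int_S1sq y * S2 x ^+ 2 - 2 * int_S1S2 y * (S1 x * S2 x) + int_S2sq y * S1 x ^+ 2)) K) => //.
- exact: open_region.
- exact: large_triangle_B_box.
- by move=> z; apply: contX2; apply: contM; [exact: cont_cst|apply: contB; exact: continuous_prod_fun].
- by move=> x /andP[? ?]; rewrite /cst/=; lra.
- move=> x; rewrite int_S1sq_reflect int_S2sq_reflect int_S1S2_reflect.
  by apply: is_derive_eq; rewrite /GRing.scale/=; field.
- by apply: continuous_derivable => x; exact: ex_derive.
- move=> x y; split; first by move=> /region_large_triangle_B[/= ? ? ?]; rewrite /cst/=; split; lra.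
  by rewrite /cst/=; case=> /andP[? ?] /andP[? ?]; apply/region_large_triangle_B; split => /=; lra.
- by move=> x y; apply: is_derive_eq; rewrite /GRing.scale/=; pi_field.
Qed.

End TrigIntegrals.

(** * Heat content of the components *)

Ltac on_edge i s :=
  exists i; split => //; apply: (@edge_intro _ _ _ _ s); rewrite /vertex /edge_vector /=; lra.

Section PolygonHeat.
Variable R : realType.
Implicit Types (x y t : R) (z : R * R).
Notation S1 := (@Sin R 1).
Notation C1 := (@Cos R 1).
Notation S2 := (@Sin R 2).
Notation C2 := (@Cos R 2).
Notation S3 := (@Sin R 3).

Definition heat_flow (P : polygon R) (u : R -> R * R -> R) := mixed_heat_equation P u /\
  (\int[area_measure R]_(x in region P) ((u t x - 1) ^+ 2)%:E)%E @[t --> 0^'+] --> 0%E.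

Definition content_asymptotics (P : polygon R) (c : R) := forall u, heat_flow P u ->
  forall t, 0 < t ->
  `|\int[mu2]_(z in region P) u t z - expR (- (eigenvalue R 5%N * t)) * c| <=
  fine (mu2 (region P)) * expR (- (eigenvalue R 8%N * t)).

Lemma neq_gt0 x : 0 <= x -> x != 0 -> 0 < x.
Proof. by move=> x0 xn; rewrite lt_neqAle eq_sym xn. Qed.

Lemma neq_lt (a b : R) : a <= b -> a != b -> a < b.
Proof. by move=> ab abn; rewrite lt_neqAle abn. Qed.

Lemma Sin1_complement y : S1 (1 - y) = C1 y.
Proof.
rewrite /Sin /Cos !mul1r mulrBr mulr1 -opprB sinN sinBpihalf opprK.
by [].
Qed.

Lemma Cos1_gt0 y : 0 <= y < 1 -> 0 < C1 y.
Proof.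
by move=> /andP[? ?]; rewrite -Sin1_complement; apply: Sin1_gt0; apply/andP; split; lra.
Qed.

Lemma Sin2_complement y : S2 (1 - y) = S2 y.
Proof.
rewrite /Sin (_ : 2%:~R * (pi / 2) = pi); last by field.
by rewrite mulrBr mulr1 -opprB sinN -[pi * y - pi]/(pi * y + - pi) sinB cospi sinpi; ring.
Qed.

Lemma Sin_double_diff x y : S1 x * S2 y - S2 x * S1 y = 2 * (S1 x * S1 y * (C1 y - C1 x)).
Proof. by rewrite !Sin_double; ring. Qed.

Lemma Sin_triple_diff x y : S3 x * S1 y - S3 y * S1 x = 2 * (S1 x * S1 y * (C2 x - C2 y)).
Proof. by rewrite !Sin_triple; ring. Qed.

Lemma half_sub_le1 (a b c d : R) : `|a| <= 1 -> `|b| <= 1 -> `|c| <= 1 -> `|d| <= 1 ->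
  2^-1 * (a * b - c * d) <= 1.
Proof.
move=> ha hb hc hd; rewrite (le_trans (ler_norm _))// normrM ger0_norm//.
have h1 : `|a * b| <= 1 * 1 by rewrite normrM ler_pM.
have h2 : `|c * d| <= 1 * 1 by rewrite normrM ler_pM.
by have := ler_normB (a * b) (c * d); lra.
Qed.

Lemma heat_square_A : content_asymptotics (square_A R) (64 / pi ^+ 4).
Proof.
move=> u [heat init] t t0.
pose e z := S2 z.1 * C1 z.2.
have eE z : e z = 1 * bas 0 1 (-1) 2 1 z.
  by rewrite /bas /basis /e mul0r subr0 mul1r mulN1r Sin1_complement.
have dich z : closure (region (square_A R)) z ->
    [\/ z.1 = 0, z.1 = 1, z.2 = 1 | [/\ 0 < z.1, z.1 < 1 & z.2 < 1]].
  move=> /closure_square_A[a b c d].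
  have [?|x0] := eqVneq z.1 0; first by constructor 1.
  have [?|x1] := eqVneq z.1 1; first by constructor 2.
  have [?|y1] := eqVneq z.2 1; first by constructor 3.
  by constructor 4; rewrite neq_gt0// !neq_lt.
have e0 z : [\/ z.1 = 0, z.1 = 1 | z.2 = 1] -> e z = 0.
  by rewrite /e => -[] ->; rewrite ?(Sin0, S2_1, C1_1) ?(mul0r, mulr0).
have e_gt0 z : 0 < z.1 -> z.1 < 1 -> 0 <= z.2 -> z.2 < 1 -> 0 < e z.
  by move=> a b c d; rewrite mulr_gt0// ?Sin2_gt0 ?Cos1_gt0 ?a ?c.
have e_ge0 z : closure (region (square_A R)) z -> 0 <= e z.
  move=> Kz; have [_ _ c _] := closure_square_A Kz.
  case: (dich z Kz) => [h|h|h|[? ? ?]]; last by apply/ltW/e_gt0.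
  - by rewrite e0//; constructor 1.
  - by rewrite e0//; constructor 2.
  - by rewrite e0//; constructor 3.
have strict z : closure (region (square_A R)) z -> 0 < e z ->
    [/\ 0 < z.1, z.1 < 1 & z.2 < 1].
  by move=> /dich[h|h|h|//]; rewrite e0 ?ltxx//; [constructor 1|constructor 2|constructor 3].
have -> : 64 / pi ^+ 4 = (\int[mu2]_(z in region (square_A R)) e z) ^+ 2 /
    \int[mu2]_(z in region (square_A R)) (e z ^+ 2) :> R.
  by rewrite int_square_A int_square_A_sqr; pi_field.
(* [Y = 1 - y] and [l = y]. For even i, [Sin i x] vanishes at x = 0 and x = 1; for odd j, [Sin j Y]
   vanishes at y = 1 and has zero slope at y = 0. *)
apply: (@trig_asymptotics R (square_A R) 3 0 1 0 0 1 (-1) 1 2 1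
  (fun a b => ~~ a && b) e eE) => //.
- exact: open_region.
- exact: square_A_box.
- by move=> z /region_square_A[? ? ? ?]; rewrite /affine; lra.
- move=> z Kz ez; have [? ? ?] := strict z Kz ez; rewrite /affine => ?.
  by apply/region_square_A; split => //; lra.
- move=> z Kz ez; have [a b c d] := closure_square_A Kz.
  case: (dich z Kz) => [h|h|h|[? ? ?]]; last by move: ez; rewrite leNgt e_gt0.
  + on_edge 3%N (1 - z.2).
  + on_edge 1%N z.2.
  + on_edge 2%N (1 - z.1).
- move=> z Kz ez; have [a b d] := strict z Kz ez; rewrite /affine => lz.
  have [|k [h1 h2]] := @inward_normal _ (square_A R) 0%N.
    by apply/eqP => /(congr1 fst) /= /eqP; rewrite subr0 oner_eq0.
  exists 0%N, k; split => //.
    by apply: (@open_edge_intro _ _ _ _ z.1); rewrite /vertex /edge_vector /=; lra.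
  by rewrite -h1 -h2 /edge_vector /vertex /=; split; ring.
- by rewrite sqrrN expr1n.
- by left.
- by do 6 case.
- by left.
- move=> z /region_square_A[a b c d]; rewrite e_gt0 ?(ltW c)//=.
  rewrite /e (le_trans (ler_norm _))// normrM -[leRHS]mulr1.
  by rewrite ler_pM// ?Sin_le1// cos_max.
- move=> i j /andP[pi_ pj] z _; rewrite /affine => lz.
  have y0 : z.2 = 0 by lra.
  by rewrite /bas2 y0 mulr0 addr0 (Cos_odd1 R pj); ring.
- move=> i j /andP[pi_ pj].
  have [A A0 hA] := Sin_bound_even R pi_; have [B B0 hB] := Sin_bound R j.
  exists (A * B) => z Kz; have [a b c d] := closure_square_A Kz.
  have -> : e z = `|S2 z.1| * `|S1 (1 + -1 * z.2)|.
    by rewrite mulN1r Sin1_complement -normrM -/(e z) ger0_norm// e_ge0.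
  by rewrite /bas /basis mul0r subr0 normrM mulrACA ler_pM.
- apply: small_frequencies => -[|[|[|m]]] [|[|[|n]]] // _ _ _; rewrite /index /par //= => _.
    by exists 0 => z; rewrite /bas /basis Sin_0 !mul0r subr0.
  by exists 1 => z; rewrite eE mul1r mul1r.
- by right; split => //; rewrite int_square_A_sqr; lra.
Qed.

Lemma heat_rectangle_B : content_asymptotics (rectangle_B R) (128 / pi ^+ 4).
Proof.
move=> u [heat init] t t0.
pose e z := S1 z.1 * S2 z.2.
have eE z : e z = 1 * bas 0 0 1 1 2 z.
  by rewrite /bas /basis /e mul0r subr0 !mul1r add0r.
have dich z : closure (region (rectangle_B R)) z -> z.1 = 0 \/ z.1 = 2 \/ z.2 = 0 \/ z.2 = 1 \/
    [/\ 0 < z.1, z.1 < 2, 0 < z.2 & z.2 < 1].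
  move=> /closure_rectangle_B[a b c d].
  have [?|x0] := eqVneq z.1 0; first by left.
  have [?|x1] := eqVneq z.1 2; first by right; left.
  have [?|y0] := eqVneq z.2 0; first by do 2 right; left.
  have [?|y1] := eqVneq z.2 1; first by do 3 right; left.
  by do 4 right; rewrite !neq_gt0// !neq_lt.
have e0 z : z.1 = 0 \/ z.1 = 2 \/ z.2 = 0 \/ z.2 = 1 -> e z = 0.
  by rewrite /e => -[|[|[|]]] ->; rewrite ?(Sin0, Sin2, S2_1) ?(mul0r, mulr0).
have e_gt0 z : [/\ 0 < z.1, z.1 < 2, 0 < z.2 & z.2 < 1] -> 0 < e z.
  by move=> [a b c d]; rewrite mulr_gt0// ?Sin1_gt0 ?Sin2_gt0 ?a ?c.
have e_ge0 z : closure (region (rectangle_B R)) z -> 0 <= e z.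
  by move=> /dich[h|[h|[h|[h|/e_gt0/ltW//]]]]; rewrite e0//; tauto.
have strict z : closure (region (rectangle_B R)) z -> 0 < e z ->
    [/\ 0 < z.1, z.1 < 2, 0 < z.2 & z.2 < 1].
  by move=> /dich[h|[h|[h|[h|//]]]]; rewrite e0 ?ltxx//; tauto.
have -> : 128 / pi ^+ 4 = (\int[mu2]_(z in region (rectangle_B R)) e z) ^+ 2 /
    \int[mu2]_(z in region (rectangle_B R)) (e z ^+ 2) :> R.
  by rewrite int_rectangle_B int_rectangle_B_sqr; pi_field.
(* No Neumann edge: [l = y + 1] is positive on the closure. Width 2 allows every i; height 1
   requires j even. *)
apply: (@trig_asymptotics R (rectangle_B R) 3 0 1 1 0 0 1 1 1 2
  (fun a b => ~~ b) e eE) => //.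
- exact: open_region.
- exact: rectangle_B_box.
- by move=> z /region_rectangle_B[? ? ? ?]; rewrite /affine; lra.
- by move=> z Kz ez _; apply/region_rectangle_B; exact: strict.
- move=> z Kz ez; have [a b c d] := closure_rectangle_B Kz.
  case: (dich z Kz) => [h|[h|[h|[h|/e_gt0]]]]; last by rewrite ltNge ez.
  + on_edge 3%N (1 - z.2).
  + on_edge 1%N z.2.
  + on_edge 0%N (z.1 / 2).
  + on_edge 2%N (1 - z.1 / 2).
- by move=> z /closure_rectangle_B[a b c d] _; rewrite /affine => lz; exfalso; lra.
- by rewrite expr1n.
- by left.
- by do 6 case.
- by left.
- move=> z /region_rectangle_B h; rewrite e_gt0//=.
  rewrite /e (le_trans (ler_norm _))// normrM -[leRHS]mulr1.
  by rewrite ler_pM// Sin_le1.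
- by move=> i j _ z /closure_rectangle_B[a b c d]; rewrite /affine => lz; exfalso; lra.
- move=> i j pj.
  have [A A0 hA] := Sin_bound R i; have [B B0 hB] := Sin_bound_even R pj.
  exists (A * B) => z Kz.
  rewrite -[e z]ger0_norm ?e_ge0// /e /bas /basis mul0r subr0 mul1r add0r !normrM mulrACA.
  by rewrite ler_pM.
- apply: small_frequencies => -[|[|[|m]]] [|[|[|n]]] // _ _ _; rewrite /index /par //= => _.
  1,2,3,5: by exists 0 => z; rewrite /bas /basis !Sin_0 !(mul0r, mulr0) subr0.
  by exists 1 => z; rewrite eE mul1r mul1r.
- by right; split => //; rewrite int_rectangle_B_sqr; lra.
Qed.

End PolygonHeat.

Section TriangleHeat.
Variable R : realType.
Implicit Types (x y t : R) (z : R * R).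
Notation S1 := (@Sin R 1).
Notation C1 := (@Cos R 1).
Notation S2 := (@Sin R 2).
Notation C2 := (@Cos R 2).
Notation S3 := (@Sin R 3).

Lemma heat_large_triangle_A :
  content_asymptotics (large_triangle_A R) (1024 / (9 * pi ^+ 4)).
Proof.
move=> u [heat init] t t0.
pose e z := 2^-1 * (S2 z.1 * S1 z.2 + S1 z.1 * S2 z.2).
have eE z : e z = 2^-1 * bas 1 2 (-1) 2 1 z.
  by rewrite /bas /basis /e mul1r mulN1r S1_reflect S2_reflect; ring.
have e_prod z : e z = S1 z.1 * S1 z.2 * (C1 z.1 + C1 z.2).
  by rewrite /e !Sin_double; field.
have dich z : closure (region (large_triangle_A R)) z ->
    z.1 = 0 \/ z.2 = 0 \/ z.1 + z.2 = 2 \/ [/\ 0 < z.1, 0 < z.2 & z.1 + z.2 < 2].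
  move=> /closure_large_triangle_A[a b c].
  have [?|x0] := eqVneq z.1 0; first by left.
  have [?|y0] := eqVneq z.2 0; first by right; left.
  have [?|s2] := eqVneq (z.1 + z.2) 2; first by do 2 right; left.
  by do 3 right; rewrite !neq_gt0// neq_lt.
have e0 z : z.1 = 0 \/ z.2 = 0 \/ z.1 + z.2 = 2 -> e z = 0.
  rewrite e_prod => -[->|[->|h]]; rewrite ?Sin0 ?(mul0r, mulr0)//.
  have -> : z.2 = 2 - z.1 by rewrite -h; ring.
  by rewrite C1_reflect subrr mulr0.
have e_gt0 z : [/\ 0 < z.1, 0 < z.2 & z.1 + z.2 < 2] -> 0 < e z.
  move=> [a b c]; rewrite e_prod mulr_gt0//.
    by rewrite mulr_gt0// Sin1_gt0//; apply/andP; split; lra.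
  have := @Cos1_decr R z.1 (2 - z.2); rewrite C1_reflect => h.
  have {}h : - C1 z.2 < C1 z.1 by apply: h; lra.
  by lra.
have e_ge0 z : closure (region (large_triangle_A R)) z -> 0 <= e z.
  by move=> /dich[h|[h|[h|/e_gt0/ltW//]]]; rewrite e0//; tauto.
have strict z : closure (region (large_triangle_A R)) z -> 0 < e z ->
    [/\ 0 < z.1, 0 < z.2 & z.1 + z.2 < 2].
  by move=> /dich[h|[h|[h|//]]]; rewrite e0 ?ltxx//; tauto.
have -> : 1024 / (9 * pi ^+ 4) = (\int[mu2]_(z in region (large_triangle_A R)) e z) ^+ 2 /
    \int[mu2]_(z in region (large_triangle_A R)) (e z ^+ 2) :> R.
  by rewrite int_large_triangle_A int_large_triangle_A_sqr; pi_field.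
(* With [Y = 2 - y] the hypotenuse is the diagonal x = Y, across which the modes for [sg = 1] are
   antisymmetric; all parities vanish on the legs. Again [l = y + 1] has no zero on the closure. *)
apply: (@trig_asymptotics R (large_triangle_A R) 3 0 1 1 1 2 (-1) 2^-1 2 1
  (fun _ _ => true) e eE) => //.
- exact: open_region.
- exact: large_triangle_A_box.
- by move=> z /region_large_triangle_A[? ? ?]; rewrite /affine; lra.
- by move=> z Kz ez _; apply/region_large_triangle_A; exact: strict.
- move=> z Kz ez; have [a b c] := closure_large_triangle_A Kz.
  case: (dich z Kz) => [h|[h|[h|/e_gt0]]]; last by rewrite ltNge ez.
  + on_edge 2%N (1 - z.2 / 2).
  + on_edge 0%N (z.1 / 2).
  + on_edge 1%N (z.2 / 2).
- by move=> z /closure_large_triangle_A[a b c] _; rewrite /affine => lz; exfalso; lra.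
- by rewrite sqrrN expr1n.
- by right; left.
- by right.
- move=> z /region_large_triangle_A h; rewrite e_gt0//=.
  rewrite /e -[S1 z.1 * S2 z.2]opprK -mulNr -[- S1 z.1]/(- S1 z.1).
  by apply: half_sub_le1; rewrite ?normrN Sin_le1.
- by move=> i j _ z /closure_large_triangle_A[a b c]; rewrite /affine => lz; exfalso; lra.
- move=> i j _; have [A A0 hA] := Sin_antisym_bound R i j.
  exists A => z Kz; rewrite /bas /basis mul1r mulN1r.
  rewrite -[e z]ger0_norm ?e_ge0// e_prod.
  have := hA z.1 (2 - z.2); rewrite S1_reflect C1_reflect opprK; exact.
- apply: small_frequencies => -[|[|[|m]]] [|[|[|n]]] // _ _ _; rewrite /index /par //= => _.
  1-5,7: by exists 0 => z; rewrite /bas /basis ?Sin_0; ring.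
  + by exists (- 2) => z; rewrite eE /bas /basis; field.
  + by exists 2 => z; rewrite eE /bas /basis; field.
- by right; split => //; rewrite int_large_triangle_A_sqr; lra.
Qed.

Lemma heat_large_triangle_B :
  content_asymptotics (large_triangle_B R) (512 / (9 * pi ^+ 4)).
Proof.
move=> u [heat init] t t0.
pose e z := 2^-1 * (S1 z.1 * S2 z.2 - S2 z.1 * S1 z.2).
have eE z : e z = 2^-1 * bas 1 0 1 1 2 z.
  by rewrite /bas /basis /e !mul1r add0r; ring.
have e_prod z : e z = S1 z.1 * S1 z.2 * (C1 z.2 - C1 z.1).
  by rewrite /e Sin_double_diff; field.
have dich z : closure (region (large_triangle_B R)) z ->
    z.2 = 0 \/ z.1 = z.2 \/ [/\ 0 < z.2 & z.2 < z.1].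
  move=> /closure_large_triangle_B[a b c].
  have [?|y0] := eqVneq z.2 0; first by left.
  have [?|xy] := eqVneq z.1 z.2; first by right; left.
  by do 2 right; rewrite neq_gt0// neq_lt// eq_sym.
have e0 z : z.2 = 0 \/ z.1 = z.2 -> e z = 0.
  by rewrite e_prod => -[->|->]; rewrite ?Sin0 ?subrr ?(mulr0, mul0r).
have e_gt0 z : [/\ 0 < z.2 & z.2 < z.1] -> z.1 + z.2 <= 2 -> 0 < e z.
  move=> [a b] c; rewrite e_prod mulr_gt0//.
    by rewrite mulr_gt0// Sin1_gt0//; apply/andP; split; lra.
  by rewrite subr_gt0 Cos1_decr//; lra.
have e_ge0 z : closure (region (large_triangle_B R)) z -> 0 <= e z.
  move=> Kz; have [_ _ c] := closure_large_triangle_B Kz.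
  by case: (dich z Kz) => [h|[h|h]]; [rewrite e0//; tauto|rewrite e0//; tauto|exact/ltW/e_gt0].
have strict z : closure (region (large_triangle_B R)) z -> 0 < e z -> [/\ 0 < z.2 & z.2 < z.1].
  by move=> /dich[h|[h|//]]; rewrite e0 ?ltxx//; tauto.
have -> : 512 / (9 * pi ^+ 4) = (\int[mu2]_(z in region (large_triangle_B R)) e z) ^+ 2 /
    \int[mu2]_(z in region (large_triangle_B R)) (e z ^+ 2) :> R.
  by rewrite int_large_triangle_B int_large_triangle_B_sqr; pi_field.
(* [l = 2 - x - y]. Antisymmetry across x = y gives the Dirichlet leg. Reflection in x + y = 2
   preserves the mode exactly when i and j have opposite parities, which gives the Neumann leg. *)
apply: (@trig_asymptotics R (large_triangle_B R) 3 (-1) (-1) 2 1 0 1 2^-1 1 2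
  (fun a b => a (+) b) e eE) => //.
- exact: open_region.
- exact: large_triangle_B_box.
- by move=> z /region_large_triangle_B[? ? ?]; rewrite /affine; lra.
- move=> z Kz ez; have [? ?] := strict z Kz ez; rewrite /affine => ?.
  by apply/region_large_triangle_B; split => //; lra.
- move=> z Kz ez; have [a b c] := closure_large_triangle_B Kz.
  case: (dich z Kz) => [h|[h|/e_gt0/(_ c)]]; last by rewrite ltNge ez.
  + on_edge 0%N (z.1 / 2).
  + on_edge 2%N (1 - z.1).
- move=> z Kz ez; have [a b] := strict z Kz ez; rewrite /affine => lz.
  have [|k [h1 h2]] := @inward_normal _ (large_triangle_B R) 1%N.
    by apply/eqP => /(congr1 snd) /= /eqP; rewrite subr0 oner_eq0.
  exists 1%N, k; split => //.
    by apply: (@open_edge_intro _ _ _ _ z.2); rewrite /vertex /edge_vector /=; lra.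
  by rewrite -h1 -h2 /edge_vector /vertex /=; split; ring.
- by rewrite expr1n.
- by right; left.
- by do 6 case.
- by right.
- move=> z /region_large_triangle_B[a b c]; rewrite e_gt0 ?(ltW c)//=.
  by apply: half_sub_le1; exact: Sin_le1.
- move=> i j ij z _; rewrite /affine => lz.
  have -> : z = (2 - z.2, z.2) by case: z lz => x y /= lz; congr pair; lra.
  rewrite /bas1 /bas2 /= !mul1r !add0r !Sin_reflect !Cos_reflect.
  by move: ij; rewrite /index; case: (par i); case: (par j) => //= _; ring.
- move=> i j _; have [A A0 hA] := Sin_antisym_bound R i j.
  exists A => z Kz; rewrite /bas /basis !mul1r add0r.
  rewrite -[e z]ger0_norm ?e_ge0// e_prod -[C1 z.2 - _]opprB mulrN normrN.
  exact: hA.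
- apply: small_frequencies => -[|[|[|m]]] [|[|[|n]]] // _ _ _; rewrite /index /par //= => _.
  1,2: by exists 0 => z; rewrite /bas /basis ?Sin_0; ring.
  + by exists 2 => z; rewrite eE /bas /basis; field.
  + by exists (- 2) => z; rewrite eE /bas /basis; field.
- by right; split => //; rewrite int_large_triangle_B_sqr; lra.
Qed.

Lemma heat_small_triangle_A : content_asymptotics (small_triangle_A R) 0.
Proof.
have lead0 : (\int[mu2]_(z in region (small_triangle_A R)) (cst 0 z)) ^+ 2 /
    \int[mu2]_(z in region (small_triangle_A R)) (cst 0 z ^+ 2) = 0 :> R.
  by rewrite /Rintegral integral0 expr0n mul0r.
rewrite -lead0 => u [heat init] t t0.
pose e z := S2 z.1 * S2 z.2.
have eE z : e z = 2^-1 * bas (-1) 1 (-1) 2 2 z.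
  by rewrite /bas /basis /e mulN1r Sin2_complement; field.
have dich z : closure (region (small_triangle_A R)) z ->
    z.1 = 0 \/ z.2 = 0 \/ [/\ 0 < z.1 & 0 < z.2].
  move=> /closure_small_triangle_A[a b c].
  have [?|x0] := eqVneq z.1 0; first by left.
  have [?|y0] := eqVneq z.2 0; first by right; left.
  by do 2 right; rewrite !neq_gt0.
have e0 z : z.1 = 0 \/ z.2 = 0 -> e z = 0.
  by rewrite /e => -[->|->]; rewrite Sin0 ?(mulr0, mul0r).
have e_gt0 z : [/\ 0 < z.1 & 0 < z.2] -> z.1 + z.2 <= 1 -> 0 < e z.
  by move=> [a b] c; rewrite mulr_gt0// Sin2_gt0//; apply/andP; split; lra.
have e_ge0 z : closure (region (small_triangle_A R)) z -> 0 <= e z.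
  move=> Kz; have [_ _ c] := closure_small_triangle_A Kz.
  by case: (dich z Kz) => [h|[h|h]]; [rewrite e0//; tauto|rewrite e0//; tauto|exact/ltW/e_gt0].
have strict z : closure (region (small_triangle_A R)) z -> 0 < e z -> [/\ 0 < z.1 & 0 < z.2].
  by move=> /dich[h|[h|//]]; rewrite e0 ?ltxx//; tauto.
(* With [Y = 1 - y] the hypotenuse is x = Y, and [sg = -1] selects the modes symmetric across it,
   hence Neumann there. Even frequencies vanish on both legs, and the lowest nonzero mode is (2, 2),
   so frequency 5 is absent. *)
apply: (@trig_asymptotics R (small_triangle_A R) 3 (-1) (-1) 1 (-1) 1 (-1) 2^-1 2 2
  (fun a b => ~~ a && ~~ b) e eE) => //.
- exact: open_region.
- exact: small_triangle_A_box.
- by move=> z /region_small_triangle_A[? ? ?]; rewrite /affine; lra.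
- move=> z Kz ez; have [? ?] := strict z Kz ez; rewrite /affine => ?.
  by apply/region_small_triangle_A; split => //; lra.
- move=> z Kz ez; have [a b c] := closure_small_triangle_A Kz.
  case: (dich z Kz) => [h|[h|/e_gt0/(_ c)]]; last by rewrite ltNge ez.
  + on_edge 2%N (1 - z.2).
  + on_edge 0%N z.1.
- move=> z Kz ez; have [a b] := strict z Kz ez; rewrite /affine => lz.
  have [|k [h1 h2]] := @inward_normal _ (small_triangle_A R) 1%N.
    by apply/eqP => /(congr1 snd) /= /eqP; rewrite subr0 oner_eq0.
  exists 1%N, k; split => //.
    by apply: (@open_edge_intro _ _ _ _ z.2); rewrite /vertex /edge_vector /=; lra.
  by rewrite -h1 -h2 /edge_vector /vertex /=; split; ring.
- by rewrite sqrrN expr1n.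
- by right; right.
- by do 6 case.
- by right.
- move=> z /region_small_triangle_A[a b c]; rewrite e_gt0 ?(ltW c)//=.
  rewrite /e (le_trans (ler_norm _))// normrM -[leRHS]mulr1.
  by rewrite ler_pM// Sin_le1.
- move=> i j _ z _; rewrite /affine => lz.
  have -> : z = (1 - z.2, z.2) by case: z lz => x y /= lz; congr pair; lra.
  by rewrite /bas1 /bas2 /= !mulN1r; ring.
- move=> i j /andP[pi_ pj].
  have [A A0 hA] := Sin_bound_even R pi_; have [B B0 hB] := Sin_bound_even R pj.
  exists (2 * A * B) => z Kz.
  rewrite -[e z]ger0_norm ?e_ge0// /e /bas /basis mulN1r -(Sin2_complement z.2).
  rewrite (le_trans (ler_normB _ _))// mulN1r normrN !normrM.
  have h1 := ler_pM (normr_ge0 _) (normr_ge0 _) (hA z.1) (hB (1 - z.2)).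
  have h2 := ler_pM (normr_ge0 _) (normr_ge0 _) (hA (1 - z.2)) (hB z.1).
  rewrite (le_trans (lerD h1 h2))// le_eqVlt; apply/orP; left; apply/eqP; ring.
- apply: small_frequencies => -[|[|[|m]]] [|[|[|n]]] // _ _ _; rewrite /index /par //= => _.
  1-3: by exists 0 => z; rewrite /bas /basis ?Sin_0; ring.
- by left.
Qed.

Lemma heat_small_triangle_B : content_asymptotics (small_triangle_B R) 0.
Proof.
have lead0 : (\int[mu2]_(z in region (small_triangle_B R)) (cst 0 z)) ^+ 2 /
    \int[mu2]_(z in region (small_triangle_B R)) (cst 0 z ^+ 2) = 0 :> R.
  by rewrite /Rintegral integral0 expr0n mul0r.
rewrite -lead0 => u [heat init] t t0.
pose e z := 2^-1 * (S3 z.1 * S1 (1 - z.2) - S3 (1 - z.2) * S1 z.1).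
have eE z : e z = 2^-1 * bas 1 1 (-1) 3 1 z.
  by rewrite /bas /basis /e mulN1r mul1r.
have e_prod z : e z = S1 z.1 * S1 (1 - z.2) * (C2 z.1 - C2 (1 - z.2)).
  by rewrite /e Sin_triple_diff; field.
have dich z : closure (region (small_triangle_B R)) z ->
    z.1 = 0 \/ z.1 + z.2 = 1 \/ [/\ 0 < z.1 & z.1 + z.2 < 1].
  move=> /closure_small_triangle_B[a b c].
  have [?|x0] := eqVneq z.1 0; first by left.
  have [?|s1] := eqVneq (z.1 + z.2) 1; first by right; left.
  by do 2 right; rewrite neq_gt0// neq_lt.
have e0 z : z.1 = 0 \/ z.1 + z.2 = 1 -> e z = 0.
  rewrite e_prod => -[->|h]; first by rewrite Sin0 !mul0r.
  have -> : 1 - z.2 = z.1 by rewrite -h; ring.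
  by rewrite subrr mulr0.
have e_gt0 z : [/\ 0 < z.1 & z.1 + z.2 < 1] -> 0 <= z.2 -> 0 < e z.
  move=> [a b] c; rewrite e_prod mulr_gt0//.
    by rewrite mulr_gt0// Sin1_gt0//; apply/andP; split; lra.
  by rewrite subr_gt0 Cos2_decr//; lra.
have e_ge0 z : closure (region (small_triangle_B R)) z -> 0 <= e z.
  move=> Kz; have [_ b _] := closure_small_triangle_B Kz.
  by case: (dich z Kz) => [h|[h|h]]; [rewrite e0//; tauto|rewrite e0//; tauto|exact/ltW/e_gt0].
have strict z : closure (region (small_triangle_B R)) z -> 0 < e z -> [/\ 0 < z.1 & z.1 + z.2 < 1].
  by move=> /dich[h|[h|//]]; rewrite e0 ?ltxx//; tauto.
(* With [Y = 1 - y], antisymmetry across x = Y gives the Dirichlet hypotenuse, and odd frequencies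
   have zero slope at Y = 1, the Neumann leg. The mode (1, 1) cancels by antisymmetry, so the lowest
   one is (3, 1). *)
apply: (@trig_asymptotics R (small_triangle_B R) 3 0 1 0 1 1 (-1) 2^-1 3 1
  (fun a b => a && b) e eE) => //.
- exact: open_region.
- exact: small_triangle_B_box.
- by move=> z /region_small_triangle_B[? ? ?]; rewrite /affine; lra.
- move=> z Kz ez; have [? ?] := strict z Kz ez; rewrite /affine => ?.
  by apply/region_small_triangle_B; split => //; lra.
- move=> z Kz ez; have [a b c] := closure_small_triangle_B Kz.
  case: (dich z Kz) => [h|[h|/e_gt0/(_ b)]]; last by rewrite ltNge ez.
  + on_edge 2%N (1 - z.2).
  + on_edge 1%N z.2.
- move=> z Kz ez; have [a b] := strict z Kz ez; rewrite /affine => lz.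
  have [|k [h1 h2]] := @inward_normal _ (small_triangle_B R) 0%N.
    by apply/eqP => /(congr1 fst) /= /eqP; rewrite subr0 oner_eq0.
  exists 0%N, k; split => //.
    by apply: (@open_edge_intro _ _ _ _ z.1); rewrite /vertex /edge_vector /=; lra.
  by rewrite -h1 -h2 /edge_vector /vertex /=; split; ring.
- by rewrite sqrrN expr1n.
- by right; left.
- by do 6 case.
- by right.
- move=> z /region_small_triangle_B[a b c]; rewrite e_gt0 ?(ltW b)//=.
  by apply: half_sub_le1; exact: Sin_le1.
- move=> i j /andP[pi_ pj] z _; rewrite /affine => lz.
  have y0 : z.2 = 0 by lra.
  by rewrite /bas2 y0 mulr0 addr0 (Cos_odd1 R pi_) (Cos_odd1 R pj); ring.
- move=> i j /andP[pi_ pj]; have [A A0 hA] := Sin_antisym_bound_odd R pi_ pj.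
  exists A => z Kz; rewrite /bas /basis mul1r mulN1r.
  by rewrite -[e z]ger0_norm ?e_ge0// e_prod.
- apply: small_frequencies => -[|[|[|m]]] [|[|[|n]]] // _ _ _; rewrite /index /par //= => _.
  by exists 0 => z; rewrite /bas /basis; ring.
- by left.
Qed.

End TriangleHeat.

(** * Total heat content and comparison of the expansions *)

Section HeatContent.
Variable R : realType.

(** The initial condition concerns the sum of the L^2 errors; its terms are nonnegative, so each of
    them tends to 0. *)
Lemma heat_solution_flow (M : seq (polygon R)) (u : 'I_(size M) -> R -> R * R -> R) :
  heat_solution u -> forall i : 'I_(size M), heat_flow (nth [::] M i) (u i).
Proof.
move=> [heat init] i; split; first exact: heat.
pose I (j : 'I_(size M)) t := (\int[area_measure R]_(x in region (nth [::] M j))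
  ((u j t x - 1) ^+ 2)%:E)%E.
have I0 j t : (0 <= I j t)%E by apply: integral_ge0 => x _; rewrite lee_fin sqr_ge0.
apply: (@squeeze_cvge _ _ _ _ (cst 0%E) _ (fun t => \sum_(j < size M) I j t)%E); last 2 first.
- exact: cvg_cst.
- exact: init.
apply: nearW => t; rewrite I0/= (bigD1 i)//= leeDl//.
by apply: sume_ge0 => j _; exact: I0.
Qed.

Lemma heat_content_bound (M : seq (polygon R)) (c : nat -> R)
    (u : 'I_(size M) -> R -> R * R -> R) :
  (forall i, (i < size M)%N -> content_asymptotics (nth [::] M i) (c i)) ->
  heat_solution u -> exists C, forall t, 0 < t ->
  `|heat_content u t - (\sum_(i < size M) c i) * expR (- (5 * pi ^+ 2 * t / 4))|
  <= C * expR (- (2 * pi ^+ 2 * t)).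
Proof.
move=> hc hu; exists (\sum_(i < size M) fine (mu2 (region (nth [::] M i)))) => t t0.
rewrite /heat_content mulr_suml -sumrB mulr_suml (le_trans (ler_norm_sum _ _ _))//.
apply: ler_sum => i _; have := hc i (ltn_ord i) _ (heat_solution_flow hu i) t t0.
rewrite mulrC /eigenvalue.
have -> : pi ^+ 2 / 4 * 5%N%:R * t = 5 * pi ^+ 2 * t / 4 :> R by field.
by have -> : pi ^+ 2 / 4 * 8%N%:R * t = 2 * pi ^+ 2 * t :> R by field.
Qed.

Lemma heat_content_A (u : 'I_(size (A R)) -> R -> R * R -> R) : heat_solution u ->
  exists C, forall t, 0 < t ->
  `|heat_content u t - 1600 / (9 * pi ^+ 4) * expR (- (5 * pi ^+ 2 * t / 4))|
  <= C * expR (- (2 * pi ^+ 2 * t)).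
Proof.
pose c := nth 0 [:: 64 / pi ^+ 4; 1024 / (9 * pi ^+ 4); 0 : R].
have -> : 1600 / (9 * pi ^+ 4) = \sum_(i < size (A R)) c i.
  by rewrite !big_ord_recl big_ord0 /c /=; pi_field.
apply: heat_content_bound => -[|[|[|i]]] //= _.
- exact: heat_square_A.
- exact: heat_large_triangle_A.
- exact: heat_small_triangle_A.
Qed.

Lemma heat_content_B (u : 'I_(size (B R)) -> R -> R * R -> R) : heat_solution u ->
  exists C, forall t, 0 < t ->
  `|heat_content u t - 1664 / (9 * pi ^+ 4) * expR (- (5 * pi ^+ 2 * t / 4))|
  <= C * expR (- (2 * pi ^+ 2 * t)).
Proof.
pose c := nth 0 [:: 512 / (9 * pi ^+ 4); 128 / pi ^+ 4; 0 : R].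
have -> : 1664 / (9 * pi ^+ 4) = \sum_(i < size (B R)) c i.
  by rewrite !big_ord_recl big_ord0 /c /=; pi_field.
apply: heat_content_bound => -[|[|[|i]]] //= _.
- exact: heat_large_triangle_B.
- exact: heat_rectangle_B.
- exact: heat_small_triangle_B.
Qed.

Lemma eqaddO_bound (f g h : R -> R) (C : R) :
  (forall t, 0 < t -> `|f t - g t| <= C * h t) -> (forall t, 0 <= h t) ->
  (f : R -> R^o) = g +O_ (+oo_ R) (h : R -> R^o).
Proof.
move=> fg h0; apply/eqaddOP; near=> k; near=> t => /=.
apply: (@le_trans _ _ (C * h t)); first by apply: fg; near: t; exact: nbhs_pinfty_gt.
rewrite ger0_norm// ler_wpM2r//; near: k; apply: nbhs_pinfty_ge; exact: num_real.
Unshelve. all: by end_near. Qed.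

(** Subtracting the expansions gives |a - b| exp((l - k) t) <= C + C' for all t > 0, which growth of
    the exponential excludes unless a = b. *)
Lemma asymptotics_unique (q : R -> R) (a b k l C C' : R) : k < l ->
  (forall t, 0 < t -> `|q t - a * expR (- (k * t))| <= C * expR (- (l * t))) ->
  (forall t, 0 < t -> `|q t - b * expR (- (k * t))| <= C' * expR (- (l * t))) -> a = b.
Proof.
move=> kl ha hb; apply/eqP; rewrite -subr_eq0 -normr_le0 leNgt; apply/negP => d0.
set d := `|a - b| in d0; have lk : 0 < l - k by rewrite subr_gt0.
(* Chosen so that already the lower bound exp x >= 1 + x makes the left side [d + (|C + C'| + 1)],
   more than [C + C']. *)
pose t := (`|C + C'| + 1) / (d * (l - k)).
have t0 : 0 < t by rewrite divr_gt0 ?mulr_gt0// ltr_wpDl.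
have h : d * expR (- (k * t)) <= (C + C') * expR (- (l * t)).
  have -> : d * expR (- (k * t)) =
      `|(q t - b * expR (- (k * t))) - (q t - a * expR (- (k * t)))|.
    by rewrite /d -[X in _ * X](gtr0_norm (expR_gt0 _)) -normrM; congr (`|_|); ring.
  rewrite [leRHS]mulrDl.
  by rewrite (le_trans (ler_normB _ _))// addrC lerD ?ha ?hb.
have {}h : d * expR ((l - k) * t) <= C + C'.
  rewrite -(ler_pM2r (expR_gt0 (- (l * t)))) (le_trans _ h)// -mulrA -expRD.
  by rewrite (_ : (l - k) * t + - (l * t) = - (k * t))//; ring.
have : d * (1 + (l - k) * t) <= C + C'.
  by rewrite (le_trans _ h)// ler_pM2l// expR_ge1Dx.
have -> : d * (1 + (l - k) * t) = d + (`|C + C'| + 1).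
  by rewrite /t; field; rewrite !gt_eqF.
by have := ler_norm (C + C'); lra.
Qed.

End HeatContent.

Theorem corollary9 (R : realType) :
  ~ isoheat (A R) (B R) /\
  (forall u : 'I_(size (A R)) -> R -> R * R -> R, heat_solution u ->
     (heat_content u : R -> R^o) =
       (fun t => 1600 / (9 * pi ^+ 4) * expR (- (5 * pi ^+ 2 * t / 4)))
       +O_ (+oo_ R) (fun t => expR (- (2 * pi ^+ 2 * t)) : R^o)) /\
  (forall u : 'I_(size (B R)) -> R -> R * R -> R, heat_solution u ->
     (heat_content u : R -> R^o) =
       (fun t => 1664 / (9 * pi ^+ 4) * expR (- (5 * pi ^+ 2 * t / 4)))
       +O_ (+oo_ R) (fun t => expR (- (2 * pi ^+ 2 * t)) : R^o)).
Proof.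
split; last first.
  split=> u hu.
    have [C hC] := heat_content_A hu.
    by apply: eqaddO_bound hC _ => t; exact: expR_ge0.
  have [C hC] := heat_content_B hu.
  by apply: eqaddO_bound hC _ => t; exact: expR_ge0.
move=> [u1 [u2 [h1 h2 E]]].
have [C1 hC1] := heat_content_A h1; have [C2 hC2] := heat_content_B h2.
have p2 : 0 < pi ^+ 2 :> R by rewrite exprn_gt0// pi_gt0.
have rate (t : R) : 5 * pi ^+ 2 * t / 4 = 5 * pi ^+ 2 / 4 * t by ring.
have kl : 5 * pi ^+ 2 / 4 < 2 * pi ^+ 2 :> R by lra.
(* A common heat content would have both expansions, and the error decays faster than the leading
   term since 5 / 4 < 2. *)
have : 1600 / (9 * pi ^+ 4) = 1664 / (9 * pi ^+ 4) :> R.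
  apply: (@asymptotics_unique R (heat_content u1) _ _ _ _ C1 C2 kl) => t t0.
    by rewrite -rate; exact: hC1.
  by rewrite -rate E//; exact: hC2.
have p4 : 0 < 9 * pi ^+ 4 :> R by rewrite mulr_gt0// exprn_gt0// pi_gt0.
move/mulIf => /(_ (invr_neq0 (lt0r_neq0 p4)))/eqP.
by rewrite eqr_nat.
Qed.
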